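(* Let $n\ge 3$, $N\ge 1$, $m\ge 1$ be integers and $0<\alpha<1$. Let $a=a(p_{-1},p_0,p_1,\ldots,p_{2m})$ be an $\mathbb{R}^N$-valued function, where $p_{-1}\in\mathbb{R}^n$ is the slot of the variable $x$ and $p_j$ is the slot of $\nabla^j u$. If $a\in\mathcal{C}^2$ and $a(0)=\nabla_{p_{2m}}a(0)=\nabla^2_{p_{2m}}a(0)=0$, then there exist infinitely many solutions $u=(u_1,\ldots,u_N)$ in the class $\mathcal{C}^{2m,\alpha}$ to the system $$\triangle^m u(x)=a(x,u,\nabla u,\ldots,\nabla^{2m}u)$$ in some small neighborhood of $0\in\mathbb{R}^n$. Moreover, all those solutions are of vanishing order $2m$ at $0$ and are not radially symmetric.
   Context: $\triangle$ is the Laplacian on $\mathbb{R}^n$ (acting componentwise) and $\triangle^m$ its $m$-th iterate. $\nabla^j u$ denotes the collection of all $j$-th order partial derivatives of all components of $u$, i.e. $(D^\beta u_l)_{|\beta|=j,\,1\le l\le N}$, with $\nabla^0u=u$. The function $a$ is defined on the whole Euclidean space of its variables; $\nabla_{p_{2m}}a$ and $\nabla^2_{p_{2m}}a$ are the collections of first and second order partial derivatives of $a$ with respect to the $p_{2m}$ variables only, and evaluation at $0$ means at the origin of the space of all variables. $u$ is of class $\mathcal{C}^{2m,\alpha}$ on a neighborhood if its partial derivatives up to order $2m$ exist and are continuous and those of order $2m$ are Hölder continuous with exponent $\alpha$. A function $u\in\mathcal{C}^k$ is of vanishing order $l$ ($l\le k$) at $0$ if $\nabla^j u(0)=0$ for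 $0\le j\le l-1$ and $\nabla^l u(0)\ne 0$. A function is radially symmetric if it depends only on $|x|$. ''All those solutions'' refers to the infinitely many solutions asserted to exist. *)

(* Defs.v *)
From mathcomp Require Import all_boot all_order all_algebra.
From mathcomp Require Import all_classical all_reals all_analysis.
Import Order.TTheory GRing.Theory Num.Theory.
Import numFieldNormedType.Exports.

Set Implicit Arguments.
Unset Strict Implicit.
Unset Printing Implicit Defensive.

Local Open Scope classical_set_scope.
Local Open Scope ring_scope.

Definition enorm {R : realType} {d : nat} (x : 'rV[R]_d) : R :=
  Num.sqrt (\sum_(i < d) x 0 i ^+ 2).

Definition coord_fun {R : realType} {d N : nat} (f : 'rV[R]_d -> 'rV[R]_N)
  (l : 'I_N) : 'rV[R]_d -> R := fun x => f x 0 l.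

Definition pderiv {R : realType} {d : nat} (i : 'I_d) (f : 'rV[R]_d -> R) :
  'rV[R]_d -> R := fun x => 'D_(delta_mx 0 i) f x.

Definition laplacian {R : realType} {d : nat} (f : 'rV[R]_d -> R) :
  'rV[R]_d -> R := fun x => \sum_(i < d) pderiv i (pderiv i f) x.

Definition mi_order {d : nat} (beta : 'I_d -> nat) : nat :=
  (\sum_(i < d) beta i)%N.

Definition mderiv {R : realType} {d : nat} (beta : 'I_d -> nat)
  (f : 'rV[R]_d -> R) : 'rV[R]_d -> R :=
  foldr (fun i g => iter (beta i) (pderiv i) g) f (enum 'I_d).

(* All partial derivatives of order at most k, taken in any order of the
   variables, exist and are continuous at every point of U (U is meant to be
   open).  The existence clause is needed because 'D_v is a total operator. *)
Fixpoint Ck_scalar {R : realType} {d : nat} (U : set 'rV[R]_d) (k : nat)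
  (f : 'rV[R]_d -> R) : Prop :=
  (forall x, U x -> {for x, continuous f}) /\
  if k is k'.+1 then
    forall i : 'I_d,
      (forall x, U x -> derivable f x (delta_mx 0 i)) /\
      Ck_scalar U k' (pderiv i f)
  else True.

Definition Ck {R : realType} {d N : nat} (U : set 'rV[R]_d) (k : nat)
  (f : 'rV[R]_d -> 'rV[R]_N) : Prop :=
  forall l : 'I_N, Ck_scalar U k (coord_fun f l).

Definition holder_on {R : realType} {d : nat} (U : set 'rV[R]_d) (alpha : R)
  (f : 'rV[R]_d -> R) : Prop :=
  exists C : R, forall x y, U x -> U y ->
    `|f x - f y| <= C * enorm (x - y) `^ alpha.

Definition Ckalpha {R : realType} {d N : nat} (U : set 'rV[R]_d) (k : nat)
  (alpha : R) (f : 'rV[R]_d -> 'rV[R]_N) : Prop :=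
  Ck U k f /\
  forall (beta : 'I_d -> nat) (l : 'I_N),
    mi_order beta = k -> holder_on U alpha (mderiv beta (coord_fun f l)).

Definition vanishing_order_at0 {R : realType} {d N : nat} (k : nat)
  (f : 'rV[R]_d -> 'rV[R]_N) : Prop :=
  (forall (beta : 'I_d -> nat) (l : 'I_N),
     (mi_order beta < k)%N -> mderiv beta (coord_fun f l) 0 = 0) /\
  (exists (beta : 'I_d -> nat) (l : 'I_N),
     mi_order beta = k /\ mderiv beta (coord_fun f l) 0 <> 0).

Definition radially_symmetric {R : realType} {d N : nat} (U : set 'rV[R]_d)
  (f : 'rV[R]_d -> 'rV[R]_N) : Prop :=
  forall x y, U x -> U y -> enorm x = enorm y -> f x = f y.

(* Multi-indices of order at most k, as a finite type. *)
Definition mindex (n k : nat) : finType :=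
  {beta : {ffun 'I_n -> 'I_k.+1} | (\sum_(i < n) beta i <= k)%N}.

Definition mi_fun {n k : nat} (beta : mindex n k) : 'I_n -> nat :=
  fun i => val beta i.

(* The scalar variables of (p_{-1}, p_0, ..., p_k): [inl i] is the i-th
   coordinate of p_{-1}, and [inr (beta, l)] is the coordinate of p_{|beta|}
   that receives D^beta u_l.  The space of all variables is
   'rV[R]_#|slot n N k|, coordinates being numbered through enum_rank. *)
Definition slot (n N k : nat) : finType := ('I_n + mindex n k * 'I_N)%type.

Definition top_slot {n N k : nat} (s : slot n N k) : bool :=
  if s is inr (beta, _) then mi_order (mi_fun beta) == k else false.

(* The point (x, u(x), nabla u(x), ..., nabla^k u(x)). *)
Definition jet {R : realType} {n N : nat} (k : nat)
  (u : 'rV[R]_n -> 'rV[R]_N) (x : 'rV[R]_n) : 'rV[R]_#|slot n N k| :=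
  \row_j match enum_val j with
         | inl i => x 0 i
         | inr (beta, l) => mderiv (mi_fun beta) (coord_fun u l) x
         end.

Definition slot_deriv {R : realType} {n N k : nat} (s : slot n N k)
  (f : 'rV[R]_#|slot n N k| -> R) : 'rV[R]_#|slot n N k| -> R :=
  pderiv (enum_rank s) f.

(* Main.v *)
Require Import Defs.
From mathcomp Require Import all_boot all_order all_algebra.
From mathcomp Require Import all_classical all_reals all_analysis.
From mathcomp Require Import ring lra zify.
Import Order.TTheory GRing.Theory Num.Theory.
Import numFieldNormedType.Exports.

Set Implicit Arguments.
Unset Strict Implicit.
Unset Printing Implicit Defensive.

Local Open Scope classical_set_scope.
Local Open Scope ring_scope.

(** The polynomial h(x) = x_0^(2m-1) x_1 satisfies Delta^m h = 0, has vanishing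
    order 2m at the origin and is odd in x_0, hence not radial.  The solutions
    are perturbations of small multiples of h on a small ball.  For
    u(x) = r^(2m) v(x/r) the system reads

      Delta^m v = a(r x, (r^(2m-|b|) D^b v)_b),

    and v = eps h + w is sought on a fixed ball, with eps of size del, r = del^2
    and w of size del^2 in C^(2m,alpha).  The right-hand side is of size del^2,
    and depends on v with a Lipschitz constant of order del: the top slots enter
    [a] at second order only, as a(0) and the derivatives of [a] in these slots
    vanish at 0, and all other slots carry a factor r ([hol_comp_diff],
    [rhs_estimates]).  If w vanishes to order 2m at the origin, then v inherits
    from eps h the vanishing order and the lack of symmetry, and different eps
    give different solutions ([scaled_family]).

    To find w, the Laplacian has to be inverted on Hoelder functions, with a gain
    of two derivatives.  A compactly supported kernel with
    Delta ker (x) = 2^n bmp(2x) - bmp(x) is explicit ([exists_kernel]).  Summing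
    its convolutions with f over all dyadic scales gives a function whose
    Laplacian telescopes to f - avg f, where avg f is the convolution of f with
    the bump, and the Schauder estimate becomes the summation [dyadic_sum].  All
    that convolution requires of the integral is linearity, a bound by volumes
    of cubes, and invariance under translations; a limit of grid sums along an
    ultrafilter has these properties on all bounded Hoelder functions
    ([exists_mean]).  The outcome is [exists_solver]: operators slv and avg that
    commute with partial derivatives and satisfy Delta (slv f) = f - avg f.

    Iteration gives Delta^m (slv^m f) = (1 - avg)^m f ([iter_laplacian_slv]).  The
    error f - (1 - avg)^m f is small if f lives on a small cube
    ([iter_rem_small]), so it can be absorbed in a contraction: a fixed point f of
    f = chi (a(...) + f - (1 - avg)^m f), with a cutoff chi, satisfies
    (1 - avg)^m f = a(...) where chi = 1.  Subtracting from slv^m f its Taylor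
    polynomial of degree 2m-1, which Delta^m kills, yields w ([sol],
    [fixed_points]). *)

Local Notation "''e_' i" := (delta_mx 0 i)
  (at level 8, i at level 2, format "''e_' i").


(** * Coordinates and partial derivatives *)

Section Coordinates.
Context {R : realType} {n : nat}.
Implicit Types (x y p q : 'rV[R]_n) (f g : 'rV[R]_n -> R).

Lemma coord_le_norm x i : `|x 0 i| <= `|x|.
Proof.
by rewrite [leRHS]/Num.norm /= mx_normrE; apply/bigmax_geP; right => /=; exists (0, i).
Qed.

Lemma norm_le_coord x (A : R) : 0 <= A -> (forall i, `|x 0 i| <= A) -> `|x| <= A.
Proof.
move=> A0 H; rewrite [leLHS]/Num.norm /= mx_normrE; apply/bigmax_leP; split => //=.
by move=> [i j] _ /=; rewrite ord1.
Qed.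

Lemma norm_ei (i : 'I_n) : `|'e_i : 'rV[R]_n| = 1.
Proof.
apply/eqP; rewrite eq_le; apply/andP; split.
  by apply: norm_le_coord => // j; rewrite mxE eqxx /=; case: (j == i); rewrite ?normr0 ?normr1.
by apply: le_trans (coord_le_norm _ i); rewrite mxE !eqxx normr1.
Qed.

Lemma norm_sei (h : R) (i : 'I_n) : `|h *: ('e_i : 'rV[R]_n)| = `|h|.
Proof. by rewrite normrZ norm_ei mulr1. Qed.

Lemma is_derive_line f (i : 'I_n) x (d t : R) :
  derivable f (x + (t * d) *: 'e_i) 'e_i ->
  is_derive t 1 (fun s : R => f (x + (s * d) *: 'e_i))
    (d * pderiv i f (x + (t * d) *: 'e_i)).
Proof.
move=> df.
set g := fun s : R => f (x + s *: 'e_i).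
have E s : (fun h : R => h^-1 *: ((g \o shift s) (h *: 1) - g s)) =
   (fun h : R => h^-1 *: ((f \o shift (x + s *: 'e_i)) (h *: 'e_i) - f (x + s *: 'e_i))).
  apply/funext => h; rewrite /g /= [h *: 1]mulr1 scalerDl.
  by rewrite [_ *: 'e_i + (x + _)]addrCA.
have gd : is_derive (t * d) 1 g (pderiv i f (x + (t * d) *: 'e_i)).
  apply: DeriveDef; first by rewrite /derivable E.
  by rewrite /pderiv /derive E.
have hd : is_derive t 1 (fun s : R => s * d) d.
  have := @is_deriveZ _ _ _ (@id R) d t 1 1 (is_derive_id _ _).
  rewrite [d *: 1]mulr1; congr is_derive.
  by apply/funext => s; rewrite /= mulrC.
by have := @is_derive1_comp _ g (fun s => s * d) t _ _ gd hd; rewrite mulrC.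
Qed.

Lemma MVT01 (f df : R -> R) : (forall t : R, 0 <= t <= 1 -> is_derive t 1 f (df t)) ->
  exists2 c : R, 0 <= c <= 1 & f 1 - f 0 = df c.
Proof.
move=> H.
have [|||c] := @MVT _ f df 0 1.
- by [].
- by move=> x; rewrite in_itv /= => /andP[? ?]; apply: H; rewrite !ltW.
- apply: derivable_within_continuous => x; rewrite in_itv /= => xi.
  by have [] := H _ xi.
rewrite in_itv /= => /andP[c0 c1]; rewrite subr0 mulr1 => ->.
by exists c => //; rewrite !ltW.
Qed.

Lemma MVT_coord f (i : 'I_n) x (h : R) :
  (forall t : R, 0 <= t <= 1 -> derivable f (x + (t * h) *: 'e_i) 'e_i) ->
  exists2 t : R, 0 <= t <= 1 &
    f (x + h *: 'e_i) - f x = h * pderiv i f (x + (t * h) *: 'e_i).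
Proof.
move=> df.
have [t t01|t t01] := @MVT01 (fun s : R => f (x + (s * h) *: 'e_i))
  (fun t => h * pderiv i f (x + (t * h) *: 'e_i)).
  exact/is_derive_line/df.
by rewrite mul1r mul0r scale0r addr0; exists t.
Qed.

(** An expansion whose remainder beats [h] determines the derivative.  Operators
    given by infinite sums are differentiated below in this way: the remainders
    are summed, and no exchange of a limit with a derivative is needed. *)
Lemma derive_of_bound (alpha : R) f (d B : R) (i : 'I_n) x : 0 < alpha ->
  (forall h, `|h| <= 1 -> `|f (x + h *: 'e_i) - f x - h * d| <= B * (`|h| * `|h| `^ alpha)) ->
  derivable f x 'e_i /\ pderiv i f x = d.
Proof.
move=> a0 H.
suff C : (h^-1 *: (f (h *: 'e_i + x) - f x)) @[h --> 0^'] --> d.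
  by split; [apply/cvg_ex; exists d|apply/cvg_lim].
apply/cvgrPdist_le => e e0.
have B0 : 0 <= Num.max B 1 by rewrite le_max ler01 orbT.
have M0 : 0 < Num.max B 1 by rewrite lt_max ltr01 orbT.
near=> h.
have h0 : h != 0 by near: h; exact: nbhs_dnbhs_neq.
have h1 : `|h| <= 1.
  near: h; apply: dnbhs0_le; exact: ltr01.
have h2 : `|h| <= (e / Num.max B 1) `^ (alpha^-1).
  near: h; apply: dnbhs0_le; apply: powR_gt0; exact: divr_gt0.
rewrite -(ler_pM2l (_ : 0 < `|h|)); last by rewrite normr_gt0.
rewrite -normrM mulrBr mulVKf// distrC (addrC _ x).
apply: le_trans (H h h1) _.
rewrite mulrCA ler_pM2l ?normr_gt0//.
apply: (@le_trans _ _ (Num.max B 1 * `|h| `^ alpha)).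
  by apply: ler_wpM2r; [exact: powR_ge0|rewrite le_max lexx].
rewrite -ler_pdivlMl// mulrC.
have -> : e / Num.max B 1 = ((e / Num.max B 1) `^ alpha^-1) `^ alpha.
  rewrite -powRrM mulVf ?gt_eqF// powRr1// ltW// divr_gt0//.
by rewrite ge0_ler_powR// ?nnegrE// ?ltW// powR_gt0// divr_gt0.
Unshelve. all: by end_near. Qed.

(** The vertices of a path from [p] to [q] along the axes, which reduces
    increments to those controlled by partial derivatives. *)
Definition hyb (k : nat) p q : 'rV[R]_n :=
  \row_j (if (j < k)%N then q 0 j else p 0 j).

Lemma hyb0 p q : hyb 0 p q = p.
Proof. by apply/rowP => j; rewrite mxE. Qed.

Lemma hybn p q : hyb n p q = q.
Proof. by apply/rowP => j; rewrite mxE ltn_ord. Qed.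

Lemma hybS p q (k : 'I_n) :
  hyb k.+1 p q = hyb k p q + (q 0 k - p 0 k) *: 'e_k.
Proof.
apply/rowP => j; rewrite !mxE eqxx /= ltnS leq_eqVlt.
have [->|jk] := eqVneq j k; first by rewrite eqxx ltnn /= mulr1 addrC subrK.
by rewrite -val_eqE in jk; rewrite (negbTE jk) /= mulr0 addr0.
Qed.

Lemma hyb_telescope f p q :
  f q - f p = \sum_(k < n) (f (hyb k p q + (q 0 k - p 0 k) *: 'e_k) - f (hyb k p q)).
Proof.
rewrite -[in LHS](hybn p q) -[X in _ - f X](hyb0 p q).
rewrite -(telescope_sumr (fun k => f (hyb k p q)) (leq0n n)) big_mkord.
by apply: eq_bigr => k _; rewrite hybS.
Qed.

End Coordinates.

(** * Grid sums *)

Definition bnd {T : Type} {R : realType} (F : T -> R) := exists A : R, forall y, `|F y| <= A.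

Section BoundedFunctions.
Context {T : Type} {R : realType}.
Implicit Types (F G : T -> R).

Lemma bnd0 : bnd (fun _ : T => 0 : R).
Proof. by exists 0 => y; rewrite normr0. Qed.

Lemma bnd_lin a F G : bnd F -> bnd G -> bnd (fun y => a * F y + G y).
Proof.
move=> [A FA] [B GB]; exists (`|a| * A + B) => y.
apply: le_trans (ler_normD _ _) _; apply: lerD => //.
by rewrite normrM ler_wpM2l.
Qed.

Variable P : (T -> R) -> R.
Hypothesis P_lin : forall a F G, bnd F -> bnd G -> P (fun y => a * F y + G y) = a * P F + P G.

Lemma lin_cst0 : P (fun=> 0) = 0.
Proof.
have E := P_lin (-1) bnd0 bnd0; rewrite mulN1r addNr in E.
by rewrite E mulN1r addNr.
Qed.

Lemma lin_sum (J : Type) (s : seq J) (F : J -> T -> R) : (forall i, bnd (F i)) ->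
  bnd (fun y => \sum_(i <- s) F i y) /\
  P (fun y => \sum_(i <- s) F i y) = \sum_(i <- s) P (F i).
Proof.
move=> Fb; elim: s => [|i s [sb IH]].
  have -> : (fun y => \sum_(i <- [::]) F i y) = (fun=> 0) by apply/funext => y; rewrite big_nil.
  by split; [exact: bnd0|rewrite lin_cst0 big_nil].
have -> : (fun y => \sum_(j <- i :: s) F j y) = (fun y => 1 * F i y + \sum_(j <- s) F j y).
  by apply/funext => y; rewrite big_cons mul1r.
by split; [exact: bnd_lin|rewrite P_lin// IH mul1r big_cons].
Qed.

End BoundedFunctions.

Section GridMean.
Context {R : realType} {n : nat}.
Implicit Types (x y c : 'rV[R]_n) (F G : 'rV[R]_n -> R).

(** The grid is [2^-j Z^n] on the cube of half-width 4, which leaves a margin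
    around the functions to be averaged, all supported in smaller cubes. *)
Definition grid_idx (j : nat) := {ffun 'I_n -> 'I_(8 * 2 ^ j).+1}.

Definition grid_pt (j : nat) (z : grid_idx j) : 'rV[R]_n :=
  \row_i ((z i)%:R / 2 ^+ j - 4).

Definition riem (j : nat) F : R :=
  (2 ^+ j) ^- n * \sum_(z : grid_idx j) F (grid_pt z).

Lemma riem_lin j a F G : riem j (fun y => a * F y + G y) = a * riem j F + riem j G.
Proof.
rewrite /riem big_split /= -mulr_sumr mulrDr; congr (_ + _).
by rewrite mulrCA.
Qed.

Lemma two_pow_gt0 j : 0 < 2 ^+ j :> R.
Proof. by rewrite exprn_gt0. Qed.

Lemma card_spread (m D : nat) (A : {set 'I_m}) :
  (forall a b, a \in A -> b \in A -> (a <= b + D)%N) -> (#|A| <= D.+1)%N.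
Proof.
move=> H; have [->|[x xA]] := set_0Vmem A; first by rewrite cards0.
have [a0 a0A a0min] := arg_minnP (fun i : 'I_m => nat_of_ord i) xA.
pose g (i : 'I_m) : 'I_D.+1 := inord (i - a0).
have gE i : i \in A -> nat_of_ord (g i) = (i - a0)%N.
  by move=> iA; rewrite inordK// ltnS leq_subLR H.
have ginj : {in A &, injective g}.
  move=> a b aA bA /(congr1 (@nat_of_ord _)); rewrite !gE// => E.
  apply: val_inj => /=; rewrite -(subnK (a0min a aA)) -(subnK (a0min b bA)).
  by rewrite E.
by rewrite -(card_in_imset ginj) (leq_trans (max_card _))// card_ord.
Qed.

(** A cube of half-width [2 * 2^-k] meets each coordinate axis of the grid of
    mesh [2^-j] in at most [5 * 2^(j-k)] points. *)
Lemma riem_cube j k c (A : R) F : (k <= j)%N -> (forall y, `|F y| <= A) ->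
  (forall y, 2 * 2 ^- k < `|y - c| -> F y = 0) ->
  `|riem j F| <= 5 ^+ n * (2 ^+ k) ^- n * A.
Proof.
move=> kj FA F0.
have A0 : 0 <= A by apply: le_trans (FA 0).
pose I (i : 'I_n) : {set 'I_(8 * 2 ^ j).+1} := finset (fun z : 'I_(8 * 2 ^ j).+1 => `|z%:R / 2 ^+ j - 4 - c 0 i| <= 2 * 2 ^- k :> R).
have cI i : (#|I i| <= 5 * 2 ^ (j - k))%N.
  apply: (@leq_trans (4 * 2 ^ (j - k)).+1); last first.
    have : (0 < 2 ^ (j - k))%N by rewrite expn_gt0.
    lia.
  apply: (@card_spread _ (4 * 2 ^ (j - k)) (I i)) => a b; rewrite !inE => Ha Hb.
  rewrite -(ler_nat R) natrD natrM natrX -lerBlDl.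
  have -> : 2 ^+ (j - k) = 2 ^+ j / 2 ^+ k :> R.
    by rewrite expfB_cond ?pnatr_eq0.
  have : `|(a%:R / 2 ^+ j - 4 - c 0 i) - (b%:R / 2 ^+ j - 4 - c 0 i)| <= 4 * 2 ^- k :> R.
    apply: le_trans (ler_normB _ _) _; apply: le_trans (lerD Ha Hb) _.
    by rewrite -mulrDl; lra.
  move=> /(le_trans (ler_norm _)).
  rewrite (_ : _ - _ = (a%:R - b%:R) / 2 ^+ j); last by ring.
  by rewrite ler_pdivrMr ?two_pow_gt0// -mulrA [2 ^- k * _]mulrC.
have E : \sum_(z : grid_idx j) F (grid_pt z) =
    \sum_(z : grid_idx j | z \in family (fun i => mem (I i))) F (grid_pt z).
  rewrite [LHS](bigID (fun z : grid_idx j => z \in family (fun i => mem (I i)))) /=.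
  rewrite [X in _ + X]big1 ?addr0// => z zI; apply: F0.
  rewrite ltNge; apply: contra zI => zc; apply/familyP => i.
  rewrite inE; apply: le_trans zc; apply: le_trans (coord_le_norm _ i).
  by rewrite !mxE.
rewrite /riem E normrM ger0_norm ?invr_ge0 ?exprn_ge0//.
rewrite -mulrA ler_pdivrMl ?exprn_gt0 ?two_pow_gt0//.
apply: le_trans (ler_norm_sum _ _ _) _.
apply: le_trans (ler_sum _ (fun z _ => FA _)) _.
rewrite sumr_const -[A *+ _]mulr_natl !mulrA; apply: ler_wpM2r => //.
rewrite card_family /image_mem foldrE big_map big_enum/=.
apply: (@le_trans _ _ (\prod_(i < n) (5 * 2 ^ (j - k))%N)%:R).
  by rewrite ler_nat; apply: leq_prod => i _; exact: cI.
rewrite prod_nat_const card_ord natrX natrM natrX.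
have -> : 2%:R ^+ (j - k) = 2 ^+ j / 2 ^+ k :> R.
  by rewrite expfB_cond ?pnatr_eq0.
by rewrite mulrA !exprMn exprVn [5 ^+ n * _]mulrC.
Qed.

Lemma riem_bnd j (A : R) F : (forall y, `|F y| <= A) -> `|riem j F| <= 9 ^+ n * A.
Proof.
move=> FA; have A0 : 0 <= A by apply: le_trans (FA 0).
rewrite /riem normrM ger0_norm ?invr_ge0 ?exprn_ge0//.
rewrite ler_pdivrMl ?exprn_gt0 ?two_pow_gt0//.
apply: le_trans (ler_norm_sum _ _ _) _.
apply: le_trans (ler_sum _ (fun z _ => FA _)) _.
rewrite sumr_const -[A *+ _]mulr_natl mulrA; apply: ler_wpM2r => //.
rewrite card_ffun !card_ord natrX -exprMn; apply: lerXn2r; rewrite ?nnegrE ?mulr_ge0 ?exprn_ge0//.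
rewrite -natrX -natrM ler_nat.
have : (0 < 2 ^ j)%N by rewrite expn_gt0.
lia.
Qed.

Lemma riem_ge j k (b : R) F : (k <= j)%N -> 0 <= b -> (forall y, 0 <= F y) ->
  (forall y, `|y| <= 2 ^- k -> b <= F y) -> (2 ^+ k) ^- n * b <= riem j F.
Proof.
move=> kj b0 F0 Fb.
have kj2 : (2 ^ (j - k) <= 2 ^ j)%N by rewrite leq_pexp2l// leq_subr.
have p0 : (0 < 2 ^ j)%N by rewrite expn_gt0.
pose I (i : 'I_n) : {set 'I_(8 * 2 ^ j).+1} := finset (fun z : 'I_(8 * 2 ^ j).+1 => (4 * 2 ^ j <= z < 4 * 2 ^ j + 2 ^ (j - k))%N).
have cI i : (2 ^ (j - k) <= #|I i|)%N.
  pose g (t : 'I_(2 ^ (j - k))) : 'I_(8 * 2 ^ j).+1 := inord (4 * 2 ^ j + t).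
  have gE t : nat_of_ord (g t) = (4 * 2 ^ j + t)%N.
    by rewrite inordK//; have := ltn_ord t; lia.
  have ginj : injective g.
    by move=> a b' /(congr1 (@nat_of_ord _)); rewrite !gE => /addnI /val_inj.
  rewrite -[X in (X <= _)%N]card_ord -(card_imset _ ginj); apply: subset_leq_card.
  by apply/fintype.subsetP => _ /imsetP[t _ ->]; rewrite inE gE leq_addr ltn_add2l ltn_ord.
have E : \sum_(z : grid_idx j | z \in family (fun i => mem (I i))) b <=
   \sum_(z : grid_idx j) F (grid_pt z).
  rewrite [X in _ <= X](bigID (fun z : grid_idx j => z \in family (fun i => mem (I i)))) /=.
  apply: ler_wpDr; first by apply: sumr_ge0 => z _; exact: F0.
  apply: ler_sum => z /familyP zI; apply: Fb; apply: norm_le_coord => [|i].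
    by rewrite invr_ge0 exprn_ge0.
  have := zI i; rewrite inE => /andP[z1 z2].
  rewrite mxE -(subnK z1) natrD mulrDl natrM natrX mulfK ?gt_eqF ?two_pow_gt0//.
  rewrite addrK ger0_norm ?divr_ge0 ?exprn_ge0//.
  rewrite ler_pdivrMr ?two_pow_gt0// mulrC.
  have <- : 2 ^+ (j - k) = 2 ^+ j / 2 ^+ k :> R by rewrite expfB_cond ?pnatr_eq0.
  by rewrite -natrX ler_nat; lia.
rewrite /riem mulrC ler_pdivlMl ?exprn_gt0 ?two_pow_gt0// mulrCA.
apply: le_trans E; rewrite sumr_const -[b *+ _]mulr_natl mulrC ler_wpM2r//.
rewrite -exprVn -exprMn card_family /image_mem foldrE big_map big_enum/=.
have <- : 2 ^+ (j - k) = 2 ^+ j / 2 ^+ k :> R by rewrite expfB_cond ?pnatr_eq0.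
rewrite -natrX -natrX ler_nat -{1}[n]card_ord -prod_nat_const.
by apply: leq_prod => i _; exact: cI.
Qed.

(** A shift by the mesh permutes the grid cyclically in the direction [i]; the
    points that wrap around lie outside the support. *)
Lemma riem_shift1 j (i : 'I_n) F : (forall y, 3 < `|y| -> F y = 0) ->
  riem j (fun y => F (y + 2 ^- j *: 'e_i)) = riem j F.
Proof.
move=> F0; rewrite /riem; congr (_ * _).
pose s (z : grid_idx j) : grid_idx j :=
  [ffun k => if k == i then ordS (z k) else z k].
have sinj : injective s.
  move=> z z' /ffunP E; apply/ffunP => k; have := E k; rewrite !ffunE.
  by case: ifP => // _ /(bij_inj (@ordS_bij _)).
rewrite [RHS](reindex_inj sinj) /=; apply: eq_bigr => z _.
have p0 := two_pow_gt0 j.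
have [zi|zi] := ltnP (z i) (8 * 2 ^ j)%N.
  congr (F _); apply/rowP => k; rewrite !mxE !ffunE eqxx /=.
  have [->|ki] := eqVneq k i; last by rewrite mulr0 addr0.
  rewrite /= modn_small ?ltnS// mulr1 -[in RHS]natr1 mulrDl mul1r.
  by rewrite addrAC.
have Ezi : nat_of_ord (z i) = (8 * 2 ^ j)%N.
  by apply/eqP; rewrite eqn_leq zi andbT -ltnS.
rewrite !F0//.
  apply: lt_le_trans (coord_le_norm _ i); rewrite !mxE ffunE eqxx /= Ezi modnn.
  by rewrite mul0r sub0r normrN ger0_norm ?ltr_nat.
apply: lt_le_trans (coord_le_norm _ i); rewrite !mxE !eqxx /= Ezi natrM natrX.
rewrite mulfK ?gt_eqF// mulr1 ger0_norm.
  have : 0 < 2 ^- j :> R by rewrite invr_gt0.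
  by lra.
have : 0 < 2 ^- j :> R by rewrite invr_gt0.
by lra.
Qed.

Lemma riem_shift j (i : 'I_n) F l : (l <= 2 ^ j)%N ->
  (forall y, 2 < `|y| -> F y = 0) ->
  riem j (fun y => F (y + (l%:R / 2 ^+ j) *: 'e_i)) = riem j F.
Proof.
move=> + F0; elim: l => [_|l ih lj].
  by congr riem; apply/funext => y; rewrite mul0r scale0r addr0.
rewrite -[RHS]ih ?(ltnW lj)// -[RHS](@riem_shift1 j i) => [|y y3].
  congr riem; apply/funext => y; congr F.
  by rewrite -addrA -scalerDl -natr1 mulrDl mul1r [2 ^- j + _]addrC.
apply: F0; rewrite -[y](addrK ((l%:R / 2 ^+ j) *: 'e_i)) in y3.
have := lt_le_trans y3 (ler_normB _ _); rewrite norm_sei.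
have : `|l%:R / 2 ^+ j| <= 1 :> R.
  rewrite ger0_norm ?divr_ge0 ?exprn_ge0// ler_pdivrMr ?two_pow_gt0// mul1r.
  by rewrite -natrX ler_nat ltnW.
by lra.
Qed.

End GridMean.

(** * A translation invariant mean *)

Lemma expr_small (R : realType) (q e : R) : 0 <= q < 1 -> 0 < e ->
  exists k, forall j, (k <= j)%N -> q ^+ j <= e.
Proof.
move=> /andP[q0 q1] e0.
have /cvgrPdist_le /(_ _ e0) [k _ H] : q ^+ j @[j --> \oo] --> 0.
  by apply: cvg_expr; rewrite ger0_norm.
exists k => j /H /=; rewrite sub0r normrN => /(le_trans _); apply.
exact: ler_norm.
Qed.

(** The properties of Lebesgue integration used below, up to normalisation;
    shifts are only required to preserve the mean of Hoelder functions with
    support in the cube of half-width [1]. *)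
Record mean (R : realType) (n : nat) (alpha : R) := Mean {
  mean_fun :> ('rV[R]_n -> R) -> R;
  mean_cst : R;
  mean_cst_ge0 : 0 <= mean_cst;
  mean_lin : forall a F G, bnd F -> bnd G ->
    mean_fun (fun y => a * F y + G y) = a * mean_fun F + mean_fun G;
  mean_cube : forall (c : 'rV[R]_n) k A F, (forall y, `|F y| <= A) ->
    (forall y, 2 * 2 ^- k < `|y - c| -> F y = 0) ->
    `|mean_fun F| <= mean_cst * (2 ^+ k) ^- n * A;
  mean_gt0 : forall b F, 0 < b -> bnd F -> (forall y, 0 <= F y) ->
    (exists k, forall y, `|y| <= 2 ^- k -> b <= F y) -> 0 < mean_fun F;
  mean_shift : forall (i : 'I_n) F C h, `|h| <= 1 -> bnd F ->
    (forall y y', `|F y - F y'| <= C * `|y - y'| `^ alpha) ->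
    (forall y, 1 < `|y| -> F y = 0) ->
    mean_fun (fun y => F (y + h *: 'e_i)) = mean_fun F
}.

Section UltraMean.
Context {R : realType} {n : nat}.
Implicit Types (x y c : 'rV[R]_n) (F G : 'rV[R]_n -> R).
Variable alpha : R.
Hypothesis alpha_gt0 : 0 < alpha.
Variable U : set_system nat.
Hypothesis UU : UltraFilter U.
Hypothesis Uoo : \oo `<=` U.

(** Grid sums of a bounded function always converge along an ultrafilter, so that
    the mean is defined and linear on all bounded functions, measurable or not. *)
Definition umean F : R := lim (riem j F @[j --> U]).

Lemma fmap_ultra (f : nat -> R) : UltraFilter (f @ U).
Proof.
split=> [|G GF sfG]; first exact: fmap_proper_filter.
rewrite predeqE => A; split; last exact: sfG.
move=> GA; have [//|UnA] := in_ultra_setVsetC (f @^-1` A) UU.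
have GnA : G (~` A) by apply: sfG.
by have /filter_ex [? []] : G (A `&` ~` A) by exact: filterI.
Qed.

Lemma umean_cvg F : bnd F -> riem j F @[j --> U] --> umean F.
Proof.
move=> [A FA].
have := @segment_compact R (- (9 ^+ n * A)) (9 ^+ n * A).
rewrite compact_ultra => /(_ (riem j F @[j --> U])) [].
- exact: fmap_ultra.
- rewrite /fmap /=; apply: filterS filterT => j _ /=.
  by rewrite in_itv /= -ler_norml riem_bnd.
- by move=> l [_ /= Fl]; rewrite /umean (cvg_lim _ Fl).
Qed.

Lemma umean_le F k A : bnd F -> (forall j, (k <= j)%N -> `|riem j F| <= A) ->
  `|umean F| <= A.
Proof.
move=> Fb FA; have Fc := umean_cvg Fb.
have ev : \forall j \near U, `|riem j F| <= A.
  by apply: Uoo; exists k => // j /= kj; exact: FA.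
rewrite ler_norml; apply/andP; split.
  apply: limr_ge; first by apply/cvg_ex; exists (umean F).
  by apply: filterS ev => j; rewrite ler_norml => /andP[].
apply: limr_le; first by apply/cvg_ex; exists (umean F).
by apply: filterS ev => j; rewrite ler_norml => /andP[].
Qed.

Lemma umean_lin a F G : bnd F -> bnd G ->
  umean (fun y => a * F y + G y) = a * umean F + umean G.
Proof.
move=> Fb Gb; apply: cvg_lim => //.
under eq_fun do rewrite riem_lin.
by apply: cvgD (umean_cvg Gb); apply: cvgMl_tmp (umean_cvg Fb).
Qed.

Lemma umean_gt0 b F : 0 < b -> bnd F -> (forall y, 0 <= F y) ->
  (exists k, forall y, `|y| <= 2 ^- k -> b <= F y) -> 0 < umean F.
Proof.
move=> b0 Fb F0 [k Fk]; apply: (@lt_le_trans _ _ ((2 ^+ k) ^- n * b)).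
  by rewrite mulr_gt0// invr_gt0 !exprn_gt0.
apply: limr_ge; first by apply/cvg_ex; exists (umean F); exact: umean_cvg.
by apply: Uoo; exists k => // j /= kj; apply: riem_ge => //; exact: ltW.
Qed.

(** Grid sums are invariant under multiples of the mesh.  A general shift is
    rounded to such a multiple, at a cost controlled by Hoelder continuity. *)
Lemma umean_shift_ge0 (i : 'I_n) F C h : 0 <= h <= 1 -> bnd F ->
  (forall y y', `|F y - F y'| <= C * `|y - y'| `^ alpha) ->
  (forall y, 2 < `|y| -> F y = 0) ->
  umean (fun y => F (y + h *: 'e_i)) = umean F.
Proof.
move=> /andP[h0 h1] Fb FC F0.
pose G y := (-1) * F y + F (y + h *: 'e_i).
have Fb' : bnd (fun y => F (y + h *: 'e_i)) by case: Fb => A FA; exists A.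
have : umean G = (-1) * umean F + umean (fun y => F (y + h *: 'e_i)).
  exact: umean_lin.
suff -> : umean G = 0 by move/esym/eqP; rewrite mulN1r addrC subr_eq0 => /eqP.
apply/eqP; rewrite -normr_le0; apply/ler_addgt0Pl => e e0; rewrite addr0.
have C0 : 0 <= Num.max C 0 by rewrite le_max lexx orbT.
have M0 : 0 < 9 ^+ n * (Num.max C 0 + 1) :> R.
  by rewrite mulr_gt0 ?exprn_gt0// ltr_wpDl.
have [k Hk] : exists k, forall j, (k <= j)%N ->
    (2 ^- j) `^ alpha <= e / (9 ^+ n * (Num.max C 0 + 1)) :> R.
  set d := e / _; have d0 : 0 < d by rewrite divr_gt0.
  have [||k kd] := @expr_small _ (2^-1) (d `^ alpha^-1); first lra.
    exact: powR_gt0.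
  exists k => j /kd jd.
  rewrite [leRHS](_ : d = (d `^ alpha^-1) `^ alpha); last first.
    by rewrite -powRrM mulVf ?gt_eqF// powRr1// ltW.
  rewrite ge0_ler_powR ?nnegrE ?invr_ge0 ?exprn_ge0 ?powR_ge0 ?(ltW alpha_gt0)//.
    by rewrite -exprVn.
have Gb : bnd G by exact: bnd_lin.
apply: (@umean_le _ k) => // j kj.
have p0 := @two_pow_gt0 R j.
pose l := Num.truncn (h * 2 ^+ j).
have hj0 : 0 <= h * 2 ^+ j by rewrite mulr_ge0// ltW.
have /andP[l1 l2] := truncn_itv hj0; rewrite -/l in l1 l2.
have lj : (l <= 2 ^ j)%N.
  rewrite -(ler_nat R) natrX; apply: le_trans l1 _.
  by rewrite ler_piMl// ltW// p0.
have -> : riem j G = riem j (fun y => (-1) * F (y + (l%:R / 2 ^+ j) *: 'e_i) + F (y + h *: 'e_i)).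
  by rewrite /G !riem_lin riem_shift.
apply: le_trans (@riem_bnd _ _ _ (Num.max C 0 * (2 ^- j) `^ alpha) _ _) _ => [y|].
  rewrite mulN1r addrC; apply: le_trans (FC _ _) _.
  apply: (@le_trans _ _ (Num.max C 0 * `|y + h *: 'e_i - (y + (l%:R / 2 ^+ j) *: 'e_i)| `^ alpha)).
    by rewrite ler_wpM2r ?powR_ge0// le_max lexx.
  rewrite ler_wpM2l// ge0_ler_powR ?nnegrE ?invr_ge0 ?exprn_ge0 ?(ltW alpha_gt0)//.
  rewrite opprD addrACA subrr add0r -scalerBl norm_sei ger0_norm.
    rewrite lerBlDr (_ : 2 ^- j + _ = (l.+1)%:R / 2 ^+ j).
      by rewrite ler_pdivlMr// ltW.
    by rewrite -[l.+1%:R]natr1 mulrDl mul1r addrC.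
  by rewrite subr_ge0 ler_pdivrMr.
have := Hk j kj; rewrite ler_pdivlMr// => /(le_trans _); apply.
rewrite mulrA mulrC ler_wpM2l ?powR_ge0// ler_wpM2l ?exprn_ge0//.
by rewrite lerDl.
Qed.

Lemma umean_shift (i : 'I_n) F C h : `|h| <= 1 -> bnd F ->
  (forall y y', `|F y - F y'| <= C * `|y - y'| `^ alpha) ->
  (forall y, 1 < `|y| -> F y = 0) ->
  umean (fun y => F (y + h *: 'e_i)) = umean F.
Proof.
move=> h1 Fb FC F0; have [h0|h0] := leP 0 h.
  apply: umean_shift_ge0 FC _ => // [|y y2].
    by move: h1; rewrite ger0_norm//; lra.
  by apply: F0; move: y2; lra.
rewrite ltr0_norm// in h1.
pose F' y := F (y + h *: 'e_i).
rewrite -/(umean F') -[LHS](@umean_shift_ge0 i F' C (- h)).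
- by congr umean; apply/funext => y; rewrite /F' -addrA -scalerDl addNr scale0r addr0.
- by lra.
- by case: Fb => A FA; exists A => y; exact: FA.
- by move=> y y'; rewrite /F'; apply: le_trans (FC _ _) _; rewrite opprD addrACA subrr addr0.
- move=> y y2; apply: F0; rewrite -[y](addrK (h *: 'e_i)) in y2.
  have := lt_le_trans y2 (ler_normB _ _); rewrite norm_sei ltr0_norm//.
  by lra.
Qed.

Definition ultra_mean : mean n alpha.
Proof.
refine (@Mean R n alpha umean (5 ^+ n) _ umean_lin _ umean_gt0 umean_shift).
- by rewrite exprn_ge0.
- move=> c k A F FA F0; apply: (@umean_le _ k); first by exists A.
  by move=> j kj; exact: (riem_cube kj FA F0).
Defined.

End UltraMean.

Lemma exists_mean (R : realType) (n : nat) (alpha : R) :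
  0 < alpha -> inhabited (mean n alpha).
Proof.
move=> a0.
have [U [UU Uoo]] := @ultraFilterLemma nat \oo _.
constructor; exact (@ultra_mean R n alpha a0 U UU Uoo).
Qed.

(** * A radial profile of class C^{2,1} *)

Section Profile.
Context {R : realType}.
Implicit Types (s t mu : R) (f df : R -> R).

(** The class C^{1,1} in terms of Taylor remainders.  Functions defined by cases
    are glued in this form without looking at derivatives at the junction. *)
Definition taylor1 (S : set R) (B : R) f df := forall s t, S s -> S t ->
  `|f t - f s - df s * (t - s)| <= B * (t - s) ^+ 2.

(** The expansions at [s] and at [t] add up to the increment of [df]. *)
Lemma taylor1_lip S B f df : taylor1 S B f df -> forall s t, S s -> S t ->
  `|df t - df s| <= 2 * B * `|t - s|.
Proof.
move=> H s t Ss St; have [->|st] := eqVneq t s; first by rewrite !subrr normr0 mulr0.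
have d0 : 0 < `|t - s| by rewrite normr_gt0 subr_eq0.
rewrite -(ler_pM2r d0) -normrM.
have -> : (df t - df s) * (t - s) =
  (f t - f s - df s * (t - s)) + (f s - f t - df t * (s - t)) by ring.
apply: le_trans (ler_normD _ _) _.
apply: le_trans (lerD (H _ _ Ss St) (H _ _ St Ss)) _.
rewrite -[leRHS]mulrA -normrM -expr2 ger0_norm ?sqr_ge0//.
by rewrite le_eqVlt; apply/orP; left; apply/eqP; ring.
Qed.

(** Across the junction, both expansions are taken at [c]. *)
Lemma taylor1_glue (c B : R) (S : set R) f df : 0 <= B -> S c ->
  taylor1 (S `&` [set s | s <= c]) B f df ->
  taylor1 (S `&` [set s | c <= s]) B f df -> taylor1 S B f df.
Proof.
move=> B0 Sc Hl Hr.
have Ll := taylor1_lip Hl; have Lr := taylor1_lip Hr.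
have E s t : f t - f s - df s * (t - s) = (f t - f c - df c * (t - c)) +
  (f c - f s - df s * (c - s)) + (df c - df s) * (t - c) by ring.
move=> s t Ss St.
have [sc|cs] := leP s c; have [tc|ct] := leP t c.
- exact: Hl.
- rewrite E; apply: le_trans (ler_normD _ _) _.
  apply: le_trans (lerD (ler_normD _ _) (lexx _)) _.
  have h1 : `|f t - f c - df c * (t - c)| <= B * (t - c) ^+ 2.
    by apply: Hr; split=> //=; rewrite ltW.
  have h2 : `|f c - f s - df s * (c - s)| <= B * (c - s) ^+ 2.
    by apply: Hl; split=> //=.
  have h3 : `|(df c - df s) * (t - c)| <= 2 * B * (c - s) * (t - c).
    rewrite normrM [`|t - c|]ger0_norm ?subr_ge0 ?(ltW ct)//.
    rewrite ler_wpM2r ?subr_ge0 ?(ltW ct)//.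
    have := Ll s c (conj Ss sc) (conj Sc (lexx c)).
    by rewrite [`|c - s|]ger0_norm ?subr_ge0.
  apply: le_trans (lerD (lerD h1 h2) h3) _.
  by rewrite le_eqVlt; apply/orP; left; apply/eqP; ring.
- rewrite E; apply: le_trans (ler_normD _ _) _.
  apply: le_trans (lerD (ler_normD _ _) (lexx _)) _.
  have h1 : `|f t - f c - df c * (t - c)| <= B * (t - c) ^+ 2.
    by apply: Hl; split=> //=.
  have h2 : `|f c - f s - df s * (c - s)| <= B * (c - s) ^+ 2.
    by apply: Hr; split=> //=; rewrite ltW.
  have h3 : `|(df c - df s) * (t - c)| <= 2 * B * (s - c) * (c - t).
    rewrite normrM distrC [`|t - c|]distrC [`|c - t|]ger0_norm ?subr_ge0//.
    rewrite ler_wpM2r ?subr_ge0//.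
    have := Lr c s (conj Sc (lexx c)) (conj Ss (ltW cs)).
    by rewrite [`|s - c|]ger0_norm ?subr_ge0 ?(ltW cs)// distrC.
  apply: le_trans (lerD (lerD h1 h2) h3) _.
  by rewrite le_eqVlt; apply/orP; left; apply/eqP; ring.
- by apply: Hr; split=> //=; rewrite ltW.
Qed.

Lemma MVT_ge1 f df : (forall x : R, 1 <= x -> is_derive x 1 f (df x)) ->
  forall s t, 1 <= s -> 1 <= t -> exists x, [/\ 1 <= x, `|x - s| <= `|t - s| &
    f t - f s = df x * (t - s)].
Proof.
move=> H s t s1 t1.
have D (a b : R) : 1 <= a -> {within `[a, b], continuous f}.
  move=> a1; apply: derivable_within_continuous => x.
  by rewrite in_itv /= => /andP[ax _]; have [] := H x (le_trans a1 ax).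
have [st|ts] := leP s t.
  have [x xst|x] := @MVT_segment _ f df _ _ st _ (D _ _ s1).
    move: xst; rewrite in_itv /= => /andP[sx _].
    by apply: H; rewrite (le_trans s1)// ltW.
  rewrite in_itv /= => /andP[sx xt] E; exists x; split => //.
    exact: le_trans sx.
  by rewrite !ger0_norm ?subr_ge0// lerB.
have [x xst|x] := @MVT_segment _ f df _ _ (ltW ts) _ (D _ _ t1).
  move: xst; rewrite in_itv /= => /andP[sx _].
  by apply: H; rewrite (le_trans t1)// ltW.
rewrite in_itv /= => /andP[sx xt] E; exists x; split => //.
- exact: le_trans sx.
- by rewrite distrC [leRHS]distrC !ger0_norm ?subr_ge0 ?(ltW ts)// lerB.
- by rewrite -[LHS]opprB E -mulrN opprB.
Qed.

Lemma powRN_le1 mu t : 0 <= mu -> 1 <= t -> 0 <= t `^ (- mu) <= 1.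
Proof.
move=> mu0 t1; rewrite powR_ge0 powRN /=.
by rewrite invf_le1 ?powR_gt0 ?(lt_le_trans ltr01)// -(powRr0 t) ler_powR.
Qed.

Lemma taylor1_powR mu : 0 <= mu ->
  taylor1 [set s : R | 1 <= s] (mu * (mu + 1)) (fun s => s `^ (- mu)) (fun s => - mu * s `^ (- mu - 1)).
Proof.
move=> mu0 s t /= s1 t1.
have D (nu x : R) : 1 <= x -> is_derive x 1 (fun s : R => s `^ (- nu)) (- nu * x `^ (- nu - 1)).
  by move=> x1; apply: is_derive1_powR; apply: lt_le_trans x1.
have [x [x1 xs ->]] := MVT_ge1 (D mu) s1 t1.
rewrite -mulrBl -mulrBr.
have [y [y1 ys E]] := MVT_ge1 (D (mu + 1)) s1 x1.
rewrite -[- mu - 1]opprD E !normrM !normrN (ger0_norm mu0) [`|mu + 1|]ger0_norm ?addr_ge0//.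
have /andP[p0 p1] : 0 <= y `^ (- (mu + 1 + 1)) <= 1 by rewrite powRN_le1 ?addr_ge0.
rewrite -[- (mu + 1) - 1]opprD [`|_ `^ _|]ger0_norm//.
rewrite -!mulrA ler_wpM2l// ler_wpM2l ?addr_ge0//.
rewrite -[leRHS]real_normK ?num_real// expr2 mulrA ler_wpM2r//.
by rewrite -[leRHS]mul1r ler_pM.
Qed.

Variable nu : R.
Hypothesis nu_gt0 : 0 < nu.

(** The power [s^-nu], continued to [s <= 1] by its Taylor polynomial of degree
    three at [1]; then its first two derivatives. *)
Definition pow0 s := if s <= 1 then 1 + nu * (1 - s) + nu * (nu + 1) / 2 * (1 - s) ^+ 2
    + nu * (nu + 1) * (nu + 2) / 6 * (1 - s) ^+ 3 else s `^ (- nu).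
Definition pow1 s := if s <= 1 then - nu - nu * (nu + 1) * (1 - s)
    - nu * (nu + 1) * (nu + 2) / 2 * (1 - s) ^+ 2 else - nu * s `^ (- nu - 1).
Definition pow2 s := if s <= 1 then nu * (nu + 1)
    + nu * (nu + 1) * (nu + 2) * (1 - s) else nu * (nu + 1) * s `^ (- nu - 2).

Lemma pow0_ge1 s : 1 <= s -> pow0 s = s `^ (- nu).
Proof.
rewrite le_eqVlt /pow0 => /orP[/eqP <-|s1]; last by rewrite leNgt s1.
by rewrite lexx powR1; ring.
Qed.

Lemma pow1_ge1 s : 1 <= s -> pow1 s = - nu * s `^ (- nu - 1).
Proof.
rewrite le_eqVlt /pow1 => /orP[/eqP <-|s1]; last by rewrite leNgt s1.
by rewrite lexx powR1; ring.
Qed.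

Lemma pow2_ge1 s : 1 <= s -> pow2 s = nu * (nu + 1) * s `^ (- nu - 2).
Proof.
rewrite le_eqVlt /pow2 => /orP[/eqP <-|s1]; last by rewrite leNgt s1.
by rewrite lexx powR1; ring.
Qed.

Definition pow_cst := nu * (nu + 1) * (nu + 2).

Lemma pow_cst_ge0 : 0 <= pow_cst.
Proof. by rewrite !mulr_ge0 ?addr_ge0// ltW. Qed.

Lemma taylor1_pow0 : taylor1 [set s | 0 <= s] (nu * (nu + 1) + pow_cst) pow0 pow1.
Proof.
have c0 := pow_cst_ge0.
have n1 : 0 <= nu * (nu + 1) by rewrite mulr_ge0 ?addr_ge0// ltW.
apply: (@taylor1_glue 1) => [||s t [/= s0 s1] [/= t0 t1]|s t [/= s0 s1] [/= t0 t1]].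
- by rewrite addr_ge0.
- by rewrite /= ler01.
- rewrite /pow0 /pow1 s1 t1 [X in `|X|](_ : _ = (nu * (nu + 1) / 2 +
    pow_cst / 6 * (3 - t - 2 * s)) * (t - s) ^+ 2); last by rewrite /pow_cst; field.
  rewrite normrM [X in _ * X]ger0_norm ?sqr_ge0// ler_wpM2r ?sqr_ge0//.
  rewrite ger0_norm; last first.
    by apply: addr_ge0; [rewrite divr_ge0|rewrite mulr_ge0 ?divr_ge0//; lra].
  apply: lerD; first by lra.
  by rewrite -mulrA ler_piMr//; lra.
- rewrite !pow0_ge1// pow1_ge1//; apply: le_trans (@taylor1_powR nu (ltW nu_gt0) s t _ _) _ => //.
  by rewrite ler_wpM2r ?sqr_ge0// lerDl.
Qed.

Lemma taylor1_pow1 : taylor1 [set s | 0 <= s] pow_cst pow1 pow2.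
Proof.
have c0 := pow_cst_ge0.
apply: (@taylor1_glue 1) => [||s t [/= s0 s1] [/= t0 t1]|s t [/= s0 s1] [/= t0 t1]] //.
- by rewrite /= ler01.
- rewrite /pow1 /pow2 s1 t1 [X in `|X|](_ : _ = (- pow_cst / 2) * (t - s) ^+ 2);
    last by rewrite /pow_cst; field.
  rewrite normrM [X in _ * X]ger0_norm ?sqr_ge0// ler_wpM2r ?sqr_ge0//.
  by rewrite mulNr normrN ger0_norm; lra.
- rewrite !pow1_ge1// pow2_ge1//.
  have nu1 : 0 <= nu + 1 by rewrite addr_ge0// ltW.
  have := @taylor1_powR (nu + 1) nu1 s t s1 t1.
  rewrite (_ : - nu - 2 = - (nu + 1) - 1); last by ring.
  rewrite (_ : - nu - 1 = - (nu + 1)); last by ring.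
  set p := s `^ _; set p' := s `^ _; set q := t `^ _ => H.
  rewrite [X in `|X|](_ : _ = (- nu) * (q - p - (- (nu + 1) * p') * (t - s))); last by ring.
  rewrite normrM normrN (ger0_norm (ltW nu_gt0)).
  apply: le_trans (ler_wpM2l (ltW nu_gt0) H) _.
  by rewrite /pow_cst le_eqVlt; apply/orP; left; apply/eqP; ring.
Qed.

(** [4 s g'' + (4 nu + 4) g'] is the Laplacian of [g(|x|^2)] in dimension
    [2 nu + 2]; the powers of [1 - s] of degree 0 and 1 cancel. *)
Lemma pow_laplacian s : 0 <= s ->
  4 * s * pow2 s + (4 * nu + 4) * pow1 s =
    - (pow_cst * (2 * nu + 6)) * (Num.max (1 - s) 0) ^+ 2.
Proof.
move=> s0; have [s1|s1] := leP s 1.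
  rewrite /pow1 /pow2 s1 max_l ?subr_ge0// /pow_cst; by field.
rewrite pow1_ge1 ?(ltW s1)// pow2_ge1 ?(ltW s1)// max_r; last by rewrite subr_le0 ltW.
rewrite (_ : s `^ (- nu - 1) = s * s `^ (- nu - 2)); first by ring.
have sp : 0 < s by apply: lt_trans s1.
by rewrite -[X in X * _]powRr1 ?ltW// -powRD ?(gt_eqF sp) ?implybT//; congr powR; ring.
Qed.

End Profile.

(** With [nu = n/2 - 1], the function [G(x) = pow0 (|x|^2)] equals the harmonic
    function [|x|^(2-n)] outside the unit ball, so [Delta G] is supported in it.
    As [|x|^(2-n)] is homogeneous, [G(x) - 2^(n-2) G(2x)] vanishes outside the
    unit ball, and its Laplacian is a difference of two scalings of [Delta G]. *)
Lemma profile_exists (R : realType) (n : nat) : (3 <= n)%N ->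
  exists (g0 g1 g2 : R -> R) (kap B : R), [/\ 0 < kap, 0 <= B,
    taylor1 [set s | 0 <= s] B g0 g1 /\ taylor1 [set s | 0 <= s] B g1 g2,
    forall s, 1 <= s -> [/\ g0 s = 0, g1 s = 0 & g2 s = 0] &
    forall s, 0 <= s -> 4 * s * g2 s + 2 * n%:R * g1 s =
      2 ^+ n * (kap * Num.max (1 - 4 * s) 0 ^+ 2) - kap * Num.max (1 - s) 0 ^+ 2].
Proof.
move=> n3; pose A : R := 2 ^+ (n - 2).
have [nu nu0 nnu] : exists2 nu : R, 0 < nu & n%:R = 2 * nu + 2.
  have n3' : 3 <= n%:R :> R by rewrite ler_nat.
  by exists ((n%:R - 2) / 2); [lra|field].
have A4 : 2 ^+ n = 4 * A.
  by rewrite /A -{1}(subnK (ltnW n3)) addnC exprD; ring.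
have pA : (4 : R) `^ (- nu) * A = 1.
  rewrite (_ : 4 = 2 `^ 2); last by rewrite powR_mulrn// expr2; ring.
  rewrite -powRrM /A -powR_mulrn// -powRD ?pnatr_eq0 ?implybT//.
  rewrite natrB ?(ltnW n3)//.
  have -> : 2 * - nu + (n%:R - 2) = 0 by rewrite nnu; ring.
 by rewrite powRr0.
exists (fun s => pow0 nu s - A * pow0 nu (4 * s)), (fun s => pow1 nu s - 4 * A * pow1 nu (4 * s)),
  (fun s => pow2 nu s - 16 * A * pow2 nu (4 * s)), (pow_cst nu * (2 * nu + 6)).
have c0 := pow_cst_ge0 nu0.
have A0 : 0 <= A by rewrite exprn_ge0.
have T B f df : taylor1 [set s : R | 0 <= s] B f df -> 0 <= B -> forall A', 0 <= A' ->
   taylor1 [set s : R | 0 <= s] (B * (1 + 16 * A')) (fun s => f s - A' * f (4 * s))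
     (fun s => df s - A' * (4 * df (4 * s))).
  move=> H B0 A' A'0 s t /= s0 t0.
  rewrite [X in `|X|](_ : _ = (f t - f s - df s * (t - s)) -
     A' * (f (4 * t) - f (4 * s) - df (4 * s) * (4 * t - 4 * s))); last by ring.
  apply: le_trans (ler_normB _ _) _.
  have h1 := H s t s0 t0.
  have h2 := H (4 * s) (4 * t) (mulr_ge0 (ler0n _ _) s0) (mulr_ge0 (ler0n _ _) t0).
  rewrite normrM (ger0_norm A'0).
  apply: le_trans (lerD h1 (ler_wpM2l A'0 h2)) _.
  by rewrite le_eqVlt; apply/orP; left; apply/eqP; ring.
have cc : 0 <= nu * (nu + 1) + pow_cst nu.
  by rewrite addr_ge0// mulr_ge0 ?addr_ge0// ltW.
exists ((nu * (nu + 1) + pow_cst nu) * (1 + 16 * (4 * A))); split.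
- by rewrite /pow_cst !mulr_gt0 ?addr_gt0 ?mulr_gt0.
- by rewrite mulr_ge0// addr_ge0// !mulr_ge0.
- have eqle (x y : R) : x = y -> x <= y by move=> ->.
  split=> s t s0 t0.
    apply: le_trans (le_trans (T _ _ _ (taylor1_pow0 nu0) cc A A0 s t s0 t0) _).
      by apply: eqle; congr (`|_|) => /=; ring.
    rewrite ler_wpM2r ?sqr_ge0// ler_wpM2l// lerD2l ler_wpM2l//.
    by rewrite ler_peMl// ler1n.
  apply: le_trans (le_trans (T _ _ _ (taylor1_pow1 nu0) c0 (4 * A) (mulr_ge0 (ler0n _ _) A0) s t s0 t0) _).
    by apply: eqle; congr (`|_|) => /=; ring.
  rewrite ler_wpM2r ?sqr_ge0// ler_wpM2r// ?addr_ge0 ?mulr_ge0//.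
  by rewrite lerDr mulr_ge0 ?addr_ge0// ltW.
- move=> s s1; have s4 : 1 <= 4 * s by lra.
  have s0 : 0 <= s by lra.
  have e1 : (4 : R) `^ (- nu - 1) * (4 * A) = 1.
    by rewrite powRD ?pnatr_eq0 ?implybT// powR_inv1//; lra.
  have e2 : (4 : R) `^ (- nu - 2) * (16 * A) = 1.
    rewrite powRD ?pnatr_eq0 ?implybT// [4 `^ (- 2)]powRN powR_mulrn// expr2.
    by lra.
  split.
  + by rewrite !pow0_ge1// powRM// [_ `^ _ * s `^ _]mulrC mulrCA [A * _]mulrC pA mulr1 subrr.
  + rewrite !pow1_ge1// powRM//.
    rewrite (_ : _ - _ = - nu * s `^ (- nu - 1) * (1 - 4 `^ (- nu - 1) * (4 * A))); last by ring.
    by rewrite e1 subrr mulr0.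
  + rewrite !pow2_ge1// powRM//.
    rewrite (_ : _ - _ = nu * (nu + 1) * s `^ (- nu - 2) * (1 - 4 `^ (- nu - 2) * (16 * A))); last by ring.
    by rewrite e2 subrr mulr0.
- move=> s s0; have h1 := pow_laplacian nu s0.
  have h2 := pow_laplacian nu (mulr_ge0 (ler0n R 4) s0).
  rewrite A4; set m1 := Num.max (1 - s) 0 in h1 *; set m2 := Num.max _ _ in h2 *.
  rewrite nnu (_ : _ + _ = (4 * s * pow2 nu s + (4 * nu + 4) * pow1 nu s) -
    4 * A * (4 * (4 * s) * pow2 nu (4 * s) + (4 * nu + 4) * pow1 nu (4 * s))); last by ring.
  by rewrite h1 h2; ring.
Qed.

(** * The kernel *)

(** The sum of the individual constants serves all indices. *)
Lemma uniform_cst (R : realType) (I : finType) (P : I -> R -> Prop) :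
  (forall i C C', C <= C' -> P i C -> P i C') -> (forall i, exists C, P i C) ->
  exists2 C, 0 <= C & forall i, P i C.
Proof.
move=> mono /choice[C HC]; exists (\sum_i `|C i|); first exact: sumr_ge0.
move=> i; apply: mono (HC i); apply: le_trans (ler_norm _) _.
by rewrite (bigD1 i)//= lerDl sumr_ge0.
Qed.

Section Kernel.
Context {R : realType} {n : nat}.
Implicit Types (y : 'rV[R]_n) (F G : 'rV[R]_n -> R) (h B C : R) (i : 'I_n).

Definition sq y : R := \sum_i y 0 i ^+ 2.

Lemma sq_ge0 y : 0 <= sq y.
Proof. by apply: sumr_ge0 => i _; exact: sqr_ge0. Qed.

Lemma sq_shift y i h : sq (y + h *: 'e_i) = sq y + (2 * h * y 0 i + h ^+ 2).
Proof.
rewrite /sq (bigD1 i)//= [in RHS](bigD1 i)//= !mxE !eqxx /= mulr1.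
rewrite (eq_bigr (fun j => y 0 j ^+ 2)); first by ring.
by move=> j ji; rewrite !mxE eqxx /= (negbTE ji) mulr0 addr0.
Qed.

Lemma sq_le y (A : R) : `|y| <= A -> sq y <= n%:R * A ^+ 2.
Proof.
move=> yA; apply: le_trans (_ : \sum_(i < n) A ^+ 2 <= _).
  apply: ler_sum => i _; rewrite -real_normK ?num_real// lerXn2r ?nnegrE//.
    by apply: le_trans yA.
  by apply: le_trans yA; exact: coord_le_norm.
by rewrite sumr_const card_ord mulr_natl.
Qed.

Lemma sq_ge1 y : 1 <= `|y| -> 1 <= sq y.
Proof.
move=> y1; rewrite leNgt; apply/negP => s1.
suff : `|y| < 1 by rewrite ltNge y1.
apply: le_lt_trans (_ : Num.sqrt (sq y) < 1); last first.
  by rewrite -sqrtr1 ltr_sqrt.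
apply: norm_le_coord => [|i]; first exact: sqrtr_ge0.
rewrite -sqrtr_sqr ler_wsqrtr// /sq (bigD1 i)//= lerDl.
by apply: sumr_ge0 => j _; exact: sqr_ge0.
Qed.

Lemma norm_shift_le y i (h A : R) : `|y| <= A -> `|h| <= 1 -> `|y + h *: 'e_i| <= A + 1.
Proof. by move=> yA h1; apply: le_trans (ler_normD _ _) _; rewrite norm_sei lerD. Qed.

(** The kernel is assembled by products and compositions from functions such as
    [|x|^2] that are unbounded; bounds on a fixed cube survive these operations,
    and become global once the result is known to vanish outside the cube. *)
Definition loc_lip F := exists2 C, 0 <= C & (forall y, `|y| <= 3 -> `|F y| <= C) /\
  (forall y i h, `|y| <= 2 -> `|h| <= 1 -> `|F (y + h *: 'e_i) - F y| <= C * `|h|).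

Definition loc_der i F F' := exists2 C, 0 <= C & forall y h, `|y| <= 2 -> `|h| <= 1 ->
  `|F (y + h *: 'e_i) - F y - h * F' y| <= C * h ^+ 2.

Lemma loc_lip_add F G : loc_lip F -> loc_lip G -> loc_lip (fun y => F y + G y).
Proof.
move=> [C C0 [F1 F2]] [D D0 [G1 G2]]; exists (C + D); first exact: addr_ge0.
split=> [y y3|y i h y2 h1].
  by apply: le_trans (ler_normD _ _) _; rewrite lerD ?F1 ?G1.
rewrite opprD addrACA mulrDl; apply: le_trans (ler_normD _ _) _.
by rewrite lerD ?F2 ?G2.
Qed.

Lemma loc_lip_mul F G : loc_lip F -> loc_lip G -> loc_lip (fun y => F y * G y).
Proof.
move=> [C C0 [F1 F2]] [D D0 [G1 G2]]; exists (C * D + C * D); first by rewrite addr_ge0 ?mulr_ge0.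
split=> [y y3|y i h y2 h1].
  rewrite normrM (@le_trans _ _ (C * D))//; first by rewrite ler_pM ?F1 ?G1.
  by rewrite lerDl mulr_ge0.
rewrite (_ : _ - _ = F (y + h *: 'e_i) * (G (y + h *: 'e_i) - G y) +
  (F (y + h *: 'e_i) - F y) * G y); last by ring.
apply: le_trans (ler_normD _ _) _; rewrite !normrM mulrDl; apply: lerD.
  rewrite -mulrA ler_pM ?G2// F1//.
  by apply: le_trans (norm_shift_le i y2 h1) _; lra.
rewrite mulrAC ler_pM ?F2//.
by apply: G1; apply: le_trans y2 _; rewrite ler_nat.
Qed.

Lemma loc_lip_cst c : loc_lip (cst c).
Proof.
exists `|c| => //; split => // y i h _ _.
by rewrite subrr normr0 mulr_ge0.
Qed.

Lemma loc_lip_coord j : loc_lip (fun y => y 0 j).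
Proof.
exists 3 => //; split=> [y y3|y i h _ _].
  by apply: le_trans (coord_le_norm _ _) _.
rewrite !mxE eqxx /= [y 0 j + _]addrC addrK normrM [leRHS]mulrC ler_wpM2l//.
by case: (j == i); rewrite normr_nat ler_nat.
Qed.

Lemma loc_der_coord i j : loc_der i (fun y => y 0 j) (fun=> (i == j)%:R).
Proof.
exists 0 => // y h _ _.
by rewrite !mxE eqxx /= [y 0 j + _]addrC addrK eq_sym subrr normr0 mul0r.
Qed.

Lemma loc_der_mul i F F' G G' : loc_lip F -> loc_lip G -> loc_der i F F' -> loc_der i G G' ->
  loc_der i (fun y => F y * G y) (fun y => F' y * G y + F y * G' y).
Proof.
move=> [C C0 [F1 F2]] [D D0 [G1 G2]] [A A0 HF] [B B0 HG].
exists (A * D + C * B + C * D); first by rewrite !addr_ge0 ?mulr_ge0.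
move=> y h y2 h1.
have y3 : `|y| <= 3 by apply: le_trans y2 _; rewrite ler_nat.
set y' := y + _.
rewrite (_ : _ - _ - _ = (F y' - F y - h * F' y) * G y + F y * (G y' - G y - h * G' y) +
  (F y' - F y) * (G y' - G y)); last by ring.
apply: le_trans (ler_normD _ _) _; rewrite [leRHS]mulrDl; apply: lerD.
  apply: le_trans (ler_normD _ _) _; rewrite [leRHS]mulrDl !normrM; apply: lerD.
    by rewrite mulrAC ler_pM ?HF ?G1.
  by rewrite -mulrA ler_pM ?HG ?F1.
rewrite normrM -[h ^+ 2]real_normK ?num_real// expr2 mulrACA.
by rewrite ler_pM ?F2 ?G2.
Qed.

Lemma sq_shift_bnd y i h : `|y| <= 2 -> `|h| <= 1 ->
  [/\ 0 <= sq y <= 9 * n%:R, 0 <= sq (y + h *: 'e_i) <= 9 * n%:R &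
   `|sq (y + h *: 'e_i) - sq y| <= 5 * `|h|].
Proof.
move=> y2 h1; rewrite !sq_ge0/= mulrC; split.
- by apply: le_trans (sq_le y2) _; rewrite ler_wpM2l// expr2; lra.
- have y3 : `|y + h *: 'e_i| <= 3 by apply: le_trans (norm_shift_le i y2 h1) _; lra.
  apply: le_trans (sq_le y3) _.
  by rewrite ler_wpM2l// expr2; lra.
rewrite sq_shift [sq y + _]addrC addrK.
rewrite (_ : _ + _ = h * (2 * y 0 i + h)); last by ring.
rewrite normrM [leRHS]mulrC ler_wpM2l//.
apply: le_trans (ler_normD _ _) _; rewrite normrM normr_nat.
by have := le_trans (coord_le_norm y i) y2; lra.
Qed.

Lemma taylor1_loc_lip B (f df : R -> R) (M : R) : 0 <= B -> 0 <= M ->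
  taylor1 [set s | 0 <= s] B f df -> exists2 C, 0 <= C &
   forall s t, 0 <= s <= M -> 0 <= t <= M -> `|f t - f s| <= C * `|t - s|.
Proof.
move=> B0 M0 H; exists (`|df 0| + 2 * B * M + B * M).
  by rewrite !addr_ge0 ?mulr_ge0.
move=> s t /andP[s0 sM] /andP[t0 tM].
have Hd := taylor1_lip H (lexx 0) s0.
rewrite -[f t - f s](subrK (df s * (t - s))); apply: le_trans (ler_normD _ _) _.
rewrite addrC mulrDl; apply: lerD.
  rewrite normrM ler_wpM2r// -[df s](subrK (df 0)) addrC.
  apply: le_trans (ler_normD _ _) _; rewrite lerD2l; apply: le_trans Hd _.
  by rewrite subr0 ler_wpM2l ?mulr_ge0// ger0_norm.
apply: le_trans (H s t s0 t0) _.
rewrite -[(_ - _) ^+ 2]real_normK ?num_real// expr2 mulrA ler_wpM2r// ler_wpM2l//.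
by rewrite ler_norml; lra.
Qed.

Lemma loc_lip_comp (g : R -> R) C : 0 <= C ->
  (forall s t, 0 <= s <= 9 * n%:R -> 0 <= t <= 9 * n%:R -> `|g t - g s| <= C * `|t - s|) ->
  loc_lip (fun y => g (sq y)).
Proof.
move=> C0 H; have n0 : 0 <= 9 * n%:R :> R by rewrite mulr_ge0.
exists (`|g 0| + C * (9 * n%:R) + 5 * C); first by rewrite !addr_ge0 ?mulr_ge0.
split=> [y y3|y i h y2 h1].
  have sM : 0 <= sq y <= 9 * n%:R.
    rewrite sq_ge0 /= mulrC; apply: le_trans (sq_le y3) _.
    by rewrite ler_wpM2l// expr2; lra.
  rewrite -[g _](subrK (g 0)) addrC -addrA.
  apply: le_trans (ler_normD _ _) _; rewrite lerD2l.
  apply: le_trans (H 0 (sq y) _ sM) _; first by rewrite lexx n0.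
  rewrite subr0 ger0_norm ?sq_ge0// ler_wpDr ?mulr_ge0// ler_wpM2l//.
  by case/andP: sM.
have [s1 s2 s3] := sq_shift_bnd i y2 h1.
apply: le_trans (H _ _ s1 s2) _; apply: le_trans (ler_wpM2l C0 s3) _.
by rewrite mulrCA mulrA ler_wpM2r// lerDr addr_ge0 ?mulr_ge0.
Qed.

Lemma loc_der_comp (g dg : R -> R) B C i : 0 <= B -> 0 <= C ->
  taylor1 [set s | 0 <= s] B g dg ->
  (forall s, 0 <= s <= 9 * n%:R -> `|dg s| <= C) ->
  loc_der i (fun y => g (sq y)) (fun y => dg (sq y) * (2 * y 0 i)).
Proof.
move=> B0 C0 H HC; exists (25 * B + C); first by rewrite addr_ge0 ?mulr_ge0.
move=> y h y2 h1; have [s1 s2 s3] := sq_shift_bnd i y2 h1.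
rewrite (_ : _ - _ - _ = (g (sq (y + h *: 'e_i)) - g (sq y) -
  dg (sq y) * (sq (y + h *: 'e_i) - sq y)) + dg (sq y) * h ^+ 2); last first.
  have E : h ^+ 2 = sq (y + h *: 'e_i) - sq y - 2 * h * y 0 i.
    by rewrite sq_shift; ring.
  by rewrite E; ring.
apply: le_trans (ler_normD _ _) _; rewrite mulrDl; apply: lerD.
  have t1 : 0 <= sq y by exact: sq_ge0.
  apply: le_trans (H _ _ t1 (sq_ge0 _)) _.
  rewrite [25 * B]mulrC -mulrA ler_wpM2l//.
  rewrite -[h ^+ 2]real_normK ?num_real// -[leLHS]real_normK ?num_real//.
  rewrite (_ : 25 * _ = (5 * `|h|) ^+ 2); last by rewrite exprMn; ring.
  by rewrite lerXn2r ?nnegrE ?mulr_ge0.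
by rewrite normrM [`|h ^+ 2|]ger0_norm ?sqr_ge0// ler_wpM2r ?sqr_ge0// HC.
Qed.

(** The pointwise bounds on a kernel and on its partial derivatives that the
    estimates for convolutions use. *)
Definition adm B F := [/\ forall y, `|F y| <= B, forall y, 1 <= `|y| -> F y = 0 &
  forall i y h, `|F (y + h *: 'e_i) - F y| <= B * `|h|].

Definition dadm B i F F' := forall y h,
  `|F (y + h *: 'e_i) - F y - h * F' y| <= B * h ^+ 2.

Lemma adm_ge0 B F : adm B F -> 0 <= B.
Proof. by move=> [F1 _ _]; apply: le_trans (F1 0). Qed.

Lemma adm_le B B' F : B <= B' -> adm B F -> adm B' F.
Proof.
move=> BB [F1 F2 F3]; split => // [y|i y h]; first exact: le_trans (F1 _) BB.
by apply: le_trans (F3 _ _ _) _; rewrite ler_wpM2r.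
Qed.

Lemma dadm_le B B' i F F' : B <= B' -> dadm B i F F' -> dadm B' i F F'.
Proof.
by move=> BB H y h; apply: le_trans (H _ _) _; rewrite ler_wpM2r ?sqr_ge0.
Qed.

Lemma adm_of_loc_lip F : loc_lip F -> (forall y, 1 <= `|y| -> F y = 0) -> exists B, adm B F.
Proof.
move=> [C C0 [F1 F2]] F0.
have Fb y : `|F y| <= C.
  have [y3|y3] := leP `|y| 3; first exact: F1.
  by rewrite F0 ?normr0//; apply: le_trans (ltW y3); rewrite ler1n.
exists (2 * C); split => // [y|i y h].
  by apply: le_trans (Fb y) _; rewrite ler_peMl// ler1n.
have [h1|h1] := leP `|h| 1; last first.
  apply: le_trans (ler_normB _ _) _; apply: le_trans (lerD (Fb _) (Fb _)) _.
  rewrite (_ : C + C = 2 * C); last by ring.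
  by rewrite ler_peMr ?mulr_ge0// ltW.
have [y2|y2] := leP `|y| 2.
  by apply: le_trans (F2 _ _ _ y2 h1) _; rewrite -mulrA ler_peMl ?mulr_ge0// ler1n.
rewrite !F0 ?subr0 ?normr0 ?mulr_ge0//; first by apply: le_trans (ltW y2); rewrite ler1n.
rewrite -[y](addrK (h *: 'e_i)) in y2.
by have := lt_le_trans y2 (ler_normB _ _); rewrite norm_sei; lra.
Qed.

Lemma dadm_of_loc_der i F F' B B' : adm B F -> adm B' F' -> loc_der i F F' -> exists B, dadm B i F F'.
Proof.
move=> aF aF' [C C0 H]; have B0 := adm_ge0 aF; have B'0 := adm_ge0 aF'.
have [F1 F2 F3] := aF; have [F1' F2' F3'] := aF'.
have s0 h : 0 <= h ^+ 2 :> R by rewrite sqr_ge0.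
exists (2 * B + B' + C) => y h.
have [h1|h1] := leP `|h| 1; last first.
  have h2 : `|h| <= h ^+ 2 by rewrite -[h ^+ 2]real_normK ?num_real// expr2 ler_peMr// ltW.
  have h3 : 1 <= h ^+ 2 by apply: le_trans h2; exact: ltW.
  apply: le_trans (ler_normB _ _) _; rewrite normrM.
  apply: (@le_trans _ _ (2 * B + h ^+ 2 * B')).
    apply: lerD; last by rewrite ler_pM.
    by apply: le_trans (ler_normB _ _) _; rewrite [2 * B]mulr_natl mulr2n lerD.
  rewrite [leRHS]mulrDl; apply: ler_wpDr; first by rewrite mulr_ge0.
  rewrite [leRHS]mulrDl [h ^+ 2 * _]mulrC lerD2r ler_peMr//.
  by rewrite mulr_ge0.
have [y2|y2] := leP `|y| 2.
  by apply: le_trans (H _ _ y2 h1) _; rewrite ler_wpM2r// lerDr addr_ge0 ?mulr_ge0.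
have y1 : 1 <= `|y| by apply: le_trans (ltW y2); rewrite ler1n.
have y1' : 1 <= `|y + h *: 'e_i|.
  rewrite -[y](addrK (h *: 'e_i)) in y2.
  by have := lt_le_trans y2 (ler_normB _ _); rewrite norm_sei; lra.
rewrite (F2 _ y1') (F2 _ y1) (F2' _ y1) mulr0 !subr0 normr0.
by apply: mulr_ge0 => //; rewrite !addr_ge0// mulr_ge0.
Qed.

(** A compactly supported solution of [Delta ker = 2^n bmp (2 .) - bmp], with its
    partial derivatives of order one and two. *)
Record kernel := Kernel {
  ker : 'rV[R]_n -> R;
  kd1 : 'I_n -> 'rV[R]_n -> R;
  kd2 : 'I_n -> 'I_n -> 'rV[R]_n -> R;
  bmp : 'rV[R]_n -> R;
  kB : R;
  ker_adm : adm kB ker;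
  kd1_adm : forall i, adm kB (kd1 i);
  kd2_adm : forall i j, adm kB (kd2 i j);
  bmp_adm : adm kB bmp;
  ker_dadm : forall i, dadm kB i ker (kd1 i);
  kd1_dadm : forall i j, dadm kB j (kd1 i) (kd2 i j);
  ker_laplacian : forall y, \sum_i kd2 i i y = 2 ^+ n * bmp (2 *: y) - bmp y;
  bmp_ge0 : forall y, 0 <= bmp y;
  bmp_gt0 : exists2 b, 0 < b & exists k, forall y, `|y| <= 2 ^- k -> b <= bmp y
}.

Lemma exists_kernel : (3 <= n)%N -> inhabited kernel.
Proof.
move=> n3.
have [g0 [g1 [g2 [kap [B [kap0 B0 [T0 T1] gz gL]]]]]] := @profile_exists R n n3.
have n0 : 0 <= 9 * n%:R :> R by rewrite mulr_ge0.
have one0 : [set s : R | 0 <= s] 1 by rewrite /= ler01.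
have z1 : [/\ g0 1 = 0, g1 1 = 0 & g2 1 = 0] by exact: gz.
have [C0 C00 L0] := taylor1_loc_lip B0 n0 T0.
have [C1 C10 L1] := taylor1_loc_lip B0 n0 T1.
have L2 s t : 0 <= s <= 9 * n%:R -> 0 <= t <= 9 * n%:R -> `|g2 t - g2 s| <= 2 * B * `|t - s|.
  by move=> /andP[s0 _] /andP[t0 _]; exact: (taylor1_lip T1).
have B2 : 0 <= 2 * B by rewrite mulr_ge0.
have bd (g : R -> R) C : 0 <= C -> g 1 = 0 -> (forall s t, 0 <= s <= 9 * n%:R -> 0 <= t <= 9 * n%:R ->
    `|g t - g s| <= C * `|t - s|) -> forall s, 0 <= s <= 9 * n%:R -> `|g s| <= C * (9 * n%:R).
  move=> C0' g10 L s sM; rewrite -[g s]subr0 -g10.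
  have n1 : 1 <= 9 * n%:R :> R by rewrite -natrM ler1n muln_gt0 /= (leq_trans _ n3).
  apply: le_trans (L 1 s _ sM) _; first by rewrite ler01 n1.
  rewrite ler_wpM2l// ler_norml; lra.
have lg0 := loc_lip_comp C00 L0.
have lg1 := loc_lip_comp C10 L1.
have lg2 := loc_lip_comp B2 L2.
have [z10 z11 z12] := z1.
have d0 i := loc_der_comp i B0 (mulr_ge0 C10 n0) T0 (bd _ _ C10 z11 L1).
have d1 i := loc_der_comp i B0 (mulr_ge0 B2 n0) T1 (bd _ _ B2 z12 L2).
pose K0 y := g0 (sq y).
pose K1 i y := g1 (sq y) * (2 * y 0 i).
pose K2 i j y := g2 (sq y) * (2 * y 0 j) * (2 * y 0 i) + g1 (sq y) * (2 * (j == i)%:R).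
pose psi y := kap * Num.max (1 - sq y) 0 ^+ 2.
have l2y i : loc_lip (fun y => 2 * y 0 i) by exact: (loc_lip_mul (loc_lip_cst 2) (loc_lip_coord i)).
have lK0 : loc_lip K0 by [].
have lK1 i : loc_lip (K1 i) by exact: (loc_lip_mul lg1 (l2y i)).
have lK2 i j : loc_lip (K2 i j).
  apply: loc_lip_add; last exact: (loc_lip_mul lg1 (loc_lip_cst _)).
  exact: loc_lip_mul (loc_lip_mul lg2 (l2y j)) (l2y i).
have lpsi : loc_lip psi.
  apply: loc_lip_mul; first exact: loc_lip_cst.
  have L (s t : R) : `|Num.max (1 - t) 0 - Num.max (1 - s) 0| <= 1 * `|t - s|.
    clear; rewrite mul1r; case: (leP (1 - t) 0) => t1; case: (leP (1 - s) 0) => s1;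
      rewrite ler_norml; have := ler_norm (t - s); have := lerNnormlW (lexx `|t - s|); lra.
  have := @loc_lip_comp (fun s => Num.max (1 - s) 0) 1 ler01 (fun s t _ _ => L s t).
  move=> H; have := loc_lip_mul H H.
  by congr loc_lip; apply/funext => y; rewrite expr2.
have dK0 i : loc_der i K0 (K1 i) by exact: d0.
have dK1 i j : loc_der j (K1 i) (K2 i j).
  have dc : loc_der j (fun y => 2 * y 0 i) (fun=> 2 * (j == i)%:R).
    have [C C' H] := loc_der_coord j i.
    exists (2 * C) => [|y h y2 h1]; first by rewrite mulr_ge0.
    rewrite (_ : _ - _ - _ = 2 * ((y + h *: 'e_j) 0 i - y 0 i - h * (j == i)%:R)); last by ring.
    by rewrite normrM normr_nat -mulrA ler_wpM2l// H.
  exact: loc_der_mul lg1 (l2y i) (d1 j) dc.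
have zK0 y : 1 <= `|y| -> K0 y = 0 by move=> /sq_ge1 /gz[].
have zK1 i y : 1 <= `|y| -> K1 i y = 0 by rewrite /K1 => /sq_ge1 /gz[_ -> _]; rewrite mul0r.
have zK2 i j y : 1 <= `|y| -> K2 i j y = 0.
  by rewrite /K2 => /sq_ge1 /gz[_ -> ->]; rewrite !mul0r addr0.
have zpsi y : 1 <= `|y| -> psi y = 0.
  by rewrite /psi => /sq_ge1 s1; rewrite max_r ?subr_le0// expr0n mulr0.
have [Ba aK0] := adm_of_loc_lip lK0 zK0.
have [Bb _ aK1] := uniform_cst (fun i C C' => @adm_le C C' (K1 i))
  (fun i => adm_of_loc_lip (lK1 i) (zK1 i)).
have [Bc _ aK2] := uniform_cst (fun (p : 'I_n * 'I_n) C C' => @adm_le C C' (K2 p.1 p.2))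
  (fun p => adm_of_loc_lip (lK2 p.1 p.2) (zK2 p.1 p.2)).
have [Bd apsi] := adm_of_loc_lip lpsi zpsi.
have [Be Be0 aD0] := uniform_cst (fun i C C' => @dadm_le C C' i K0 (K1 i))
  (fun i => dadm_of_loc_der aK0 (aK1 i) (dK0 i)).
have [Bf Bf0 aD1] := uniform_cst (fun (p : 'I_n * 'I_n) C C' => @dadm_le C C' p.2 (K1 p.1) (K2 p.1 p.2))
  (fun p => dadm_of_loc_der (aK1 p.1) (aK2 p) (dK1 p.1 p.2)).
have pa := adm_ge0 aK0; have pd := adm_ge0 apsi.
have i0 : 'I_n by exact: (Ordinal (ltnW (ltnW n3))).
have pb := adm_ge0 (aK1 i0); have pc := adm_ge0 (aK2 (i0, i0)).
pose BB := Ba + Bb + Bc + Bd + Be + Bf.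
constructor; apply: (@Kernel K0 K1 K2 psi BB).
- by apply: adm_le aK0; rewrite /BB; lra.
- by move=> i; apply: adm_le (aK1 i); rewrite /BB; lra.
- by move=> i j; apply: adm_le (aK2 (i, j)); rewrite /BB; lra.
- by apply: adm_le apsi; rewrite /BB; lra.
- by move=> i; apply: dadm_le (aD0 i); rewrite /BB; lra.
- by move=> i j; apply: dadm_le (aD1 (i, j)); rewrite /BB; lra.
- move=> y; rewrite /psi (_ : sq (2 *: y) = 4 * sq y); last first.
    by rewrite /sq mulr_sumr; apply: eq_bigr => i _; rewrite mxE; ring.
  rewrite -gL ?sq_ge0// /K2 big_split /=; congr (_ + _).
    rewrite (eq_bigr (fun i => 4 * g2 (sq y) * y 0 i ^+ 2)); last by move=> i _; ring.
    by rewrite -mulr_sumr -/(sq y); ring.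
  rewrite (eq_bigr (fun=> g1 (sq y) * 2)); last by move=> i _; rewrite eqxx mulr1.
  by rewrite sumr_const card_ord -[_ *+ n]mulr_natr; ring.
- by move=> y; rewrite mulr_ge0 ?sqr_ge0 ?ltW.
- exists (kap / 4); first by rewrite divr_gt0.
  have nn0 : 0 < n%:R :> R by rewrite ltr0n (leq_trans _ n3).
  have [||k Hk] := @expr_small R 2^-1 (2 * n%:R)^-1; [clear; lra|by rewrite invr_gt0 mulr_gt0|].
  exists k => y yk; rewrite /psi ler_wpM2l ?(ltW kap0)//.
  have q1 : 2 ^- k <= 1 :> R by rewrite invf_le1 ?exprn_gt0// exprn_ege1// ler1n.
  have s2 : sq y <= 1 / 2.
    apply: le_trans (sq_le yk) _.
    apply: (@le_trans _ _ (n%:R * (2 ^- k : R))).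
      by rewrite ler_wpM2l// expr2 ler_piMl// invr_ge0 exprn_ge0.
    have := Hk k (leqnn k); rewrite exprVn invfM => /(ler_wpM2l (ltW nn0)) /le_trans; apply.
    by rewrite mulrCA mulfV ?gt_eqF// mulr1 mul1r.
  rewrite max_l; last by clear -s2; lra.
  rewrite (_ : 4^-1 = (1 / 2) ^+ 2 :> R); last by field.
  by rewrite lerXn2r ?nnegrE; clear -s2; lra.
Qed.

End Kernel.

(** * Series and the dyadic summation *)

Section Series.
Context {R : realType}.
Implicit Types (t u : nat -> R) (q A B : R).

Definition ser t : R := limn (series t).

Lemma geom_sum_le q K : 0 <= q < 1 -> \sum_(k < K) q ^+ k <= (1 - q)^-1.
Proof.
move=> /andP[q0 q1]; have q1' : 0 < 1 - q by rewrite subr_gt0.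
rewrite -[leRHS]mul1r ler_pdivlMr//.
have -> : (\sum_(k < K) q ^+ k) * (1 - q) = 1 - q ^+ K.
  elim: K => [|K ih]; first by rewrite big_ord0 mul0r expr0 subrr.
  by rewrite big_ord_recr /= mulrDl ih exprSr; ring.
by rewrite gerBl exprn_ge0.
Qed.

Lemma geom_dom_le q A t K : 0 <= q < 1 -> 0 <= A -> (forall k, `|t k| <= A * q ^+ k) ->
  \sum_(k < K) `|t k| <= A / (1 - q).
Proof.
move=> q01 A0 H; apply: le_trans (ler_sum _ (fun (k : 'I_K) _ => H k)) _.
by rewrite -mulr_sumr ler_wpM2l// geom_sum_le.
Qed.

Lemma ser_cvg t A : (forall K, \sum_(k < K) `|t k| <= A) -> cvgn (series t).
Proof.
move=> H; apply: normed_cvg; apply: nondecreasing_is_cvgn.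
  by apply: nondecreasing_series => k _ _ /=; exact: normr_ge0.
exists A => _ [K _ <-]; change (\sum_(0 <= k < K) `|t k| <= A); rewrite big_mkord; exact: H.
Qed.

Lemma ser_le t A : (forall K, \sum_(k < K) `|t k| <= A) -> `|ser t| <= A.
Proof.
move=> H; have c := ser_cvg H.
have ev K : `|series t K| <= A.
  by apply: le_trans (H K); rewrite /series /= big_mkord ler_norm_sum.
rewrite ler_norml; apply/andP; split.
  by apply: limr_ge => //; near=> K; have := ev K; rewrite ler_norml => /andP[].
by apply: limr_le => //; near=> K; have := ev K; rewrite ler_norml => /andP[].
Unshelve. all: by end_near. Qed.

Lemma ser_lin t u A B a : (forall K, \sum_(k < K) `|t k| <= A) ->
  (forall K, \sum_(k < K) `|u k| <= B) ->
  ser (fun k => a * t k + u k) = a * ser t + ser u.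
Proof.
move=> Ht Hu; apply: cvg_lim => //.
rewrite (_ : series _ = (fun K => a * series t K + series u K)); last first.
  by apply/funext => K; rewrite /series /= big_split /= mulr_sumr.
apply: cvgD; last exact: (ser_cvg Hu).
by apply: cvgMl_tmp; exact: (ser_cvg Ht).
Qed.

Lemma ser_telescope u l q A : 0 <= q < 1 -> 0 <= A -> (forall k, `|u k - l| <= A * q ^+ k) ->
  ser (fun k => u k.+1 - u k) = l - u 0%N.
Proof.
move=> q01 A0 H; apply: cvg_lim => //.
rewrite (_ : series _ = (fun K => u K - u 0%N)); last first.
  by apply/funext => K; rewrite /series /= telescope_sumr.
apply: cvgB; last exact: cvg_cst.
apply/cvgrPdist_le => e e0.
have [|k Hk] := expr_small q01 (_ : 0 < e / (A + 1)); first by rewrite divr_gt0// ltr_wpDl.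
exists k => // j /= kj; rewrite distrC; apply: le_trans (H j) _.
apply: le_trans (ler_wpM2l A0 (Hk j kj)) _.
by rewrite mulrCA ler_piMr ?(ltW e0)// ler_pdivrMr ?ltr_wpDl// mul1r lerDl.
Qed.

Lemma two_powR_bounds (alpha : R) : 0 < alpha -> alpha < 1 ->
  [/\ 0 < 2 `^ (- alpha) :> R, 2 `^ (- alpha) < 1 :> R & 1 < 2 * 2 `^ (- alpha) :> R].
Proof.
move=> a0 a1.
have lt2 (x y : R) : x < y -> (2 : R) `^ x < 2 `^ y.
  by move=> xy; rewrite /powR pnatr_eq0 /= ltr_expR ltr_pM2r// ln_gt0// ltr1n.
split; first exact: powR_gt0.
  by rewrite -[ltRHS](powRr0 2) lt2// oppr_lt0.
rewrite powRN ltr_pdivlMr ?powR_gt0// mul1r -[ltRHS]powRr1//.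
exact: lt2.
Qed.

(** The summation behind the Schauder estimate: at scale [2^-k] an increment
    [h] is seen either as small, where a smooth kernel gains the factor
    [2^k h], or as large, where only the size [q^k = 2^(- k alpha)] is left. *)
Lemma dyadic_sum (alpha A h : R) (a : nat -> R) : 0 < alpha < 1 -> 0 <= A -> 0 < `|h| <= 1 ->
  let q := 2 `^ (- alpha) in
  (forall k, 2 ^+ k * `|h| <= 1 -> a k <= A * (2 ^+ k * `|h|) * q ^+ k) ->
  (forall k, 1 < 2 ^+ k * `|h| -> a k <= A * q ^+ k) ->
  forall K, \sum_(k < K) a k <=
    A * ((2 * q / (2 * q - 1) + (1 - q)^-1) / q) * `|h| `^ alpha.
Proof.
move=> /andP[a0 a1] A0 /andP[h0 h1] q Hs Hl.
have [q0 q1 q2] := two_powR_bounds a0 a1; rewrite -/q in q0 q1 q2.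
have [N N1 N2] : exists2 N, 2 ^+ N * `|h| <= 1 & 1 < 2 ^+ N.+1 * `|h|.
  have ex : exists k, 1 < 2 ^+ k * `|h|.
    have [||k Hk] := @expr_small R 2^-1 (`|h| / 2); [lra|by rewrite divr_gt0|].
    exists k; have := Hk k (leqnn _); rewrite exprVn ler_pdivlMr// => H.
    rewrite -ltr_pdivrMl ?exprn_gt0// mulr1; apply: lt_le_trans H.
    by rewrite ltr_pMr ?invr_gt0 ?exprn_gt0// ltr1n.
  case: (ex_minnP ex) => -[|N] N1 Nmin.
    by move: N1; rewrite expr0 mul1r ltNge h1.
  by exists N => //; rewrite leNgt; apply/negP => /Nmin; rewrite ltnn.
set X := 2 * q / (2 * q - 1).
have X0 : 0 < X by rewrite divr_gt0 ?mulr_gt0// subr_gt0.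
have Y0 : 0 < (1 - q)^-1 by rewrite invr_gt0 subr_gt0.
have p1 K : (K <= N.+1)%N -> \sum_(k < K) a k <= A * `|h| * (2 * q) ^+ K / (2 * q - 1).
  have d0 : 0 < 2 * q - 1 by rewrite subr_gt0.
  elim: K => [_|K ih KN]; first by rewrite big_ord0 expr0 mulr1 divr_ge0 ?(ltW d0)// mulr_ge0.
  rewrite big_ord_recr /=; apply: le_trans (lerD (ih (ltnW KN)) (Hs K _)) _.
    apply: le_trans N1; rewrite ler_wpM2r// ler_weXn2l//; lra.
  rewrite le_eqVlt; apply/orP; left; apply/eqP.
  rewrite !exprMn !exprS; move: (2 ^+ K) (q ^+ K) => u v.
  by field; rewrite gt_eqF.
have base : A * `|h| * (2 * q) ^+ N.+1 / (2 * q - 1) <= A * X * q ^+ N.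
  rewrite (_ : _ / _ = A * X * q ^+ N * (2 ^+ N * `|h|)); last first.
    rewrite /X exprMn !exprS; move: (2 ^+ N) (q ^+ N) => u v.
    by field; rewrite gt_eqF// subr_gt0.
  by rewrite ler_piMr// mulr_ge0 ?exprn_ge0 ?(ltW q0)// mulr_ge0 ?(ltW X0).
have p2 j : \sum_(k < N.+1 + j) a k <= A * X * q ^+ N + A * q ^+ N * \sum_(k < j) q ^+ k.
  elim: j => [|j ih].
    by rewrite addn0 big_ord0 mulr0 addr0; apply: le_trans (p1 _ (leqnn _)) base.
  rewrite addnS big_ord_recr /= [in leRHS]big_ord_recr /= mulrDr addrA.
  apply: lerD => //; apply: le_trans (Hl _ _) _.
    apply: lt_le_trans N2 _; rewrite ler_wpM2r// ler_weXn2l//; [lra|exact: leq_addr].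
  rewrite -mulrA ler_wpM2l// -exprD ler_wiXn2l ?(ltW q0) ?(ltW q1)//.
have qN : q ^+ N <= `|h| `^ alpha / q.
  rewrite ler_pdivlMr// -exprSr /q -powR_mulrn ?powR_ge0// -powRrM.
  rewrite mulrC mulrN -mulNr powRrM ge0_ler_powR ?nnegrE ?powR_ge0 ?(ltW a0)//.
  rewrite powRN powR_mulrn// -[leLHS]mul1r ler_pdivrMr ?exprn_gt0//.
  by rewrite mulrC ltW.
have fin : A * X * q ^+ N + A * q ^+ N * (1 - q)^-1 <= A * ((X + (1 - q)^-1) / q) * `|h| `^ alpha.
  rewrite (_ : _ + _ = A * (X + (1 - q)^-1) * q ^+ N); last by ring.
  rewrite (_ : A * (_ / q) * _ = A * (X + (1 - q)^-1) * (`|h| `^ alpha / q)); last by ring.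
  by rewrite ler_wpM2l// mulr_ge0// addr_ge0// ltW.
move=> K; apply: le_trans fin.
have g0 : 0 <= A * q ^+ N * (1 - q)^-1.
  by rewrite mulr_ge0 ?(ltW Y0)// mulr_ge0// exprn_ge0// ltW.
have [KN|NK] := leqP K N.+1.
  apply: le_trans (p1 _ KN) _; apply: (@le_trans _ _ (A * X * q ^+ N)); last by rewrite lerDl.
  apply: le_trans base; rewrite ler_wpM2r ?invr_ge0 ?subr_ge0 ?(ltW q2)// ler_wpM2l ?mulr_ge0//.
  by rewrite ler_weXn2l// ltW.
rewrite -(subnKC (ltnW NK)); apply: le_trans (p2 _) _; rewrite lerD2l ler_wpM2l//.
  by rewrite mulr_ge0// exprn_ge0// ltW.
by apply: geom_sum_le; rewrite q1 ltW.
Qed.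

End Series.

(** * Hoelder functions *)

(** A single constant bounds both the supremum and the Hoelder seminorm. *)
Definition hol (R : realType) (n : nat) (alpha : R) (B : set 'rV[R]_n) (C : R) (f : 'rV[R]_n -> R) :=
  (forall x, B x -> `|f x| <= C) /\
  (forall x y, B x -> B y -> `|f x - f y| <= C * `|x - y| `^ alpha).

Section Hoelder.
Context {R : realType} {n : nat} (alpha : R).
Hypothesis alpha01 : 0 < alpha < 1.
Implicit Types (x y : 'rV[R]_n) (f g : 'rV[R]_n -> R) (B : set 'rV[R]_n) (A C D h : R).

  Local Notation hol := (hol alpha).

Let a0 : 0 <= alpha. Proof. by case/andP: alpha01 => /ltW. Qed.

Lemma hol_le B C C' f : C <= C' -> hol B C f -> hol B C' f.
Proof.
move=> CC [f1 f2]; split=> [x Bx|x y Bx By]; first exact: le_trans (f1 x Bx) CC.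
by apply: le_trans (f2 x y Bx By) _; rewrite ler_wpM2r ?powR_ge0.
Qed.

Lemma hol_sub B B' C f : B' `<=` B -> hol B C f -> hol B' C f.
Proof. by move=> BB [f1 f2]; split=> [x /BB|x y /BB Bx /BB]; [exact: f1|exact: f2]. Qed.

Lemma hol_add B C D f g : hol B C f -> hol B D g -> hol B (C + D) (fun x => f x + g x).
Proof.
move=> [f1 f2] [g1 g2]; split=> [x Bx|x y Bx By].
  by apply: le_trans (ler_normD _ _) _; rewrite lerD ?f1 ?g1.
rewrite opprD addrACA mulrDl; apply: le_trans (ler_normD _ _) _.
by rewrite lerD ?f2 ?g2.
Qed.

Lemma hol_scale B C c f : hol B C f -> hol B (`|c| * C) (fun x => c * f x).
Proof.
move=> [f1 f2]; split=> [x Bx|x y Bx By]; first by rewrite normrM ler_wpM2l ?f1.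
by rewrite -mulrBr normrM -mulrA ler_wpM2l ?f2.
Qed.

Lemma hol_mul B C D f g : 0 <= C -> 0 <= D ->
  hol B C f -> hol B D g -> hol B (2 * (C * D)) (fun x => f x * g x).
Proof.
move=> C0 D0 [f1 f2] [g1 g2]; have cd : 0 <= C * D by rewrite mulr_ge0.
split=> [x Bx|x y Bx By].
  rewrite normrM (@le_trans _ _ (C * D))//; first by rewrite ler_pM ?f1 ?g1.
  by rewrite ler_peMl// ler1n.
rewrite (_ : _ - _ = f x * (g x - g y) + (f x - f y) * g y); last by ring.
apply: le_trans (ler_normD _ _) _; rewrite !normrM mulr_natl mulr2n mulrDl lerD//.
  by rewrite -mulrA ler_pM ?f1 ?g2.
by rewrite mulrAC ler_pM ?f2 ?g1.
Qed.

Lemma powR_ge_id (h : R) : 0 <= h <= 1 -> h <= h `^ alpha.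
Proof.
move=> /andP[h0 h1]; have [->|hn0] := eqVneq h 0; first exact: powR_ge0.
have hp : 0 < h by rewrite lt_neqAle eq_sym hn0.
rewrite ger1_powR ?hp//.
by case/andP: alpha01 => _ /ltW.
Qed.

Lemma powR_ge1 (h : R) : 1 <= h -> 1 <= h `^ alpha.
Proof. by move=> h1; rewrite -[leLHS](powRr0 h) ler_powR. Qed.

(** Small increments along the axes suffice: large ones are controlled by the
    supremum. *)
Lemma hol_of_coord A C f : 0 <= C -> (forall x, `|f x| <= A) ->
  (forall x i h, `|h| <= 1 -> `|f (x + h *: 'e_i) - f x| <= C * `|h| `^ alpha) ->
  hol setT (A + n%:R * (2 * A + C)) f.
Proof.
move=> C0 f1 f2; have A0 : 0 <= A by apply: le_trans (f1 0).
have AC : 0 <= 2 * A + C by rewrite addr_ge0 ?mulr_ge0.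
split=> [x _|x y _ _]; first by apply: le_trans (f1 x) _; rewrite lerDl mulr_ge0.
rewrite distrC hyb_telescope.
apply: le_trans (ler_norm_sum _ _ _) _.
apply: le_trans (_ : \sum_(k < n) (2 * A + C) * `|x - y| `^ alpha <= _); last first.
  by rewrite sumr_const card_ord -[_ *+ n]mulr_natl mulrA ler_wpM2r ?powR_ge0// lerDr.
apply: ler_sum => k _; set h := y 0 k - x 0 k; set z := hyb _ _ _.
have hxy : `|h| <= `|x - y|.
  by rewrite /h distrC; apply: le_trans (coord_le_norm _ k); rewrite !mxE.
apply: (@le_trans _ _ ((2 * A + C) * `|h| `^ alpha)); last first.
  by rewrite ler_wpM2l// ge0_ler_powR// nnegrE.
have [h1|h1] := leP `|h| 1.
  by apply: le_trans (f2 _ _ _ h1) _; rewrite ler_wpM2r ?powR_ge0// lerDr mulr_ge0.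
apply: le_trans (ler_normB _ _) _; apply: le_trans (lerD (f1 _) (f1 _)) _.
apply: (@le_trans _ _ (2 * A + C)); first by rewrite mulr_natl mulr2n lerDl.
by rewrite ler_peMr// powR_ge1// ltW.
Qed.

Lemma powR_half k : (2 ^- k) `^ alpha = (2 `^ (- alpha)) ^+ k :> R.
Proof.
have two0 : 0 <= 2 :> R by exact: ler0n.
rewrite -(powR_invn _ two0) -powRrM mulNr [_ * alpha]mulrC -mulNr powRrM.
exact: powR_mulrn (powR_ge0 _ _).
Qed.

End Hoelder.

(** * Convolution with a dilated kernel *)

Section Convolution.
Context {R : realType} {n : nat} (alpha : R).
Hypothesis alpha01 : 0 < alpha < 1.
Variable M : mean n alpha.
Implicit Types (x y : 'rV[R]_n) (f g F Phi : 'rV[R]_n -> R) (A B C h : R) (G : 'rV[R]_n -> R).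

  Local Notation hol := (hol alpha).
  Local Notation q := (2 `^ (- alpha)).
  Local Notation mc := (mean_cst M).

Let a0 : 0 <= alpha. Proof. by case/andP: alpha01 => /ltW. Qed.

(** The dilation to scale [2^-k] that preserves the mean. *)
Definition dil Phi k y : R := (2 ^+ k) ^+ n * Phi (2 ^+ k *: y).

Definition conv Phi k f x : R := M (fun y => dil Phi k y * f (x - y)).

Let p2 k : 0 < 2 ^+ k :> R. Proof. by rewrite exprn_gt0. Qed.
Let pn k : 0 <= (2 ^+ k) ^+ n :> R. Proof. by rewrite !exprn_ge0. Qed.

Lemma mean_local k A F : (forall y, `|F y| <= (2 ^+ k) ^+ n * A) ->
  (forall y, 2 * 2 ^- k < `|y| -> F y = 0) -> `|M F| <= mc * A.
Proof.
move=> FA F0; apply: le_trans (@mean_cube _ _ _ M 0 k _ _ FA _) _.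
  by move=> y; rewrite subr0; exact: F0.
by rewrite -mulrA mulKf// gt_eqF// exprn_gt0.
Qed.

Lemma bnd_dil B Phi k : adm B Phi -> bnd (dil Phi k).
Proof.
move=> [P1 _ _]; exists ((2 ^+ k) ^+ n * B) => y.
by rewrite normrM ger0_norm// ler_wpM2l.
Qed.

Lemma bnd_mul F G : bnd F -> bnd G -> bnd (fun y => F y * G y).
Proof.
move=> [A FA] [B GB]; exists (A * B) => y.
by rewrite normrM ler_pM.
Qed.

Lemma bnd_refl f x : bnd f -> bnd (fun y => f (x - y)).
Proof. by move=> [A fA]; exists A => y. Qed.

Lemma bnd_shift f x : bnd f -> bnd (fun y => f (y + x)).
Proof. by move=> [A fA]; exists A => y. Qed.

Lemma hol_bnd C f : hol setT C f -> bnd f.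
Proof. by move=> [f1 _]; exists C => y; exact: f1. Qed.

Lemma dil_out B Phi k y : adm B Phi -> 2 ^- k <= `|y| -> dil Phi k y = 0.
Proof.
move=> [_ P2 _] yk; rewrite /dil P2 ?mulr0// normrZ ger0_norm ?(ltW (p2 k))//.
by rewrite -ler_pdivrMl// mulr1.
Qed.

Lemma dil_shift Phi k y i h :
  dil Phi k (y + h *: 'e_i) = (2 ^+ k) ^+ n * Phi (2 ^+ k *: y + (2 ^+ k * h) *: 'e_i).
Proof. by rewrite /dil scalerDr scalerA. Qed.

Lemma dil_lip B Phi k y i h : adm B Phi ->
  `|dil Phi k (y + h *: 'e_i) - dil Phi k y| <= (2 ^+ k) ^+ n * (B * (2 ^+ k * `|h|)).
Proof.
move=> [_ _ P3]; rewrite dil_shift /dil -mulrBr normrM ger0_norm// ler_wpM2l//.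
by apply: le_trans (P3 _ _ _) _; rewrite normrM (ger0_norm (ltW (p2 k))).
Qed.

Lemma dil_hol B Phi k : adm B Phi -> exists C, hol setT C (dil Phi k).
Proof.
move=> aP; have B0 := adm_ge0 aP; have [A HA] := bnd_dil k aP.
have C0 : 0 <= (2 ^+ k) ^+ n * (B * 2 ^+ k) by rewrite !mulr_ge0.
eexists; apply: (hol_of_coord alpha01 C0 HA) => x i h h1.
apply: le_trans (dil_lip _ _ _ _ aP) _.
rewrite (mulrA B) mulrA ler_wpM2l// powR_ge_id//.
by rewrite normr_ge0.
Qed.

Lemma dil_out2 B Phi k y i h : adm B Phi -> 2 ^+ k * `|h| <= 1 -> 2 * 2 ^- k < `|y| ->
  dil Phi k (y + h *: 'e_i) = 0 /\ dil Phi k y = 0.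
Proof.
move=> aP hk yk.
have hk' : `|h| <= 2 ^- k by rewrite -[leRHS]mulr1 ler_pdivlMl.
have yk' := yk; rewrite -[y](addrK (h *: 'e_i)) in yk'.
have := lt_le_trans yk' (ler_normB _ _); rewrite norm_sei => {}yk'.
have k0 : 0 < 2 ^- k :> R by rewrite invr_gt0.
split; apply: (dil_out aP); first by rewrite ltW//; lra.
by rewrite ltW//; lra.
Qed.

Lemma h_le1 k (h : R) : 2 ^+ k * `|h| <= 1 -> `|h| <= 1.
Proof. by apply: le_trans; rewrite ler_peMl// exprn_ege1// ler1n. Qed.

Lemma mean_dil_shift B Phi k i h : adm B Phi -> `|h| <= 1 ->
  M (fun y => dil Phi k (y + h *: 'e_i)) = M (dil Phi k).
Proof.
move=> aP h1; have [C [_ H]] := dil_hol k aP.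
apply: (@mean_shift _ _ _ M i (dil Phi k) C h) => //; first exact: bnd_dil aP.
  by move=> y y'; exact: H.
move=> y y1; apply: (dil_out aP); apply: le_trans (ltW y1).
by rewrite invf_le1// exprn_ege1// ler1n.
Qed.

(** Translation invariance moves the increment from [f] to the kernel. *)
Lemma conv_shift B Phi k C f x i h : adm B Phi -> hol setT C f -> `|h| <= 1 ->
  conv Phi k f (x + h *: 'e_i) = M (fun y => dil Phi k (y + h *: 'e_i) * f (x - y)).
Proof.
move=> aP fC h1; have [D HD] := dil_hol k aP.
have C0 : 0 <= C by case: fC => f1 _; apply: le_trans (f1 0 I).
have D0 : 0 <= D by case: HD => f1 _; apply: le_trans (f1 0 I).
pose F y := dil Phi k y * f (x + h *: 'e_i - y).
have HF : hol setT (2 * (D * C)) F.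
  apply: hol_mul => //; case: fC => [f1 f2]; split=> [y _|y y' _ _]; first exact: f1.
  apply: le_trans (f2 _ _ I I) _; rewrite opprB addrC addrA subrK.
  by rewrite -normrN opprB.
rewrite /conv -/F -(@mean_shift _ _ _ M i F (2 * (D * C)) h) //.
- by congr (M _); apply/funext => y; rewrite /F opprD addrACA subrr addr0.
- exact: hol_bnd HF.
- by move=> y y'; case: HF => _; exact.
move=> y y1; rewrite /F (dil_out aP) ?mul0r//; apply: le_trans (ltW y1).
by rewrite invf_le1// exprn_ege1// ler1n.
Qed.

Lemma meanB F G : bnd F -> bnd G -> M (fun y => F y - G y) = M F - M G.
Proof.
move=> Fb Gb; rewrite addrC -[- M G]mulN1r -mean_lin//.
by congr (M _); apply/funext => y; rewrite mulN1r addrC.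
Qed.

Lemma bndB F G : bnd F -> bnd G -> bnd (fun y => F y - G y).
Proof.
by move=> [A FA] [B GB]; exists (A + B) => y; apply: le_trans (ler_normB _ _) _; rewrite lerD.
Qed.

Lemma bndZ c F : bnd F -> bnd (fun y => c * F y).
Proof. by move=> [A FA]; exists (`|c| * A) => y; rewrite normrM ler_wpM2l. Qed.

Lemma meanZ c F : bnd F -> M (fun y => c * F y) = c * M F.
Proof.
move=> Fb; rewrite -[RHS]addr0 -(lin_cst0 (mean_lin M)) -mean_lin//; last exact: bnd0.
by congr (M _); apply/funext => y; rewrite addr0.
Qed.

Lemma mean_osc k A C (D : 'rV[R]_n -> R) f x : 0 <= A -> hol setT C f ->
  (forall y, `|D y| <= (2 ^+ k) ^+ n * A) ->
  (forall y, 2 * 2 ^- k < `|y| -> D y = 0) ->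
  `|M (fun y => D y * (f (x - y) - f x))| <= mc * (2 * A * C * q ^+ k).
Proof.
move=> A0 fC DA Dk.
have C0 : 0 <= C by case: fC => f1 _; apply: le_trans (f1 0 I).
case: fC => f1 f2.
apply: (@mean_local k) => [y|y yk]; last by rewrite Dk// mul0r.
rewrite normrM.
have [yk|yk] := leP `|y| (2 * 2 ^- k); last by rewrite Dk// normr0 mul0r !mulr_ge0// exprn_ge0// powR_ge0.
rewrite [leRHS](_ : _ = (2 ^+ k) ^+ n * A * (C * (2 * q ^+ k))); last by ring.
apply: ler_pM => //.
apply: le_trans (f2 _ _ I I) _; rewrite ler_wpM2l//.
rewrite addrAC subrr sub0r normrN.
apply: (@le_trans _ _ ((2 * 2 ^- k) `^ alpha)).
  by rewrite ge0_ler_powR// nnegrE// mulr_ge0// invr_ge0 ltW.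
rewrite powRM// ?invr_ge0 ?exprn_ge0// powR_half ler_wpM2r// ?exprn_ge0 ?powR_ge0//.
by apply: ler1_powR; [rewrite ler1n|case/andP: alpha01 => _ /ltW].
Qed.

(** Against a kernel of mean zero, [f (x - y)] may be replaced by
    [f (x - y) - f x], which is small where the kernel lives. *)
Lemma mean_zero_osc k A C (D : 'rV[R]_n -> R) f x : 0 <= A -> hol setT C f -> bnd D -> M D = 0 ->
  (forall y, `|D y| <= (2 ^+ k) ^+ n * A) ->
  (forall y, 2 * 2 ^- k < `|y| -> D y = 0) ->
  `|M (fun y => D y * f (x - y))| <= mc * (2 * A * C * q ^+ k).
Proof.
move=> A0 fC Db D0 DA Dk.
have -> : M (fun y => D y * f (x - y)) = M (fun y => D y * (f (x - y) - f x)).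
  have fb := hol_bnd fC.
  rewrite -[LHS]subr0 -(mulr0 (f x)) -D0 -meanZ// -meanB; [|by apply: bnd_mul => //; exact: bnd_refl|exact: bndZ].
  by congr (M _); apply/funext => y; ring.
exact: mean_osc.
Qed.

Lemma conv_le B Phi k A f x : adm B Phi -> (forall y, `|f y| <= A) ->
  `|conv Phi k f x| <= mc * (B * A).
Proof.
move=> aP fA; apply: (@mean_local k) => [y|y yk].
  rewrite normrM mulrA; apply: ler_pM => //.
  by rewrite normrM ger0_norm// ler_wpM2l//; case: aP.
rewrite (dil_out aP) ?mul0r//; apply: le_trans (ltW yk).
by rewrite ler_peMl ?ler1n// invr_ge0 ltW.
Qed.

Lemma conv_osc B Phi k C f x : adm B Phi -> hol setT C f -> M (dil Phi k) = 0 ->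
  `|conv Phi k f x| <= mc * (2 * B * C * q ^+ k).
Proof.
move=> aP fC P0; apply: mean_zero_osc => //; first exact: adm_ge0 aP.
- exact: bnd_dil aP.
- by move=> y; rewrite normrM ger0_norm// ler_wpM2l//; case: aP.
move=> y yk; rewrite (dil_out aP)//; apply: le_trans (ltW yk).
by rewrite ler_peMl ?ler1n// invr_ge0 ltW.
Qed.

Lemma conv_lip B Phi k C f x i h : adm B Phi -> hol setT C f -> 2 ^+ k * `|h| <= 1 ->
  `|conv Phi k f (x + h *: 'e_i) - conv Phi k f x| <=
  mc * (2 * (B * (2 ^+ k * `|h|)) * C * q ^+ k).
Proof.
move=> aP fC hk; have h1 := h_le1 hk; have B0 := adm_ge0 aP.
have fb := bnd_refl x (hol_bnd fC); have db := bnd_dil k aP.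
have db' := bnd_shift (h *: 'e_i) db.
rewrite (conv_shift _ _ _ aP fC h1) /conv -meanB; [|exact: bnd_mul|exact: bnd_mul].
under [X in M X]eq_fun do rewrite -mulrBl.
apply: mean_zero_osc => //.
- by rewrite !mulr_ge0// ltW.
- exact: bndB.
- by rewrite meanB// (mean_dil_shift _ _ aP)// subrr.
- by move=> y; exact: dil_lip.
by move=> y yk; have [-> ->] := dil_out2 i aP hk yk; rewrite subrr.
Qed.

Section Derivative.
Variables (B : R) (Phi Phi' : 'rV[R]_n -> R) (i : 'I_n).
Hypotheses (aP : adm B Phi) (aP' : adm B Phi') (dP : dadm B i Phi Phi').

Let dd k h y := dil Phi k (y + h *: 'e_i) - dil Phi k y - h * (2 ^+ k * dil Phi' k y).

Let dd_le k h y : `|dd k h y| <= (2 ^+ k) ^+ n * (B * (2 ^+ k * `|h|) ^+ 2).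
Proof.
rewrite /dd dil_shift /dil (_ : _ - _ - _ = (2 ^+ k) ^+ n * (Phi (2 ^+ k *: y + (2 ^+ k * h) *: 'e_i)
  - Phi (2 ^+ k *: y) - (2 ^+ k * h) * Phi' (2 ^+ k *: y))); last by ring.
rewrite normrM ger0_norm// ler_wpM2l//; apply: le_trans (dP _ _) _.
by rewrite !exprMn real_normK ?num_real.
Qed.

Let dd_out k h y : 2 ^+ k * `|h| <= 1 -> 2 * 2 ^- k < `|y| -> dd k h y = 0.
Proof.
move=> hk yk; have [e1 e2] := dil_out2 i aP hk yk; have [_ e3] := dil_out2 i aP' hk yk.
by rewrite /dd e1 e2 e3 subrr !mulr0 subr0.
Qed.

Let dd_bnd k h : bnd (dd k h).
Proof.
apply: bndB; first by apply: bndB; [apply: bnd_shift|]; exact: bnd_dil aP.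
by apply: bndZ; apply: bndZ; exact: bnd_dil aP'.
Qed.

Let mean_dd k h : `|h| <= 1 -> M (dd k h) = - (h * (2 ^+ k * M (dil Phi' k))).
Proof.
move=> h1; have b1 := bnd_dil k aP; have b2 := bnd_dil k aP'.
have b1' := bnd_shift (h *: 'e_i) b1; have b2' := bndZ h (bndZ (2 ^+ k) b2).
rewrite meanB//; last exact: bndB.
rewrite meanB// (mean_dil_shift _ _ aP)// subrr sub0r meanZ; last exact: bndZ.
by rewrite meanZ.
Qed.

(** Difference quotients have mean zero by translation invariance, and they
    approach the derivative uniformly. *)
Lemma mean_dil_deriv k : M (dil Phi' k) = 0.
Proof.
have B0 := adm_ge0 aP; have mc0 : 0 <= mc by exact: mean_cst_ge0.
have H t : 0 < t <= 1 -> `|M (dil Phi' k)| <= mc * B * t.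
  move=> /andP[t0 t1]; pose h := t / 2 ^+ k : R.
  have h0 : 0 < h by rewrite divr_gt0.
  have hk : 2 ^+ k * `|h| = t by rewrite gtr0_norm// mulrC divfK// gt_eqF.
  have hk1 : 2 ^+ k * `|h| <= 1 by rewrite hk.
  clearbody h.
  have := @mean_local k _ _ (dd_le k h) (fun y => dd_out hk1).
  rewrite mean_dd ?(h_le1 hk1)// normrN !normrM (ger0_norm (ltW (p2 k))).
  have E : `|h| * (2 ^+ k * `|M (dil Phi' k)|) = t * `|M (dil Phi' k)|.
    by rewrite mulrCA mulrA hk.
  rewrite E hk => H.
  rewrite -(ler_pM2l t0); apply: le_trans H _.
  by rewrite le_eqVlt; apply/orP; left; apply/eqP; ring.
apply/eqP; rewrite -normr_le0; apply/ler_addgt0Pl => e e0; rewrite addr0.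
have D0 : 0 < mc * B + 1 by rewrite ltr_wpDl// mulr_ge0.
pose t := Num.min 1 (e / (mc * B + 1)).
have t0 : 0 < t by rewrite lt_min ltr01 divr_gt0.
apply: le_trans (H t _) _; first by rewrite t0 ge_min lexx.
apply: (@le_trans _ _ ((mc * B + 1) * t)).
  by rewrite ler_wpM2r ?(ltW t0)// lerDl.
by rewrite -ler_pdivlMl// mulrC ge_min lexx orbT.
Qed.

Let conv_dd k C f x h : hol setT C f -> `|h| <= 1 ->
  conv Phi k f (x + h *: 'e_i) - conv Phi k f x - h * (2 ^+ k * conv Phi' k f x) =
  M (fun y => dd k h y * f (x - y)).
Proof.
move=> fC h1; have fb := bnd_refl x (hol_bnd fC).
have b1 := bnd_dil k aP; have b2 := bnd_dil k aP'.
have b1' := bnd_shift (h *: 'e_i) b1.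
rewrite (conv_shift _ _ _ aP fC h1) /conv -meanZ; last exact: bnd_mul.
rewrite -meanZ; last by apply: bndZ; exact: bnd_mul.
rewrite -meanB; [|exact: bnd_mul|exact: bnd_mul].
rewrite -meanB; [|by apply: bndB; exact: bnd_mul|by apply: bndZ; apply: bndZ; exact: bnd_mul].
by congr (M _); apply/funext => y; rewrite /dd; ring.
Qed.

Lemma conv_deriv k C f x h : hol setT C f -> 2 ^+ k * `|h| <= 1 ->
  `|conv Phi k f (x + h *: 'e_i) - conv Phi k f x - h * (2 ^+ k * conv Phi' k f x)| <=
  mc * (B * (2 ^+ k * `|h|) ^+ 2 * C).
Proof.
move=> fC hk; rewrite (conv_dd _ _ fC (h_le1 hk)).
apply: (@mean_local k) => [y|y yk]; last by rewrite dd_out// mul0r.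
by rewrite normrM mulrA; apply: ler_pM => //; case: fC => f1 _; exact: f1.
Qed.

(** The kernel of the remainder has mean zero as well, which gains [q^k]. *)
Lemma conv_deriv_osc k C f x h : hol setT C f -> 2 ^+ k * `|h| <= 1 ->
  `|conv Phi k f (x + h *: 'e_i) - conv Phi k f x - h * (2 ^+ k * conv Phi' k f x)| <=
  mc * (2 * (B * (2 ^+ k * `|h|) ^+ 2) * C * q ^+ k).
Proof.
move=> fC hk; rewrite (conv_dd _ _ fC (h_le1 hk)).
apply: mean_zero_osc => //.
- by rewrite mulr_ge0 ?sqr_ge0// (adm_ge0 aP).
- by rewrite mean_dd ?(h_le1 hk)// mean_dil_deriv !mulr0 oppr0.
- by move=> y; exact: dd_out.
Qed.

End Derivative.

Lemma conv_lin B Phi k a f g x : adm B Phi -> bnd f -> bnd g ->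
  conv Phi k (fun y => a * f y + g y) x = a * conv Phi k f x + conv Phi k g x.
Proof.
move=> aP fb gb; have b1 := bnd_dil k aP.
rewrite /conv -mean_lin; [|by apply: bnd_mul => //; exact: bnd_refl|by apply: bnd_mul => //; exact: bnd_refl].
by congr (M _); apply/funext => y; ring.
Qed.

Lemma conv_smooth B Phi k C f f' x i h : adm B Phi -> bnd f -> bnd f' ->
  (forall x, `|f (x + h *: 'e_i) - f x - h * f' x| <= C) ->
  `|conv Phi k f (x + h *: 'e_i) - conv Phi k f x - h * conv Phi k f' x| <= mc * (B * C).
Proof.
move=> aP fb fb' H; have b1 := bnd_dil k aP.
have c1 := bnd_mul b1 (bnd_refl x fb); have c2 := bnd_mul b1 (bnd_refl x fb').
have c3 := bnd_mul b1 (bnd_refl (x + h *: 'e_i) fb).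
rewrite /conv -meanZ// -meanB// -meanB; [|exact: bndB|exact: bndZ].
apply: (@mean_local k) => [y|y yk].
  rewrite (_ : _ - _ - _ = dil Phi k y * (f (x + h *: 'e_i - y) - f (x - y) - h * f' (x - y))); last by ring.
  rewrite normrM mulrA; apply: ler_pM => //.
    by rewrite normrM ger0_norm// ler_wpM2l//; case: aP.
  by rewrite [x + _ - y]addrAC.
rewrite (dil_out aP) ?mul0r ?mulr0 ?subrr//; apply: le_trans (ltW yk).
by rewrite ler_peMl ?ler1n// invr_ge0 ltW.
Qed.

End Convolution.

(** * Inverting the Laplacian up to an average *)

Section Solver.
Context {R : realType} {n : nat} (alpha : R).
Hypothesis alpha01 : 0 < alpha < 1.
Variable M : mean n alpha.
Variable K : @kernel R n.
Implicit Types (x y : 'rV[R]_n) (f g F Phi : 'rV[R]_n -> R) (A C h : R).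

  Local Notation hol := (hol alpha).
  Local Notation q := (2 `^ (- alpha)).
  Local Notation mc := (mean_cst M).
  Local Notation B := (kB K).

Let q0 : 0 < q :> R. Proof. exact: powR_gt0. Qed.
Let q1 : q < 1 :> R.
Proof. by case/andP: alpha01 => a0 a1; case: (two_powR_bounds a0 a1). Qed.
Let q2 : 1 < 2 * q :> R.
Proof. by case/andP: alpha01 => a0 a1; case: (two_powR_bounds a0 a1). Qed.
Let q01 : 0 <= q < 1. Proof. by rewrite q1 ltW ?q0. Qed.
Let mc0 : 0 <= mc. Proof. exact: mean_cst_ge0. Qed.
Let B0 : 0 <= B. Proof. exact: adm_ge0 (ker_adm K). Qed.
Let p2 k : 0 < 2 ^+ k :> R. Proof. by rewrite exprn_gt0. Qed.

Let half_le_q k : 2 ^- k <= q ^+ k :> R.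
Proof.
rewrite -exprVn; apply: lerXn2r; rewrite ?nnegrE ?invr_ge0// ?ltW//.
by rewrite -[ltLHS]mulr1 ltr_pdivrMl.
Qed.

Definition mass : R := M (bmp K).

Lemma mass_gt0 : 0 < mass.
Proof.
have [b b0 Hb] := bmp_gt0 K; apply: (@mean_gt0 _ _ _ M b _ b0) => //.
  by have [b1 _ _] := bmp_adm K; exists B.
exact: bmp_ge0.
Qed.

(** The sum over all scales of convolutions with the kernel.  Since the Laplacian
    of the kernel is a difference of two scalings of one bump, the Laplacian of
    the sum telescopes, from the identity down to convolution with the bump.
    [pot1] and [pot2] are the termwise derivatives. *)
Definition pot f x := ser (fun k => 4 ^- k * conv M (ker K) k f x) / mass.
Definition pot1 i f x := ser (fun k => 2 ^- k * conv M (kd1 K i) k f x) / mass.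
Definition pot2 i j f x := ser (fun k => conv M (kd2 K i j) k f x) / mass.
Definition bavg f x := conv M (bmp K) 0 f x / mass.

(** Differentiability of [f] in direction [i] with a Hoelder remainder, in a form
    that passes through convolutions and infinite sums. *)
Definition sder C i f f' := forall x h, `|h| <= 1 ->
  `|f (x + h *: 'e_i) - f x - h * f' x| <= C * (`|h| * `|h| `^ alpha).

Let Cd : R := (2 * q / (2 * q - 1) + (1 - q)^-1) / q.

Let Cd0 : 0 <= Cd.
Proof.
rewrite divr_ge0 ?(ltW q0)// addr_ge0 ?invr_ge0 ?subr_ge0 ?(ltW q1)//.
by rewrite divr_ge0 ?subr_ge0 ?(ltW q2)// mulr_ge0// ltW.
Qed.

Let zero1 i k : M (dil (kd1 K i) k) = 0.
Proof. exact: (mean_dil_deriv alpha01 M (ker_adm K) (kd1_adm K i) (ker_dadm K i)). Qed.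

Let zero2 i j k : M (dil (kd2 K i j) k) = 0.
Proof. exact: (mean_dil_deriv alpha01 M (kd1_adm K i) (kd2_adm K i j) (kd1_dadm K i j)). Qed.

Lemma ser_comb (A A' : R) (t u v : nat -> R) h : 0 <= A -> 0 <= A' ->
  (forall k, `|t k| <= A * q ^+ k) -> (forall k, `|u k| <= A * q ^+ k) ->
  (forall k, `|v k| <= A' * q ^+ k) ->
  ser t - ser u - h * ser v = ser (fun k => t k - u k - h * v k).
Proof.
move=> A0 A'0 Ht Hu Hv.
have D (s : nat -> R) A2 : 0 <= A2 -> (forall k, `|s k| <= A2 * q ^+ k) ->
    forall L, \sum_(k < L) `|s k| <= A2 / (1 - q).
  by move=> A20 Hs L; exact: geom_dom_le.
have S1 := @ser_lin _ u t _ _ (-1) (D _ _ A0 Hu) (D _ _ A0 Ht).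
have Hs L : \sum_(k < L) `|(-1) * u k + t k| <= A / (1 - q) + A / (1 - q).
  apply: le_trans (lerD (D _ _ A0 Hu L) (D _ _ A0 Ht L)); rewrite -big_split /=.
  by apply: ler_sum => k _; apply: le_trans (ler_normD _ _) _; rewrite mulN1r normrN.
have S2 := @ser_lin _ v (fun k => -1 * u k + t k) _ _ (- h) (D _ _ A'0 Hv) Hs.
rewrite (_ : (fun k => t k - u k - h * v k) = (fun k => - h * v k + (-1 * u k + t k))).
  by rewrite S2 S1; ring.
by apply/funext => k; ring.
Qed.

Section OneFunction.
Variables (C : R) (f : 'rV[R]_n -> R).
Hypothesis fC : hol setT C f.

Let C0 : 0 <= C.
Proof. by case: fC => f1 _; apply: le_trans (f1 0 I). Qed.

Let f1 y : `|f y| <= C. Proof. by case: fC => H _; exact: H. Qed.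

Let A : R := mc * (2 * B * C).

Let A0 : 0 <= A. Proof. by rewrite !mulr_ge0. Qed.

Let mBC_le : mc * (B * C) <= A.
Proof. by rewrite ler_wpM2l// -mulrA ler_peMl ?mulr_ge0// ler1n. Qed.

Let w0 k x : `|4 ^- k * conv M (ker K) k f x| <= A * (2 ^- k * q ^+ k).
Proof.
rewrite (_ : 4 ^- k = 2 ^- k * 2 ^- k :> R); last first.
  by rewrite -invfM -exprMn; congr (_ ^+ _)^-1; ring.
rewrite normrM ger0_norm ?mulr_ge0 ?invr_ge0 ?exprn_ge0// mulrC.
apply: ler_pM; rewrite ?mulr_ge0 ?invr_ge0 ?exprn_ge0//.
  by apply: le_trans (conv_le M k x (ker_adm K) f1) _.
by rewrite ler_wpM2l ?invr_ge0 ?exprn_ge0.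
Qed.

Let w1 i k x : `|2 ^- k * conv M (kd1 K i) k f x| <= A * (2 ^- k * q ^+ k).
Proof.
rewrite normrM ger0_norm ?invr_ge0 ?exprn_ge0// mulrCA ler_wpM2l ?invr_ge0 ?exprn_ge0//.
by apply: le_trans (conv_osc alpha01 x (kd1_adm K i) fC (zero1 i k)) _; rewrite mulrA.
Qed.

Let w2 i j k x : `|conv M (kd2 K i j) k f x| <= A * q ^+ k.
Proof.
by apply: le_trans (conv_osc alpha01 x (kd2_adm K i j) fC (zero2 i j k)) _; rewrite mulrA.
Qed.

Let half1 k : 2 ^- k <= 1 :> R.
Proof. by rewrite invf_le1// exprn_ege1// ler1n. Qed.

Let weak (t : nat -> R) : (forall k, `|t k| <= A * (2 ^- k * q ^+ k)) ->
  forall k, `|t k| <= A * q ^+ k.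
Proof.
move=> H k; apply: le_trans (H k) _; rewrite ler_wpM2l//.
by apply: ler_piMl => //; rewrite exprn_ge0// ltW.
Qed.

Let ser_bnd (t : nat -> R) : (forall k, `|t k| <= A * q ^+ k) -> `|ser t / mass| <= A / (1 - q) / mass.
Proof.
move=> Ht; rewrite normrM (@ger0_norm _ mass^-1) ?invr_ge0 ?(ltW mass_gt0)//.
rewrite ler_wpM2r ?invr_ge0 ?(ltW mass_gt0)//; apply: ser_le => L.
exact: geom_dom_le L q01 A0 Ht.
Qed.

Lemma pot_bnd x : `|pot f x| <= A / (1 - q) / mass.
Proof. exact: ser_bnd (weak (fun k => w0 k x)). Qed.

Lemma pot1_bnd i x : `|pot1 i f x| <= A / (1 - q) / mass.
Proof. exact: ser_bnd (weak (fun k => w1 i k x)). Qed.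

Lemma pot2_bnd i j x : `|pot2 i j f x| <= A / (1 - q) / mass.
Proof. exact: ser_bnd (fun k => w2 i j k x). Qed.

(** At scales coarser than [h] the remainder of each term is used; at finer ones
    the three terms of the remainder are estimated separately. *)
Let ser_sder (t u v : nat -> R) h : 0 < `|h| <= 1 ->
  (forall k, `|t k| <= A * (2 ^- k * q ^+ k)) ->
  (forall k, `|u k| <= A * (2 ^- k * q ^+ k)) -> (forall k, `|v k| <= A * q ^+ k) ->
  (forall k, 2 ^+ k * `|h| <= 1 -> `|t k - u k - h * v k| <= A * `|h| * (2 ^+ k * `|h|) * q ^+ k) ->
  `|ser t / mass - ser u / mass - h * (ser v / mass)| <= 3 * A * Cd / mass * (`|h| * `|h| `^ alpha).
Proof.
move=> h01 Ht Hu Hv Hs.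
have [h0 h1] := andP h01.
rewrite (_ : _ - _ - _ = (ser t - ser u - h * ser v) / mass); last by ring.
rewrite (ser_comb _ A0 A0 (weak Ht) (weak Hu) Hv) normrM (@ger0_norm _ mass^-1) ?invr_ge0 ?(ltW mass_gt0)//.
rewrite (_ : _ * _ * (_ * _) = (3 * A * `|h| * Cd * `|h| `^ alpha) / mass); last by ring.
rewrite ler_wpM2r ?invr_ge0 ?(ltW mass_gt0)//; apply: ser_le => L.
apply: (@dyadic_sum R alpha (3 * A * `|h|) h (fun k => `|t k - u k - h * v k|) alpha01 _ h01 _ _ L) => [|k hk|k hk].
- by rewrite !mulr_ge0.
- apply: le_trans (Hs k hk) _.
  rewrite ler_wpM2r ?exprn_ge0 ?(ltW q0)// ler_wpM2r ?mulr_ge0 ?exprn_ge0//.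
  by rewrite ler_wpM2r// ler_peMl// ler1n.
have hk' : 2 ^- k <= `|h| by rewrite -[leLHS]mulr1 ler_pdivrMl// ltW.
have qk : 0 <= q ^+ k by rewrite exprn_ge0// ltW.
have H3 (s : nat -> R) : (forall k, `|s k| <= A * (2 ^- k * q ^+ k)) -> `|s k| <= A * `|h| * q ^+ k.
  by move=> /(_ k) /le_trans; apply; rewrite -mulrA ler_wpM2l// ler_wpM2r.
apply: le_trans (ler_normB _ _) _.
rewrite (_ : 3 * A * `|h| * q ^+ k = A * `|h| * q ^+ k + A * `|h| * q ^+ k + A * `|h| * q ^+ k); last by ring.
apply: lerD.
  by apply: le_trans (ler_normB _ _) _; apply: lerD; exact: H3.
by rewrite normrM mulrAC [_ * `|h|]mulrC ler_wpM2l.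
Qed.

Let sder0 (g g' : 'rV[R]_n -> R) C' i x : 
  `|g (x + (0 : R) *: 'e_i) - g x - 0 * g' x| <= C' * (`|0 : R| * `|0 : R| `^ alpha).
Proof. by rewrite scale0r addr0 subrr mul0r subrr normr0 mul0r mulr0. Qed.

Lemma pot_sder i : sder (3 * A * Cd / mass) i (pot f) (pot1 i f).
Proof.
move=> x h h1; have [->|hn0] := eqVneq h 0; first exact: sder0.
apply: ser_sder => [|k|k|k|k hk].
- by rewrite normr_gt0 hn0.
- exact: w0.
- exact: w0.
- exact: (weak (fun k => w1 i k x)).
have := conv_deriv alpha01 M (ker_adm K) (kd1_adm K i) (ker_dadm K i) x fC hk.
set c1 := conv _ _ _ _ _; set c2 := conv _ _ _ _ _; set c3 := conv _ _ _ _ _ => H.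
have e4 : 4 ^- k = 2 ^- k * 2 ^- k :> R.
  by rewrite -invfM -exprMn; congr (_ ^+ _)^-1; ring.
have e1 : 2 ^- k * 2 ^+ k = 1 :> R by rewrite mulVf// gt_eqF.
rewrite (_ : _ - _ - _ = 4 ^- k * (c1 - c2 - h * (2 ^+ k * c3))); last first.
  rewrite e4 !mulrBr; congr (_ - _).
  rewrite (_ : 2 ^- k * 2 ^- k * (h * (2 ^+ k * c3)) = 2 ^- k * 2 ^+ k * (h * (2 ^- k * c3))); last by ring.
  by rewrite e1 mul1r.
rewrite normrM ger0_norm ?invr_ge0 ?exprn_ge0//.
apply: le_trans (ler_wpM2l _ H) _; first by rewrite invr_ge0 exprn_ge0.
rewrite [leLHS](_ : _ = mc * (B * C) * (`|h| * `|h|)  * (2 ^- k * 2 ^+ k) ^+ 2); last by rewrite e4; ring.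
rewrite e1 expr1n mulr1 [leRHS](_ : _ = A * (`|h| * `|h|) * (2 ^+ k * q ^+ k)); last by ring.
rewrite -[leLHS]mulr1; apply: ler_pM; rewrite ?mulr_ge0//.
  by rewrite ler_wpM2r ?mulr_ge0.
by rewrite -exprMn exprn_ege1// ltW.
Qed.

Lemma pot1_sder i j : sder (3 * A * Cd / mass) j (pot1 i f) (pot2 i j f).
Proof.
move=> x h h1; have [->|hn0] := eqVneq h 0; first exact: sder0.
apply: ser_sder => [|k|k|k|k hk].
- by rewrite normr_gt0 hn0.
- exact: w1.
- exact: w1.
- exact: w2.
have := conv_deriv_osc alpha01 M (kd1_adm K i) (kd2_adm K i j) (kd1_dadm K i j) x fC hk.
set c1 := conv _ _ _ _ _; set c2 := conv _ _ _ _ _; set c3 := conv _ _ _ _ _ => H.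
have e1 : 2 ^- k * 2 ^+ k = 1 :> R by rewrite mulVf// gt_eqF.
rewrite (_ : _ - _ - _ = 2 ^- k * (c1 - c2 - h * (2 ^+ k * c3))); last first.
  rewrite !mulrBr; congr (_ - _).
  rewrite (_ : 2 ^- k * (h * (2 ^+ k * c3)) = 2 ^- k * 2 ^+ k * (h * c3)); last by ring.
  by rewrite e1 mul1r.
rewrite normrM ger0_norm ?invr_ge0 ?exprn_ge0//.
apply: le_trans (ler_wpM2l _ H) _; first by rewrite invr_ge0 exprn_ge0.
rewrite [leLHS](_ : _ = A * `|h| * (2 ^+ k * `|h|) * q ^+ k * (2 ^- k * 2 ^+ k)).
  by rewrite e1 mulr1.
by rewrite /A; ring.
Qed.

Lemma pot2_coord i j x l h : `|h| <= 1 ->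
  `|pot2 i j f (x + h *: 'e_l) - pot2 i j f x| <= 2 * A * Cd / mass * `|h| `^ alpha.
Proof.
move=> h1; have [->|hn0] := eqVneq h 0.
  rewrite scale0r addr0 subrr normr0; apply: mulr_ge0 (powR_ge0 _ _).
  by apply: divr_ge0 (ltW mass_gt0); apply: mulr_ge0 Cd0; exact: mulr_ge0.
have h01 : 0 < `|h| <= 1 by rewrite normr_gt0 hn0.
rewrite -mulrBl normrM (@ger0_norm _ mass^-1) ?invr_ge0 ?(ltW mass_gt0)//.
rewrite [leRHS]mulrAC ler_wpM2r ?invr_ge0 ?(ltW mass_gt0)//.
have z0 : forall k, `|(fun=> 0 : R) k| <= A * q ^+ k.
  by move=> k; rewrite normr0 mulr_ge0// exprn_ge0// ltW.
have := ser_comb 0 A0 A0 (fun k => w2 i j k (x + h *: 'e_l)) (fun k => w2 i j k x) z0.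
rewrite mul0r subr0 => ->; apply: ser_le => L.
apply: (@dyadic_sum R alpha (2 * A) h (fun k => `|conv M (kd2 K i j) k f (x + h *: 'e_l) -
  conv M (kd2 K i j) k f x - 0 * 0|) alpha01 _ h01 _ _ L) => [|k hk|k hk].
- by rewrite mulr_ge0.
- rewrite mul0r subr0; apply: le_trans (conv_lip alpha01 M x l (kd2_adm K i j) fC hk) _.
  rewrite /A [leRHS](_ : _ = 2 * (mc * (2 * (B * (2 ^+ k * `|h|)) * C * q ^+ k))); last by ring.
  by rewrite ler_peMl ?ler1n// !mulr_ge0 ?exprn_ge0// ltW.
rewrite mul0r subr0; apply: le_trans (ler_normB _ _) _.
by rewrite -mulrA mulr_natl mulr2n; apply: lerD; exact: w2.
Qed.

(** Consecutive dilations of the bump differ by a sum of second derivatives,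
    which have mean zero. *)
Let mass_dil k : M (dil (bmp K) k) = mass.
Proof.
have e0 : M (dil (bmp K) 0) = mass.
  by congr (M _); apply/funext => y; rewrite /dil expr0 expr1n mul1r scale1r.
elim: k => // k <-; apply/eqP; rewrite -subr_eq0.
rewrite -meanB; [|exact: bnd_dil (bmp_adm K)|exact: bnd_dil (bmp_adm K)].
have -> : (fun y => dil (bmp K) k.+1 y - dil (bmp K) k y) = (fun y => \sum_i dil (kd2 K i i) k y).
  apply/funext => y; rewrite -mulr_sumr ker_laplacian /dil mulrBr; congr (_ - _).
  by rewrite exprS exprMn mulrA scalerA [_ * 2 ^+ n]mulrC.
have [_ ->] := lin_sum (mean_lin M) (index_enum _) (fun i => bnd_dil k (kd2_adm K i i)).
by rewrite big1.
Qed.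

Lemma laplacian_pot x : \sum_i pot2 i i f x = f x - bavg f x.
Proof.
have m0 : mass != 0 by rewrite gt_eqF ?mass_gt0.
have fb := bnd_refl x (hol_bnd fC); have bb k := bnd_dil k (bmp_adm K).
have tel : ser (fun k => conv M (bmp K) k.+1 f x - conv M (bmp K) k f x) =
    mass * f x - conv M (bmp K) 0 f x.
  apply: (ser_telescope q01 A0) => k.
  rewrite /conv -(mass_dil k) mulrC -meanZ// -meanB; [|exact: bnd_mul|exact: bndZ].
  rewrite (_ : (fun y => _) = (fun y => dil (bmp K) k y * (f (x - y) - f x))); last first.
    by apply/funext => y; ring.
  rewrite /A -mulrA; apply: (mean_osc alpha01 M x B0 fC) => [y|y yk].
    by rewrite normrM ger0_norm ?exprn_ge0 ?exprn_ge0// ler_wpM2l ?exprn_ge0 ?exprn_ge0//; case: (bmp_adm K).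
  rewrite (dil_out (bmp_adm K))//; apply: le_trans (ltW yk).
  by rewrite ler_peMl ?ler1n// invr_ge0 ltW.
rewrite /bavg -[f x](mulfK m0) [f x * _]mulrC -mulrBl -tel -mulr_suml; congr (_ / _).
suff : forall s : seq 'I_n, ser (fun k => \sum_(i <- s) conv M (kd2 K i i) k f x) =
    \sum_(i <- s) ser (fun k => conv M (kd2 K i i) k f x) /\
    exists2 A', 0 <= A' & forall k, `|\sum_(i <- s) conv M (kd2 K i i) k f x| <= A' * q ^+ k.
  move=> /(_ (index_enum _)) [<- _]; congr ser; apply/funext => k.
  rewrite /conv -meanB; [|exact: bnd_mul|exact: bnd_mul].
  have -> : (fun y => dil (bmp K) k.+1 y * f (x - y) - dil (bmp K) k y * f (x - y)) =
      (fun y => \sum_i dil (kd2 K i i) k y * f (x - y)).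
    apply/funext => y; rewrite -mulr_suml -mulr_sumr ker_laplacian /dil -mulrBl mulrBr; congr ((_ - _) * _).
    by rewrite exprS exprMn mulrA scalerA [_ * 2 ^+ n]mulrC.
  have bi i : bnd (fun y => dil (kd2 K i i) k y * f (x - y)).
    by apply: bnd_mul fb; exact: bnd_dil (kd2_adm K i i).
  by have [_ ->] := lin_sum (mean_lin M) (index_enum _) bi.
elim=> [|i s [Ms [A' A'0 HA']]].
  split.
    rewrite big_nil; apply/eqP; rewrite -normr_le0; apply: ser_le => L.
    by rewrite big1// => k _; rewrite big_nil normr0.
  by exists 0 => // k; rewrite big_nil normr0 mul0r.
split; last first.
  exists (A + A') => [|k]; first by rewrite addr_ge0.
  rewrite big_cons mulrDl; apply: le_trans (ler_normD _ _) _.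
  by rewrite lerD.
rewrite big_cons -Ms -[X in X + _]mul1r.
rewrite -(@ser_lin _ _ _ (A / (1 - q)) (A' / (1 - q)) 1); last 2 first.
- by move=> L; exact: (geom_dom_le L q01 A0 (fun k => w2 i i k x)).
- by move=> L; exact: (geom_dom_le L q01 A'0 HA').
by congr ser; apply/funext => k; rewrite big_cons mul1r.
Qed.

End OneFunction.
Lemma sder_pderiv C i f f' : sder C i f f' ->
  (forall x, derivable f x 'e_i) /\ pderiv i f = f'.
Proof.
move=> H; have a0 : 0 < alpha by case/andP: alpha01.
have D x := derive_of_bound a0 (H x).
by split=> [x|]; [case: (D x)|apply/funext => x; case: (D x)].
Qed.

Lemma hol_of_sder A A' C f (f' : 'I_n -> 'rV[R]_n -> R) : 0 <= C -> 0 <= A' ->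
  (forall x, `|f x| <= A) -> (forall i x, `|f' i x| <= A') -> (forall i, sder C i f (f' i)) ->
  hol setT (A + n%:R * (2 * A + (A' + C))) f.
Proof.
move=> C0 A'0 fA fA' H.
apply: (hol_of_coord alpha01) => // [|x i h h1]; first exact: addr_ge0.
rewrite -[X in `|X|](subrK (h * f' i x)); apply: le_trans (ler_normD _ _) _.
have hh : `|h| <= `|h| `^ alpha by rewrite powR_ge_id// normr_ge0.
rewrite addrC mulrDl; apply: lerD.
  by rewrite normrM mulrC; apply: ler_pM.
apply: le_trans (H i x h h1) _; rewrite ler_wpM2l//.
by rewrite -[leRHS]mul1r ler_wpM2r// powR_ge0.
Qed.

Let p4q k : 4 ^- k <= q ^+ k :> R.
Proof.
apply: le_trans (half_le_q k); rewrite lef_pV2 ?posrE ?exprn_gt0//.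
by rewrite lerXn2r ?nnegrE// ler_nat.
Qed.

Lemma ker_term A f k x : (forall y, `|f y| <= A) ->
  `|4 ^- k * conv M (ker K) k f x| <= mc * (B * A) * q ^+ k.
Proof.
move=> fA; rewrite normrM ger0_norm ?invr_ge0 ?exprn_ge0// mulrC.
by apply: ler_pM => //; rewrite ?invr_ge0 ?exprn_ge0// (conv_le M k x (ker_adm K) fA).
Qed.

Lemma pot_lin a f g x : bnd f -> bnd g ->
  pot (fun y => a * f y + g y) x = a * pot f x + pot g x.
Proof.
move=> fb gb; have [A fA] := fb; have [A' gA] := gb.
have A0 : 0 <= A by apply: le_trans (fA 0).
have A'0 : 0 <= A' by apply: le_trans (gA 0).
rewrite /pot mulrA -mulrDl; congr (_ / _).
rewrite -(@ser_lin _ _ _ (mc * (B * A) / (1 - q)) (mc * (B * A') / (1 - q)) a).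
- by congr ser; apply/funext => k; rewrite (conv_lin M k a x (ker_adm K) fb gb); ring.
- by move=> L; apply: (geom_dom_le L q01 _ (fun k => ker_term k x fA)); rewrite !mulr_ge0.
- by move=> L; apply: (geom_dom_le L q01 _ (fun k => ker_term k x gA)); rewrite !mulr_ge0.
Qed.

Lemma pot_smooth C i f f' : 0 <= C -> bnd f -> bnd f' -> sder C i f f' ->
  sder (mc * B / (1 - q) / mass * C) i (pot f) (pot f').
Proof.
move=> C0 fb fb' H x h h1; have [A fA] := fb; have [A' fA'] := fb'.
have A0 : 0 <= A by apply: le_trans (fA 0).
have A'0 : 0 <= A' by apply: le_trans (fA' 0).
pose t k := 4 ^- k * conv M (ker K) k f (x + h *: 'e_i).
pose u k := 4 ^- k * conv M (ker K) k f x.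
pose v k := 4 ^- k * conv M (ker K) k f' x.
rewrite /pot -/t -/u -/v (_ : _ - _ - _ = (ser t - ser u - h * ser v) / mass); last by ring.
have P0 A2 : 0 <= A2 -> 0 <= mc * (B * A2) by move=> A20; rewrite !mulr_ge0.
rewrite (ser_comb h (P0 A A0) (P0 A' A'0) (fun k => ker_term k _ fA) (fun k => ker_term k _ fA)
  (fun k => ker_term k _ fA')) normrM (@ger0_norm _ mass^-1) ?invr_ge0 ?(ltW mass_gt0)//.
rewrite (_ : _ * C * _ = mc * (B * (C * (`|h| * `|h| `^ alpha))) / (1 - q) / mass); last by ring.
rewrite ler_wpM2r ?invr_ge0 ?(ltW mass_gt0)//; apply: ser_le => L.
have H0 : 0 <= C * (`|h| * `|h| `^ alpha) by rewrite mulr_ge0// mulr_ge0// powR_ge0.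
apply: (@geom_dom_le R q _ (fun k => t k - u k - h * v k) L q01 (P0 _ H0)) => k.
rewrite (_ : t k - _ - _ = 4 ^- k * (conv M (ker K) k f (x + h *: 'e_i) -
  conv M (ker K) k f x - h * conv M (ker K) k f' x)); last by rewrite /v /u /t; ring.
rewrite normrM ger0_norm ?invr_ge0 ?exprn_ge0// mulrC.
apply: ler_pM; rewrite ?invr_ge0 ?exprn_ge0//.
by apply: (conv_smooth M k x (ker_adm K) fb fb') => z; exact: H.
Qed.

Lemma bavg_lin a f g x : bnd f -> bnd g ->
  bavg (fun y => a * f y + g y) x = a * bavg f x + bavg g x.
Proof.
by move=> fb gb; rewrite /bavg (conv_lin M 0 a x (bmp_adm K) fb gb); ring.
Qed.

Lemma bavg_smooth C i f f' : 0 <= C -> bnd f -> bnd f' -> sder C i f f' ->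
  sder (mc * B / mass * C) i (bavg f) (bavg f').
Proof.
move=> C0 fb fb' H x h h1; rewrite /bavg.
rewrite (_ : _ - _ - _ = (conv M (bmp K) 0 f (x + h *: 'e_i) - conv M (bmp K) 0 f x -
  h * conv M (bmp K) 0 f' x) / mass); last by ring.
rewrite normrM (@ger0_norm _ mass^-1) ?invr_ge0 ?(ltW mass_gt0)//.
rewrite (_ : _ * C * _ = mc * (B * (C * (`|h| * `|h| `^ alpha))) / mass); last by ring.
rewrite ler_wpM2r ?invr_ge0 ?(ltW mass_gt0)//.
by apply: (conv_smooth M 0 x (bmp_adm K) fb fb') => z; exact: H.
Qed.

(** Convolution with a fixed smooth bump is estimated through any bound [W] on
    integrals against [f]: the two choices below are the supremum of [f], and
    that supremum times the volume of the support. *)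
Lemma hol_bavg C W f : hol setT C f -> 0 <= W ->
  (forall x D A, (forall y, `|D y| <= A) -> (forall y, 2 < `|y| -> D y = 0) ->
     `|M (fun y => D y * f (x - y))| <= mc * W * A) ->
  let A := mc * B / mass * W in hol setT (A + n%:R * (2 * A + A)) (bavg f).
Proof.
move=> fC W0 HM; have m0 := mass_gt0.
have d0 y : dil (bmp K) 0 y = bmp K y by rewrite /dil expr0 expr1n mul1r scale1r.
have h0 h : `|h| <= 1 -> 2 ^+ 0 * `|h| <= 1 by rewrite expr0 mul1r.
apply: (hol_of_coord alpha01) => [|x|x i h h1].
- by rewrite mulr_ge0// divr_ge0 ?(ltW m0)// mulr_ge0.
- rewrite /bavg normrM (@ger0_norm _ mass^-1) ?invr_ge0 ?(ltW m0)//.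
  rewrite (_ : mc * B / mass * W = mc * W * B / mass); last by ring.
  rewrite ler_wpM2r ?invr_ge0 ?(ltW m0)//; apply: HM => y; first by rewrite d0; case: (bmp_adm K).
  move=> y2; apply: (dil_out (bmp_adm K)); rewrite expr0 invr1.
  by apply: le_trans (ltW y2); rewrite ler1n.
apply: (@le_trans _ _ (mc * B / mass * W * `|h|)); last first.
  rewrite ler_wpM2l ?powR_ge_id ?normr_ge0// mulr_ge0//.
  by rewrite divr_ge0 ?(ltW m0)// mulr_ge0.
rewrite /bavg -mulrBl normrM (@ger0_norm _ mass^-1) ?invr_ge0 ?(ltW m0)//.
rewrite (_ : mc * B / mass * W * `|h| = mc * W * (B * `|h|) / mass); last by ring.
rewrite ler_wpM2r ?invr_ge0 ?(ltW m0)//.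
have fb := bnd_refl x (hol_bnd fC); have db := bnd_dil 0 (bmp_adm K).
have db' := bnd_shift (h *: 'e_i) db.
rewrite (conv_shift alpha01 M 0 x i (bmp_adm K) fC h1) /conv -meanB; [|exact: bnd_mul|exact: bnd_mul].
under [X in M X]eq_fun do rewrite -mulrBl.
apply: HM => y; first by have := dil_lip 0 y i h (bmp_adm K); rewrite expr0 expr1n !mul1r.
have := @dil_out2 _ _ _ (bmp K) 0 y i h (bmp_adm K) (h0 h h1); rewrite expr0 invr1 mulr1 => H /H[-> ->].
by rewrite subrr.
Qed.

Lemma bavg_hol C f : hol setT C f ->
  let A := mc * B / mass * C in hol setT (A + n%:R * (2 * A + A)) (bavg f).
Proof.
move=> fC; have [f1 _] := fC; have C0 : 0 <= C by apply: le_trans (f1 0 I).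
apply: (hol_bavg fC C0) => x D A DA Dz; rewrite -mulrA [C * A]mulrC.
apply: (@mean_local _ _ _ M 0) => y; first by rewrite expr0 expr1n mul1r normrM ler_pM ?f1.
by rewrite expr0 invr1 mulr1 => /Dz ->; rewrite mul0r.
Qed.

Lemma bavg_small C l f : hol setT C f -> (forall y, 2 ^- l < `|y| -> f y = 0) ->
  let A := mc * B / mass * ((2 ^+ l) ^- n * C) in hol setT (A + n%:R * (2 * A + A)) (bavg f).
Proof.
move=> fC fl; have [f1 _] := fC; have C0 : 0 <= C by apply: le_trans (f1 0 I).
have l0 : 0 <= (2 ^+ l) ^- n :> R by rewrite invr_ge0 !exprn_ge0.
apply: (hol_bavg fC (mulr_ge0 l0 C0)) => x D A DA Dz.
rewrite (_ : mc * _ * A = mc * (2 ^+ l) ^- n * (A * C)); last by ring.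
apply: (@mean_cube _ _ _ M x) => y; first by rewrite normrM ler_pM ?f1.
rewrite distrC => xy; rewrite fl ?mulr0//; apply: le_lt_trans xy.
by rewrite ler_peMl ?ler1n// invr_ge0 ltW.
Qed.

(** The class C^{k,alpha} on [S], with one constant for all derivatives.  These
    are required to exist at every point, and only their bounds refer to [S]. *)
Fixpoint smooth (S : set 'rV[R]_n) (k : nat) (C : R) (f : 'rV[R]_n -> R) : Prop :=
  hol S C f /\ if k is k'.+1 then
    forall i, (forall x, derivable f x 'e_i) /\ smooth S k' C (pderiv i f) else True.

Lemma pot_smooth2 : exists2 D, 0 <= D & forall C f, hol setT C f -> smooth setT 2 (D * C) (pot f).
Proof.
have m0 := mass_gt0; have q1' : 0 < 1 - q :> R by rewrite subr_gt0.
pose s := mc * (2 * B) / (1 - q) / mass; pose d := 3 * (mc * (2 * B)) * Cd / mass.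
have s0 : 0 <= s.
  by apply: divr_ge0 (ltW m0); apply: divr_ge0 (ltW q1'); rewrite !mulr_ge0.
have d0 : 0 <= d.
  by apply: divr_ge0 (ltW m0); apply: mulr_ge0 Cd0; rewrite !mulr_ge0.
have n0 : 0 <= n%:R :> R by [].
exists (s + n%:R * (2 * s + (s + d))); first by rewrite addr_ge0// mulr_ge0// !addr_ge0// mulr_ge0.
move=> C f fC; have C0 : 0 <= C by case: fC => f1 _; apply: le_trans (f1 0 I).
have E : (s + n%:R * (2 * s + (s + d))) * C = s * C + n%:R * (2 * (s * C) + (s * C + d * C)) by ring.
have sE : mc * (2 * B * C) / (1 - q) / mass = s * C by rewrite /s; ring.
have dE : 3 * (mc * (2 * B * C)) * Cd / mass = d * C by rewrite /d; ring.
have sC : 0 <= s * C by rewrite mulr_ge0.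
have dC : 0 <= d * C by rewrite mulr_ge0.
have b0 x : `|pot f x| <= s * C by rewrite -sE; exact: pot_bnd.
have b1 i x : `|pot1 i f x| <= s * C by rewrite -sE; exact: pot1_bnd.
have b2 i j x : `|pot2 i j f x| <= s * C by rewrite -sE; exact: pot2_bnd.
have h1 i : sder (d * C) i (pot f) (pot1 i f) by rewrite -dE; exact: pot_sder.
have h2 i j : sder (d * C) j (pot1 i f) (pot2 i j f) by rewrite -dE; exact: pot1_sder.
rewrite E; split; first exact: hol_of_sder b0 b1 h1.
move=> i; have [D1 ->] := sder_pderiv (h1 i); split; first exact: D1.
split; first exact: hol_of_sder (b1 i) (b2 i) (h2 i).
move=> j; have [D2 ->] := sder_pderiv (h2 i j); split; first exact: D2.
split; last exact: Logic.I.
apply: hol_le (_ : s * C + n%:R * (2 * (s * C) + d * C) <= _) _.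
  by rewrite lerD2l ler_wpM2l// lerD2l lerDr.
apply: (hol_of_coord alpha01) => // x l h hh.
apply: le_trans (pot2_coord fC i j x l hh) _; rewrite ler_wpM2r ?powR_ge0// -dE.
by rewrite ler_wpM2r ?invr_ge0 ?(ltW m0)// ler_wpM2r// ler_wpM2r ?ler_nat// !mulr_ge0.
Qed.

Lemma laplacian_potE C f x : hol setT C f -> laplacian (pot f) x = f x - bavg f x.
Proof.
move=> fC; rewrite -(laplacian_pot fC); apply: eq_bigr => i _.
have [_ ->] := sder_pderiv (pot_sder fC i).
by have [_ ->] := sder_pderiv (pot1_sder fC i i).
Qed.

End Solver.

(** A right inverse [slv] of the Laplacian on bounded Hoelder functions, up to
    an averaging operator [avg]; both commute with partial derivatives. *)
Record solver (R : realType) (n : nat) (alpha : R) := Solver {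
  slv : ('rV[R]_n -> R) -> 'rV[R]_n -> R;
  avg : ('rV[R]_n -> R) -> 'rV[R]_n -> R;
  slvC : R;
  slvC_ge0 : 0 <= slvC;
  slv_smooth : forall C f, hol alpha setT C f -> smooth alpha setT 2 (slvC * C) (slv f);
  slv_lin : forall a f g x, bnd f -> bnd g ->
    slv (fun y => a * f y + g y) x = a * slv f x + slv g x;
  slv_sder : forall (C : R) i f f', 0 <= C -> bnd f -> bnd f' -> sder alpha C i f f' ->
    sder alpha (slvC * C) i (slv f) (slv f');
  avg_lin : forall a f g x, bnd f -> bnd g ->
    avg (fun y => a * f y + g y) x = a * avg f x + avg g x;
  avg_sder : forall (C : R) i f f', 0 <= C -> bnd f -> bnd f' -> sder alpha C i f f' ->
    sder alpha (slvC * C) i (avg f) (avg f');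
  avg_hol : forall C f, hol alpha setT C f -> hol alpha setT (slvC * C) (avg f);
  avg_small : forall C (l : nat) f, hol alpha setT C f -> (forall y, 2 ^- l < `|y| -> f y = 0) ->
    hol alpha setT (slvC * (2 ^+ l) ^- n * C) (avg f);
  laplacian_slv : forall C f x, hol alpha setT C f -> laplacian (slv f) x = f x - avg f x
}.

Lemma smooth_le (R : realType) (n : nat) (alpha : R) (S : set 'rV[R]_n) k (C C' : R) f : C <= C' ->
  smooth alpha S k C f -> smooth alpha S k C' f.
Proof.
move=> CC; elim: k f => [|k ih] f /= [fC H]; split=> //; try exact: hol_le CC fC.
by move=> i; have [D Hi] := H i; split=> //; exact: ih.
Qed.

Lemma sder_le (R : realType) (n : nat) (alpha C C' : R) i (f f' : 'rV[R]_n -> R) : C <= C' ->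
  sder alpha C i f f' -> sder alpha C' i f f'.
Proof.
move=> CC H x h h1; apply: le_trans (H x h h1) _.
by rewrite ler_wpM2r// mulr_ge0// powR_ge0.
Qed.

Lemma exists_solver (R : realType) (n : nat) (alpha : R) : 0 < alpha < 1 -> (3 <= n)%N ->
  inhabited (solver n alpha).
Proof.
move=> a01 n3; have a0 : 0 < alpha by case/andP: a01.
have [M] := exists_mean n a0; have [K] := @exists_kernel R n n3.
have [D D0 HD] := pot_smooth2 a01 M K.
have m0 := mass_gt0 M K; have mc0 := mean_cst_ge0 M; have B0 := adm_ge0 (ker_adm K).
have [_ q1 _] : [/\ 0 < 2 `^ (- alpha) :> R, 2 `^ (- alpha) < 1 :> R & 1 < 2 * 2 `^ (- alpha) :> R].
  by apply: two_powR_bounds => //; case/andP: a01.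
pose e1 := mean_cst M * kB K / (1 - 2 `^ (- alpha)) / mass M K.
pose e2 := mean_cst M * kB K / mass M K.
have e20 : 0 <= e2 by apply: divr_ge0 (ltW m0); exact: mulr_ge0.
have e10 : 0 <= e1.
  by apply: divr_ge0 (ltW m0); rewrite divr_ge0 ?subr_ge0 ?(ltW q1)// mulr_ge0.
have n0 : 0 <= n%:R :> R by [].
have en0 : 0 <= n%:R * (3 * e2) by apply: mulr_ge0 n0 (mulr_ge0 (ler0n _ _) e20).
pose CC := D + e1 + e2 + n%:R * (3 * e2).
have hC0 C (f : 'rV[R]_n -> R) : hol alpha setT C f -> 0 <= C by case=> f1 _; apply: le_trans (f1 0 I).
have [c1 c2 c3 c4] : [/\ D <= CC, e1 <= CC, e2 <= CC & e2 + n%:R * (3 * e2) <= CC].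
  rewrite /CC; move: (n%:R * (3 * e2)) en0 => en en0.
  by clear -D0 e10 e20 en0; move: e1 e2 e10 e20 => u v u0 v0; split; lra.
have CC0 : 0 <= CC by apply: le_trans c1.
constructor; apply: (@Solver R n alpha (pot M K) (bavg M K) CC) => //.
- move=> C f fC; apply: smooth_le (HD C f fC).
  exact: ler_wpM2r (hC0 _ _ fC) _ _ c1.
- by move=> a f g x fb gb; apply: pot_lin.
- move=> C i f f' C0 fb fb' H; apply: sder_le (pot_smooth a01 M K C0 fb fb' H).
  by rewrite ler_wpM2r.
- by move=> a f g x fb gb; apply: bavg_lin.
- move=> C i f f' C0 fb fb' H; apply: sder_le (bavg_smooth M K C0 fb fb' H).
  by rewrite ler_wpM2r.
- move=> C f fC; apply: hol_le (bavg_hol a01 M K fC); rewrite -/e2.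
  rewrite (_ : _ + _ = (e2 + n%:R * (3 * e2)) * C); last by ring.
  exact: ler_wpM2r (hC0 _ _ fC) _ _ c4.
- move=> C l f fC fl; apply: hol_le (bavg_small a01 M K fC fl); rewrite -/e2.
  rewrite (_ : _ + _ = (e2 + n%:R * (3 * e2)) * (2 ^+ l) ^- n * C); last by ring.
  apply: (ler_wpM2r (hC0 _ _ fC)); apply: ler_wpM2r c4.
  by rewrite invr_ge0 !exprn_ge0.
- by move=> C f x; exact: (laplacian_potE a01).
Qed.

(** * Iterating the inverse *)

Section Smooth.
Context {R : realType} {n : nat} (alpha : R).
Hypothesis alpha01 : 0 < alpha < 1.
Implicit Types (x y : 'rV[R]_n) (f g : 'rV[R]_n -> R) (B : set 'rV[R]_n) (A C D c h : R).

  Local Notation hol := (hol alpha).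
  Local Notation smooth := (smooth alpha).

(** Derivatives along words of indices compose by concatenation, so that no
    symmetry of partial derivatives enters. *)
Definition dword (s : seq 'I_n) f : 'rV[R]_n -> R := foldr pderiv f s.

Lemma dword_rcons s i f : dword (rcons s i) f = dword s (pderiv i f).
Proof. by rewrite /dword foldr_rcons. Qed.

Lemma pderivD i f g : (forall x, derivable f x 'e_i) -> (forall x, derivable g x 'e_i) ->
  (forall x, derivable (fun y => f y + g y) x 'e_i) /\
  pderiv i (fun y => f y + g y) = (fun x => pderiv i f x + pderiv i g x).
Proof.
move=> df dg; split=> [x|]; first exact: (derivableD (df x) (dg x)).
by apply/funext => x; exact: (deriveD (df x) (dg x)).
Qed.

Lemma pderivZ i c f : (forall x, derivable f x 'e_i) ->
  (forall x, derivable (fun y => c * f y) x 'e_i) /\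
  pderiv i (fun y => c * f y) = (fun x => c * pderiv i f x).
Proof.
move=> df; split=> [x|]; first exact: (@derivableZ _ _ _ f c x 'e_i (df x)).
by apply/funext => x; exact: (@deriveZ _ _ _ f c x 'e_i (df x)).
Qed.

Lemma smooth_holE B k C f : smooth B k C f -> hol B C f.
Proof. by case: k => [|k] []. Qed.

Lemma smooth_lower B k C f : smooth B k.+1 C f -> smooth B k C f.
Proof.
elim: k f => [|k ih] f [fC H]; split=> //.
by move=> i; have [D Hi] := H i; split=> //; exact: ih.
Qed.

Lemma smooth_leq B k l C f : (l <= k)%N -> smooth B k C f -> smooth B l C f.
Proof.
move=> /subnKC <-; elim: (k - l)%N => [|j ih]; first by rewrite addn0.
by rewrite addnS => /smooth_lower.
Qed.

Lemma smooth_sub B B' k C f : B' `<=` B -> smooth B k C f -> smooth B' k C f.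
Proof.
move=> BB; elim: k f => [|k ih] f [fC H]; split=> //; try exact: hol_sub BB fC.
by move=> i; have [D Hi] := H i; split=> //; exact: ih.
Qed.

Lemma smooth_add B k C D f g : smooth B k C f -> smooth B k D g ->
  smooth B k (C + D) (fun x => f x + g x).
Proof.
elim: k f g => [|k ih] f g [fC Hf] [gD Hg]; split=> //; try exact: hol_add.
move=> i; have [df Hfi] := Hf i; have [dg Hgi] := Hg i.
by have [d ->] := pderivD df dg; split=> //; exact: ih.
Qed.

Lemma smooth_scale B k C c f : smooth B k C f -> smooth B k (`|c| * C) (fun x => c * f x).
Proof.
elim: k f => [|k ih] f [fC Hf]; split=> //; try exact: hol_scale.
move=> i; have [df Hfi] := Hf i.
by have [d ->] := pderivZ c df; split=> //; exact: ih.
Qed.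

Lemma smooth_dword B k C f s : smooth B k C f -> (size s <= k)%N ->
  smooth B (k - size s) C (dword s f).
Proof.
elim/last_ind: s k f => [|s i ih] k f fk; first by rewrite subn0.
rewrite size_rcons dword_rcons; case: k fk => // k [_ /(_ i)[_ H]] sk.
by rewrite subSS; exact: ih.
Qed.

Lemma dword_lin B k C D c f g s : smooth B k C f -> smooth B k D g -> (size s <= k)%N ->
  dword s (fun x => c * f x + g x) = (fun x => c * dword s f x + dword s g x).
Proof.
elim/last_ind: s k f g => [//|s i ih] k f g fk gk.
rewrite size_rcons !dword_rcons; case: k fk gk => // k [_ /(_ i)[df Hf]] [_ /(_ i)[dg Hg]] sk.
have [dcf E] := pderivZ c df.
have [_ ->] := pderivD dcf dg; rewrite E; exact: ih Hf Hg sk.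
Qed.

Lemma smooth_sder C f i : smooth setT 1 C f -> sder alpha C i f (pderiv i f).
Proof.
move=> [_ /(_ i)[df [[_ H] _]]] x h h1.
have [t /andP[t0 t1] ->] := @MVT_coord R n f i x h (fun _ _ => df _).
rewrite -mulrBr normrM mulrCA ler_wpM2l//.
have C0 : 0 <= C.
  have := H 0 'e_i I I; rewrite sub0r normrN norm_ei powR1 mulr1.
  exact: le_trans.
apply: le_trans (H _ _ I I) _; rewrite ler_wpM2l// addrAC subrr add0r norm_sei.
rewrite ge0_ler_powR ?nnegrE//; first by case/andP: alpha01 => /ltW.
by rewrite normrM ler_piMl// ger0_norm.
Qed.

Variable S : solver n alpha.

Let smooth_cst_ge0 k C f : smooth setT k C f -> 0 <= C.
Proof. by move=> /smooth_holE [f1 _]; apply: le_trans (f1 0 I). Qed.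

Lemma slv_pderiv k C f i : smooth setT k.+1 C f ->
  (forall x, derivable (slv S f) x 'e_i) /\ pderiv i (slv S f) = slv S (pderiv i f).
Proof.
move=> fk; have f1 : smooth setT 1 C f by apply: smooth_leq fk.
apply: (sder_pderiv alpha01 (C := slvC S * C)).
apply: slv_sder; [exact: smooth_cst_ge0 fk|exact: hol_bnd (smooth_holE fk)| |exact: smooth_sder].
by case: f1 => _ /(_ i)[_ [fi _]]; exact: hol_bnd fi.
Qed.

Lemma avg_pderiv k C f i : smooth setT k.+1 C f ->
  (forall x, derivable (avg S f) x 'e_i) /\ pderiv i (avg S f) = avg S (pderiv i f).
Proof.
move=> fk; have f1 : smooth setT 1 C f by apply: smooth_leq fk.
apply: (sder_pderiv alpha01 (C := slvC S * C)).
apply: avg_sder; [exact: smooth_cst_ge0 fk|exact: hol_bnd (smooth_holE fk)| |exact: smooth_sder].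
by case: f1 => _ /(_ i)[_ [fi _]]; exact: hol_bnd fi.
Qed.

Lemma smooth_slv k C f : smooth setT k C f -> smooth setT k.+2 (slvC S * C) (slv S f).
Proof.
elim: k f => [|k ih] f fk; first by case: fk => fC _; exact: slv_smooth.
split; first exact: smooth_holE (slv_smooth S (smooth_holE fk)).
move=> i; have [d ->] := slv_pderiv i fk; split; [exact: d|apply: ih].
by case: fk => _ /(_ i)[].
Qed.

Lemma smooth_avg k C f : smooth setT k C f -> smooth setT k (slvC S * C) (avg S f).
Proof.
elim: k f => [|k ih] f fk; first by case: fk => fC _; split=> //; exact: avg_hol.
split; first exact: avg_hol (smooth_holE fk).
move=> i; have [d ->] := avg_pderiv i fk; split; [exact: d|apply: ih].
by case: fk => _ /(_ i)[].
Qed.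

Definition rem f : 'rV[R]_n -> R := fun x => f x - avg S f x.

Lemma remE f : rem f = (fun x => -1 * avg S f x + f x).
Proof. by apply/funext => x; rewrite mulN1r addrC. Qed.

Lemma smooth_rem k C f : smooth setT k C f -> smooth setT k ((slvC S + 1) * C) (rem f).
Proof.
move=> fk; rewrite remE mulrDl mul1r; apply: smooth_add => //.
by have := smooth_scale (-1) (smooth_avg fk); rewrite normrN1 mul1r.
Qed.

Lemma rem_pderiv k C f i : smooth setT k.+1 C f -> pderiv i (rem f) = rem (pderiv i f).
Proof.
move=> fk; have [da E] := avg_pderiv i fk; rewrite !remE.
have [d1 E1] := pderivZ (-1) da.
have [_ ->] := pderivD d1 (proj1 (proj2 fk i)).
by rewrite E1 E.
Qed.

Lemma rem_lin a f g : bnd f -> bnd g -> rem (fun x => a * f x + g x) = (fun x => a * rem f x + rem g x).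
Proof.
by move=> fb gb; apply/funext => x; rewrite /rem avg_lin//; ring.
Qed.

Lemma laplacian_rem k C f : smooth setT k.+2 C f -> laplacian (rem f) = rem (laplacian f).
Proof.
move=> fk; have H i : smooth setT k.+1 C (pderiv i f) by case: fk => _ /(_ i)[].
have Hii i : bnd (pderiv i (pderiv i f)).
  by have [_ /(_ i)[_ /smooth_holE Hi]] := H i; exact: hol_bnd Hi.
apply/funext => x.
have [_ ->] := lin_sum (fun c g g' gb gb' => congr1 (fun u => u x) (rem_lin c gb gb')) (index_enum _) Hii.
apply: eq_bigr => i _.
by rewrite (rem_pderiv i fk) (rem_pderiv i (H i)).
Qed.

Lemma smooth0 B k : smooth B k 0 (fun=> 0).
Proof.
elim: k => [|k ih] //=.
  by split=> //; split=> [x _|x y _ _]; rewrite ?subrr normr0 ?mul0r.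
split; first exact: smooth_holE ih.
move=> i; split=> [x|]; first exact: derivable_cst.
rewrite (_ : pderiv i _ = fun=> 0)//.
by apply/funext => x; exact: derive_cst.
Qed.

Lemma smooth_sum B k C (F : 'I_n -> 'rV[R]_n -> R) (s : seq 'I_n) :
  (forall i, smooth B k C (F i)) -> smooth B k ((size s)%:R * C) (fun x => \sum_(i <- s) F i x).
Proof.
move=> Fk; elim: s => [|i s IH].
  rewrite mul0r (_ : (fun x => _) = (fun=> 0)); first exact: smooth0.
  by apply/funext => x; rewrite big_nil.
have -> : (fun x => \sum_(j <- i :: s) F j x) = (fun x => F i x + \sum_(j <- s) F j x).
  by apply/funext => x; rewrite big_cons.
rewrite /= -natr1 mulrDl mul1r addrC; exact: smooth_add.
Qed.

Lemma smooth_laplacian B k C f : smooth B k.+2 C f -> smooth B k (n%:R * C) (laplacian f).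
Proof.
move=> [_ H]; have := @smooth_sum B k C (fun i => pderiv i (pderiv i f)) (index_enum _).
rewrite -[size _](_ : #|'I_n| = _); last by rewrite cardE enumT.
rewrite card_ord; apply=> // i.
by have [_ [_ /(_ i)[]]] := H i.
Qed.

Lemma iter_laplacian_rem m k C f : smooth setT (k + m.*2) C f ->
  iter m laplacian (rem f) = rem (iter m laplacian f).
Proof.
elim: m C f => // m ih C f; rewrite doubleS !addnS => fk.
rewrite !iterSr (laplacian_rem fk); apply: (ih (n%:R * C)).
exact: smooth_laplacian.
Qed.

Lemma smooth_iter_slv m C f : hol setT C f ->
  smooth setT m.*2 (slvC S ^+ m * C) (iter m (slv S) f).
Proof.
move=> fC; elim: m => [|m ih]; first by rewrite mul1r; split.
by rewrite doubleS exprS -mulrA; exact: smooth_slv.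
Qed.

(** [slv] and [avg] commute with partial derivatives, so the error operators [rem]
    left by each application of [laplacian] can be moved inside. *)
Lemma iter_laplacian_slv m C f : hol setT C f ->
  iter m laplacian (iter m (slv S) f) = iter m rem f.
Proof.
move=> fC; elim: m => // m ih; rewrite iterSr iterS.
have gk := smooth_iter_slv m fC.
rewrite (_ : laplacian _ = rem (iter m (slv S) f)); last first.
  by apply/funext => x; apply: (laplacian_slv S _ (smooth_holE gk)).
by rewrite (@iter_laplacian_rem m 0 (slvC S ^+ m * C))// ih.
Qed.

Lemma hol_rem C f : hol setT C f -> hol setT ((slvC S + 1) * C) (rem f).
Proof. by move=> fC; have [] := @smooth_rem 0 C f (conj fC I). Qed.

Definition rem_cst m := \sum_(j < m) (slvC S + 1) ^+ j * slvC S.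

Lemma rem_cst_ge0 m : 0 <= rem_cst m.
Proof.
have s0 := slvC_ge0 S; apply: sumr_ge0 => j _.
by rewrite mulr_ge0// exprn_ge0// addr_ge0.
Qed.

(** The difference is a sum of terms [rem^j (avg f)], and [avg f] is small when
    [f] is supported in a small cube. *)
Lemma iter_rem_small m l C f : hol setT C f -> (forall y, 2 ^- l < `|y| -> f y = 0) ->
  hol setT (rem_cst m * ((2 ^+ l) ^- n * C)) (fun x => f x - iter m rem f x).
Proof.
move=> fC fl; set th := _ * C; elim: m => [|m ih].
  rewrite /rem_cst big_ord0 mul0r; split=> [x _|x y _ _]; rewrite /= !subrr ?subr0 normr0 ?mul0r//.
have itb : bnd (iter m rem f).
  have : exists D, hol setT D (iter m rem f).
    elim: m {ih} => [|m [D HD]]; first by exists C.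
    by exists ((slvC S + 1) * D); exact: hol_rem.
  by move=> [D /hol_bnd].
have E : (fun x => f x - iter m.+1 rem f x) = (fun x => avg S f x + rem (fun y => f y - iter m rem f y) x).
  apply/funext => x; rewrite iterS.
  rewrite (_ : (fun y => f y - _) = (fun y => -1 * iter m rem f y + f y)); last first.
    by apply/funext => y; rewrite mulN1r addrC.
  rewrite rem_lin//; last exact: hol_bnd fC.
  by rewrite /rem; ring.
rewrite E /rem_cst big_ord_recl expr0 mul1r.
rewrite (eq_bigr (fun j : 'I_m => (slvC S + 1) * ((slvC S + 1) ^+ j * slvC S))); last first.
  by move=> j _; rewrite /= exprS mulrA.
rewrite -mulr_sumr -/(rem_cst m) mulrDl; apply: hol_add.
  by rewrite /th mulrA; exact: avg_small.
by rewrite -mulrA; exact: hol_rem.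
Qed.

End Smooth.

(** * Monomials *)

Section Monomials.
Context {R : realType} {n : nat} (alpha : R).
Hypothesis alpha01 : 0 < alpha < 1.
Implicit Types (x y : 'rV[R]_n) (f g : 'rV[R]_n -> R) (b : 'I_n -> nat) (C c h : R).

  Local Notation smooth := (smooth alpha).

Definition cube (r : R) : set 'rV[R]_n := [set x | `|x| <= r].

Definition mono b x : R := \prod_i x 0 i ^+ b i.

Definition dec (i : 'I_n) b : 'I_n -> nat := fun j => if j == i then (b j).-1 else b j.

Lemma pow_taylor (k : nat) (t : R) : exists B : R, forall h, `|h| <= 1 ->
  `|(t + h) ^+ k - t ^+ k - h * (k%:R * t ^+ k.-1)| <= B * h ^+ 2.
Proof.
elim: k => [|k [B HB]].
  by exists 0 => h _; rewrite mul0r mulr0 !expr0 subrr subr0 normr0 mul0r.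
exists ((`|t| + 1) * B + `|k%:R * t ^+ k.-1|) => h h1.
have E : (k%:R * t ^+ k.-1) * t = k%:R * t ^+ k.
  by case: k {HB} => [|k]; rewrite ?mul0r// -mulrA -exprSr.
rewrite (_ : _ - _ - _ = (t + h) * ((t + h) ^+ k - t ^+ k - h * (k%:R * t ^+ k.-1)) +
   h ^+ 2 * (k%:R * t ^+ k.-1)); last first.
  rewrite !exprS /= -[k.+1%:R]natr1 [(k%:R + 1) * _]mulrDl mul1r -E.
  by move: (k%:R * _) (t ^+ k) ((t + h) ^+ k) => Q P U; ring.
apply: le_trans (ler_normD _ _) _; rewrite [leRHS]mulrDl; apply: lerD.
  rewrite normrM -[leRHS]mulrA; apply: ler_pM; rewrite ?HB//.
  by apply: le_trans (ler_normD _ _) _; rewrite lerD2l.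
by rewrite normrM ger0_norm ?sqr_ge0// mulrC.
Qed.

Lemma mono_split (i : 'I_n) b x : mono b x = x 0 i ^+ b i * \prod_(j | j != i) x 0 j ^+ b j.
Proof. by rewrite /mono (bigD1 i). Qed.

Lemma pderiv_mono i b : (forall x, derivable (mono b) x 'e_i) /\
  pderiv i (mono b) = (fun x => (b i)%:R * mono (dec i b) x).
Proof.
suff H x : derivable (mono b) x 'e_i /\ pderiv i (mono b) x = (b i)%:R * mono (dec i b) x.
  by split=> [x|]; [case: (H x)|apply/funext => x; case: (H x)].
have [B HB] := pow_taylor (b i) (x 0 i).
set c := \prod_(j | j != i) x 0 j ^+ b j.
apply: (@derive_of_bound _ _ 1 _ _ (B * `|c|)) => // h h1.
have E1 : mono b (x + h *: 'e_i) = (x 0 i + h) ^+ b i * c.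
  rewrite (mono_split i) !mxE !eqxx /= mulr1; congr (_ * _); apply: eq_bigr => j ji.
  by rewrite !mxE eqxx /= (negbTE ji) mulr0 addr0.
have E2 : mono (dec i b) x = x 0 i ^+ (b i).-1 * c.
  rewrite (mono_split i) /dec eqxx; congr (_ * _); apply: eq_bigr => j ji.
  by rewrite (negbTE ji).
rewrite E1 E2 (mono_split i) -/c powRr1//.
rewrite (_ : _ - _ - _ = ((x 0 i + h) ^+ b i - x 0 i ^+ b i - h * ((b i)%:R * x 0 i ^+ (b i).-1)) * c); last by ring.
rewrite normrM mulrAC ler_wpM2r//; apply: le_trans (HB h h1) _.
by rewrite -normrM -expr2 ger0_norm ?sqr_ge0.
Qed.

Lemma lip_of_pderiv (A r : R) f : (forall i x, derivable f x 'e_i) ->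
  (forall i x, cube r x -> `|pderiv i f x| <= A) ->
  forall x y, cube r x -> cube r y -> `|f x - f y| <= n%:R * A * `|x - y|.
Proof.
move=> df H x y xr yr; rewrite distrC hyb_telescope.
apply: le_trans (ler_norm_sum _ _ _) _.
apply: le_trans (_ : \sum_(k < n) A * `|x - y| <= _); last first.
  by rewrite sumr_const card_ord -[_ *+ n]mulr_natl mulrA.
apply: ler_sum => k _.
have [t t01 ->] := @MVT_coord R n f k (hyb k x y) (y 0 k - x 0 k) (fun _ _ => df _ _).
rewrite normrM mulrC; apply: ler_pM => //.
  apply: H; rewrite /cube /=; apply: norm_le_coord => [|j].
    by apply: le_trans xr.
  rewrite !mxE eqxx /=; have [->|jk] := eqVneq j k; last first.
    rewrite mulr0 addr0; case: ifP => _; first exact: le_trans (coord_le_norm _ _) yr.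
    exact: le_trans (coord_le_norm _ _) xr.
  rewrite ltnn mulr1; have [t0 t1] := andP t01.
  have := le_trans (coord_le_norm x k) xr; have := le_trans (coord_le_norm y k) yr.
  rewrite !ler_norml => /andP[y1 y2] /andP[x1 x2].
  rewrite (_ : _ + _ = (1 - t) * x 0 k + t * y 0 k); last by ring.
  by apply/andP; split; nra.
by rewrite distrC; apply: le_trans (coord_le_norm _ k); rewrite !mxE.
Qed.

Lemma mono_le1 b x : cube 1 x -> `|mono b x| <= 1.
Proof.
move=> x1; rewrite /mono; elim/big_ind: _ => [|u v u1 v1|i _]; first by rewrite normr1.
  by rewrite normrM -[leRHS]mulr1; apply: ler_pM.
rewrite normrX exprn_ile1//; exact: le_trans (coord_le_norm _ _) x1.
Qed.

Lemma hol_of_lip (A L : R) f : 0 <= A -> 0 <= L -> (forall x, cube 1 x -> `|f x| <= A) ->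
  (forall x y, cube 1 x -> cube 1 y -> `|f x - f y| <= L * `|x - y|) ->
  hol alpha (cube 1) (A + 2 * L) f.
Proof.
move=> A0 L0 fA fL; split=> [x x1|x y x1 y1].
  by apply: le_trans (fA x x1) _; rewrite lerDl mulr_ge0.
apply: le_trans (fL x y x1 y1) _.
have d2 : `|x - y| <= 2.
  by apply: le_trans (ler_normB _ _) _; apply: le_trans (lerD x1 y1) _; lra.
apply: (@le_trans _ _ (2 * L * `|x - y| `^ alpha)); last first.
  by rewrite ler_wpM2r ?powR_ge0// lerDr.
rewrite [2 * L]mulrC -mulrA ler_wpM2l//.
have [d1|d1] := leP `|x - y| 1.
  apply: le_trans (powR_ge_id alpha01 _) _; first by rewrite normr_ge0.
  by rewrite ler_peMl ?powR_ge0// ler1n.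
by apply: le_trans d2 _; rewrite ler_peMr// powR_ge1 ?ltW.
Qed.

Lemma smooth_mono k b : exists2 C, 0 <= C & smooth (cube 1) k C (mono b).
Proof.
elim: k b => [|k ih] b.
  pose A : R := \sum_i (b i)%:R.
  have A0 : 0 <= A by rewrite sumr_ge0.
  exists (1 + 2 * (n%:R * A)); first by rewrite addr_ge0 ?mulr_ge0.
  split=> //; apply: hol_of_lip => // [||x y x1 y1]; rewrite ?mulr_ge0//; first exact: mono_le1.
  apply: lip_of_pderiv x1 y1 => [i z|i z z1]; first by case: (pderiv_mono i b).
  have [_ ->] := pderiv_mono i b; rewrite normrM normr_nat.
  rewrite -[leRHS]mulr1; apply: ler_pM => //; last exact: mono_le1.
  by rewrite /A (bigD1 i)//= lerDl sumr_ge0.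
have [C0 C00 H0] := ih b.
have mn (i : 'I_n) (C C' : R) : C <= C' -> smooth (cube 1) k C (pderiv i (mono b)) ->
    smooth (cube 1) k C' (pderiv i (mono b)) by exact: smooth_le.
have ex (i : 'I_n) : exists C, smooth (cube 1) k C (pderiv i (mono b)).
  have [C _ HC] := ih (dec i b); have [_ ->] := pderiv_mono i b.
  by exists (`|(b i)%:R| * C); exact: smooth_scale.
have [C1 C10 H1] := uniform_cst mn ex.
exists (C0 + C1); first exact: addr_ge0.
split; first by apply: hol_le (smooth_holE H0); rewrite lerDl.
move=> i; split; first by case: (pderiv_mono i b).
by apply: smooth_le (H1 i); rewrite lerDr.
Qed.

(** The order in which [mderiv] takes the derivatives. *)
Definition word (be : 'I_n -> nat) : seq 'I_n := flatten [seq nseq (be i) i | i <- enum 'I_n].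

Lemma mderivE be f : mderiv be f = dword (word be) f.
Proof.
rewrite /mderiv /word; elim: (enum 'I_n) => //= i s ->.
rewrite /dword foldr_cat; set g := foldr _ _ _.
by elim: (be i) => //= k ->.
Qed.

Lemma size_word be : size (word be) = mi_order be.
Proof.
rewrite /word size_flatten /shape -map_comp sumnE big_map big_enum /=.
by apply: eq_bigr => i _; rewrite size_nseq.
Qed.

Lemma count_word be i : count_mem i (word be) = be i.
Proof.
rewrite /word count_flatten -map_comp sumnE big_map big_enum /= (bigD1 i)//=.
rewrite count_nseq /= eqxx mul1n big1 ?addn0// => j ji.
by rewrite count_nseq /= (negbTE ji).
Qed.

Definition fact_mi b : R := \prod_i (b i)`!%:R.

Lemma fact_mi_neq0 b : fact_mi b != 0.
Proof. by apply/prodf_neq0 => i _; rewrite pnatr_eq0 -lt0n fact_gt0. Qed.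

Lemma dword_mono0 s c b : dword s (fun x => c * mono b x) 0 =
  if [forall i, count_mem i s == b i] then c * fact_mi b else 0.
Proof.
elim/last_ind: s c b => [|s i ih] c b.
  rewrite /= /mono; case: ifPn => [/forallP b0|].
    by congr (_ * _); apply: eq_bigr => i _; rewrite mxE -(eqP (b0 i)).
  rewrite negb_forall => /existsP[i bi]; rewrite (bigD1 i)//= mxE expr0n eq_sym.
  by rewrite (negbTE bi) mul0r mulr0.
have [d E] := pderiv_mono i b; have [_ E'] := pderivZ c d.
rewrite dword_rcons E' E.
rewrite (_ : (fun x => _) = (fun x => (c * (b i)%:R) * mono (dec i b) x)); last first.
  by apply/funext => x; rewrite mulrA.
rewrite ih; have [bi0|bi] := eqVneq (b i) 0%N.
  rewrite bi0 mulr0 mul0r if_same; case: ifP => // /forallP /(_ i).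
  by rewrite -cats1 count_cat /= eqxx bi0 addn1.
have -> : [forall j, count_mem j s == dec i b j] = [forall j, count_mem j (rcons s i) == b j].
  apply: eq_forallb => j; rewrite -cats1 count_cat /= addn0 /dec [i == j]eq_sym.
  have [->|ji] := eqVneq j i; last by rewrite addn0.
  by rewrite addn1; case: (b i) bi => // k _; rewrite eqSS.
case: ifP => // _; rewrite -mulrA; congr (_ * _).
rewrite /fact_mi (bigD1 i)//= [RHS](bigD1 i)//= mulrA; congr (_ * _).
  by rewrite /dec eqxx -natrM; case: (b i) bi => // k _; rewrite factS.
by apply: eq_bigr => j ji; rewrite /dec (negbTE ji).
Qed.

(** Polynomials as formal sums of terms, so that they can be differentiated termwise. *)
Definition psum (r : seq (R * ('I_n -> nat))) x : R := \sum_(p <- r) p.1 * mono p.2 x.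

Lemma pderiv_psum i r : (forall x, derivable (psum r) x 'e_i) /\
  pderiv i (psum r) = psum [seq (p.1 * (p.2 i)%:R, dec i p.2) | p <- r].
Proof.
elim: r => [|p r [dr Er]].
  have -> : psum [::] = cst 0 by apply/funext => x; rewrite /psum big_nil.
  split=> [x|]; first exact: derivable_cst.
  by apply/funext => x; rewrite /= /cst; exact: derive_cst.
have -> : psum (p :: r) = (fun x => p.1 * mono p.2 x + psum r x).
  by apply/funext => x; rewrite /psum big_cons.
have [d E] := pderiv_mono i p.2; have [d' E'] := pderivZ p.1 d.
have [d'' ->] := pderivD d' dr; split=> //.
by apply/funext => x; rewrite E' E Er /psum /= big_cons /= mulrA.
Qed.

(** Each application of the Laplacian lowers one exponent by two; [wt b] is twice
    the number of times that this can be done to the monomial [b]. *)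
Definition wt b : nat := (\sum_i (b i)./2.*2)%N.

Definition light (d : nat) (r : seq (R * ('I_n -> nat))) :=
  all (fun p => (p.1 == 0) || (wt p.2 < d)%N) r.

Lemma wt_dec2 i b : (2 <= b i)%N -> (wt (dec i (dec i b))).+2 = wt b.
Proof.
move=> bi; rewrite /wt (bigD1 i)//= [RHS](bigD1 i)//=.
rewrite (eq_bigr (fun j => (b j)./2.*2)); last first.
  by move=> j ji; rewrite /dec (negbTE ji).
rewrite /dec eqxx -!addSn; congr addn.
by case: (b i) bi => [|[|k]].
Qed.

Lemma laplacian_psum d r : light d.+2 r ->
  exists2 r', light d r' & laplacian (psum r) = psum r'.
Proof.
move=> lr; pose d2 (i : 'I_n) (p : R * ('I_n -> nat)) :=
  (p.1 * (p.2 i)%:R * (dec i p.2 i)%:R, dec i (dec i p.2)).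
exists (flatten [seq [seq d2 i p | p <- r] | i <- index_enum 'I_n]).
  apply/allP => p /flattenP[/= _ /mapP[i _ ->]] pin.
  have : light d [seq d2 i p | p <- r].
    rewrite /light all_map; apply: sub_all lr => -[c b] /=.
    have [-> _|c0 /= wb] := eqVneq c 0; first by rewrite !mul0r eqxx.
    have [bi|bi] := leqP 2 (b i).
      by rewrite -(wt_dec2 bi) in wb; rewrite -2!ltnS wb orbT.
    by rewrite /dec eqxx; case: (b i) bi => [|[|k]]// _; rewrite ?mulr0 ?mul0r eqxx.
  by move=> /allP /(_ _ pin).
apply/funext => x; rewrite /laplacian /psum big_flatten big_map; apply: eq_bigr => i _.
have [_ ->] := pderiv_psum i r; have [_ ->] := pderiv_psum i [seq (p.1 * (p.2 i)%:R, dec i p.2) | p <- r].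
by rewrite -map_comp /psum !big_map.
Qed.

Lemma iter_laplacian_psum m r : light m.*2 r -> iter m laplacian (psum r) = (fun=> 0).
Proof.
elim: m r => [|m ih] r lr.
  apply/funext => x; rewrite /= /psum big_seq big1// => p pr.
  by have /allP /(_ _ pr) := lr; rewrite ltn0 orbF => /eqP ->; rewrite mul0r.
by rewrite iterSr; have [r' lr' ->] := laplacian_psum lr; exact: ih.
Qed.

End Monomials.

(** * Subtracting a Taylor polynomial *)

Section TaylorSubtraction.
Context {R : realType} {n : nat} (alpha : R).
Hypothesis alpha01 : 0 < alpha < 1.
Implicit Types (x y : 'rV[R]_n) (f g : 'rV[R]_n -> R) (b : 'I_n -> nat) (C c D h : R).

  Local Notation smooth := (smooth alpha).
  Local Notation cube1 := (@cube R n 1).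

Lemma laplacian_add B k C D f g : smooth B k.+2 C f -> smooth B k.+2 D g ->
  laplacian (fun x => f x + g x) = (fun x => laplacian f x + laplacian g x).
Proof.
move=> [_ Hf] [_ Hg]; apply/funext => x; rewrite /laplacian -big_split /=.
apply: eq_bigr => i _; have [df [_ /(_ i)[ddf _]]] := Hf i; have [dg [_ /(_ i)[ddg _]]] := Hg i.
have [_ ->] := pderivD df dg.
by have [_ ->] := pderivD ddf ddg.
Qed.

Lemma iter_laplacian_add m B C D f g : smooth B m.*2 C f -> smooth B m.*2 D g ->
  iter m laplacian (fun x => f x + g x) = (fun x => iter m laplacian f x + iter m laplacian g x).
Proof.
elim: m C D f g => // m ih C D f g fm gm; rewrite !iterSr (laplacian_add fm gm).
exact: ih (smooth_laplacian fm) (smooth_laplacian gm).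
Qed.

Lemma mono_cst k : exists2 Cst : ('I_n -> nat) -> R, forall b, 0 <= Cst b &
  forall b, smooth cube1 k (Cst b) (mono b).
Proof.
have /choice[Cst H] : forall b, exists C, 0 <= C /\ smooth cube1 k C (mono b).
  by move=> b; have [C C0 HC] := smooth_mono alpha01 k b; exists C.
by exists Cst => b; case: (H b).
Qed.

Lemma smooth_psum k (Cst : ('I_n -> nat) -> R) r : (forall b, smooth cube1 k (Cst b) (mono b)) ->
  smooth cube1 k (\sum_(p <- r) `|p.1| * Cst p.2) (psum r).
Proof.
move=> H; elim: r => [|p r ih].
  rewrite big_nil (_ : psum [::] = fun=> 0); first exact: smooth0.
  by apply/funext => x; rewrite /psum big_nil.
rewrite big_cons (_ : psum (p :: r) = (fun x => p.1 * mono p.2 x + psum r x)).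
  by apply: smooth_add => //; exact: smooth_scale.
by apply/funext => x; rewrite /psum big_cons.
Qed.

Lemma dword_psum0 s r : dword s (psum r) 0 =
  \sum_(p <- r) (if [forall i, count_mem i s == p.2 i] then p.1 * @fact_mi R n p.2 else 0).
Proof.
have [Cst _ H] := mono_cst (size s).
elim: r => [|p r ih].
  have -> : psum [::] = (fun x => 0 * mono (fun=> 0%N) x : R).
    by apply/funext => x; rewrite /psum big_nil mul0r.
  by rewrite dword_mono0 big_nil mul0r if_same.
rewrite big_cons -ih -dword_mono0.
have -> : psum (p :: r) = (fun x => 1 * (p.1 * mono p.2 x) + psum r x).
  by apply/funext => x; rewrite /psum big_cons mul1r.
by rewrite (dword_lin 1 (smooth_scale p.1 (H p.2)) (smooth_psum r H) (leqnn _)) mul1r.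
Qed.

(** Minus the Taylor polynomial of [g] at the origin, up to the order [d - 1]. *)
Definition taylor (d : nat) g : seq (R * ('I_n -> nat)) :=
  [seq (- (mderiv (mi_fun be) g 0 / @fact_mi R n (mi_fun be)), mi_fun be) | be <- enum {: mindex n d.-1}].

Definition cut (d : nat) g x : R := g x + psum (taylor d g) x.

Lemma mderiv_cut0 d C g ga : smooth setT d C g -> (mi_order ga < d)%N ->
  mderiv ga (cut d g) 0 = 0.
Proof.
move=> gd gad; rewrite mderivE.
have sg : (size (word ga) <= d)%N by rewrite size_word ltnW.
have [Cst _ H] := mono_cst d.
have -> : cut d g = (fun x => 1 * g x + psum (taylor d g) x).
  by apply/funext => x; rewrite mul1r.
have g1 : smooth cube1 d C g by apply: smooth_sub gd.
rewrite (dword_lin 1 g1 (smooth_psum _ H) sg) mul1r dword_psum0 big_map big_enum /=.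
have gab i : (ga i < d)%N.
  by apply: leq_ltn_trans gad; rewrite /mi_order (bigD1 i)//= leq_addr.
have dE : d.-1.+1 = d by rewrite prednK// (leq_ltn_trans _ gad).
pose be0 : {ffun 'I_n -> 'I_d.-1.+1} := [ffun i => inord (ga i)].
have be0E i : nat_of_ord (be0 i) = ga i by rewrite ffunE inordK// dE.
have be0P : (\sum_(i < n) be0 i <= d.-1)%N.
  by rewrite (eq_bigr ga)// -ltnS dE.
pose be : mindex n d.-1 := Sub be0 be0P.
have beE : mi_fun be = ga by apply/funext => i; rewrite /mi_fun SubK be0E.
rewrite (bigD1 be)//= beE.
have -> : [forall i, count_mem i (word ga) == ga i].
  by apply/forallP => i; rewrite count_word.
rewrite big1 ?addr0 => [|b bb].
  by rewrite mulNr divfK ?fact_mi_neq0// -mderivE subrr.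
case: ifP => // /forallP E; case/eqP: bb.
apply: val_inj; apply/ffunP => i; apply: val_inj.
by have := E i; rewrite count_word -beE => /eqP /esym.
Qed.

Lemma smooth_cut d : exists2 K : R, 0 <= K &
  forall C g, smooth setT d C g -> smooth cube1 d (K * C) (cut d g).
Proof.
have [Cst Cst0 H] := mono_cst d.
pose K := \sum_(be : mindex n d.-1) `|(@fact_mi R n (mi_fun be))^-1| * Cst (mi_fun be).
have K0 : 0 <= K by apply: sumr_ge0 => be _; rewrite mulr_ge0.
exists (1 + K); first exact: addr_ge0.
move=> C g gd; rewrite mulrDl mul1r; apply: smooth_add; first exact: smooth_sub gd.
have C0 : 0 <= C by have [f1 _] := smooth_holE gd; apply: le_trans (f1 0 I).
apply: smooth_le (smooth_psum _ H); rewrite big_map big_enum /= mulrC mulr_sumr.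
apply: ler_sum => be _; rewrite mulrA ler_wpM2r// normrN normrM ler_wpM2r//.
rewrite mderivE; have [bd|bd] := leqP (size (word (mi_fun be))) d.
  by have [f1 _] := smooth_holE (smooth_dword gd bd); exact: f1.
have : (mi_order (mi_fun be) <= d.-1)%N by exact: (valP be).
by rewrite -size_word => /(leq_trans bd); rewrite ltnNge leq_pred.
Qed.

Lemma cut_lin d C D c f g : smooth setT d C f -> smooth setT d D g ->
  cut d (fun x => c * f x + g x) = (fun x => c * cut d f x + cut d g x).
Proof.
move=> fd gd; apply/funext => x; rewrite /cut /psum /taylor !big_map /=.
rewrite mulrDr addrACA; congr (_ + _); rewrite mulr_sumr -big_split /=; apply: eq_bigr => be _.
have bd : (size (word (mi_fun be)) <= d)%N.
  by rewrite size_word; apply: leq_trans (valP be) (leq_pred d).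
by rewrite !mderivE (dword_lin c fd gd bd); ring.
Qed.

(** The subtracted polynomial has degree less than [2m]. *)
Lemma iter_laplacian_cut m C g : (0 < m)%N -> smooth setT m.*2 C g ->
  iter m laplacian (cut m.*2 g) = iter m laplacian g.
Proof.
move=> m0 gd; have [Cst _ H] := mono_cst m.*2.
have g1 : smooth cube1 m.*2 C g by apply: smooth_sub gd.
rewrite /cut (iter_laplacian_add g1 (smooth_psum _ H)) iter_laplacian_psum.
  by apply/funext => x; rewrite addr0.
rewrite /light all_map; apply/allP => be _ /=; apply/orP; right.
apply: (@leq_ltn_trans (mi_order (mi_fun be))).
  by apply: leq_sum => i _; rewrite halfK leq_subr.
have : (mi_order (mi_fun be) <= m.*2.-1)%N by exact: (valP be).
by move/leq_ltn_trans; apply; rewrite prednK// double_gt0.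
Qed.

End TaylorSubtraction.

(** * Composition with the nonlinearity *)

Section Nonlinearity.
Context {R : realType} {n M : nat} (alpha : R).
Implicit Types (p q : 'rV[R]_M) (A La eta ka : R) (b : 'rV[R]_M -> R).

Lemma continuous_bounded b : (forall p, {for p, continuous b}) ->
  exists2 A, 0 <= A & forall p, cube 1 p -> `|b p| <= A.
Proof.
move=> bc.
have kc : compact (@cube R M 1).
  apply: bounded_closed_compact.
    by exists 1; split => // y y1 p /= p1; apply: le_trans p1 (ltW y1).
  rewrite (_ : cube 1 = (fun p : 'rV[R]_M => `|p|) @^-1` [set t | t <= 1])//.
  by apply: closed_comp (@closed_le _ 1) => p _; exact: norm_continuous.
have : compact (b @` @cube R M 1).
  by apply: continuous_compact => //; apply: continuous_subspaceT => p; exact: bc.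
move=> /compact_bounded [A [_ HA]]; exists (Num.max 0 (A + 1)); first by rewrite le_max lexx.
move=> p p1; apply: (@le_trans _ _ (A + 1)); last by rewrite le_max lexx orbT.
by apply: HA; [rewrite ltrDl|exists p].
Qed.

Lemma C2_bounds b : Ck_scalar setT 2 b -> exists La, [/\ 0 <= La,
  forall s p, derivable b p 'e_s,
  forall s p, cube 1 p -> `|pderiv s b p| <= La &
  forall s p q, cube 1 p -> cube 1 q -> `|pderiv s b p - pderiv s b q| <= La * `|p - q|].
Proof.
move=> [_ H].
have bc s p : {for p, continuous (pderiv s b)}.
  by have [_ [bc _]] := H s; exact: bc.
have mn (c : 'rV[R]_M -> R) (C C' : R) : C <= C' -> (forall p, cube 1 p -> `|c p| <= C) ->
    forall p, cube 1 p -> `|c p| <= C'.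
  by move=> CC HC p p1; apply: le_trans (HC p p1) CC.
have [L1 L10 H1] := uniform_cst (fun s => @mn (pderiv s b))
  (fun s => let: ex_intro2 A _ HA := continuous_bounded (bc s) in ex_intro _ A HA).
have dc s t p : {for p, continuous (pderiv t (pderiv s b))}.
  by have [_ [_ /(_ t)[_ [c _]]]] := H s; exact: c.
have [L2 L20 H2] := uniform_cst (fun st : 'I_M * 'I_M => @mn (pderiv st.2 (pderiv st.1 b)))
  (fun st => let: ex_intro2 A _ HA := continuous_bounded (dc st.1 st.2) in ex_intro _ A HA).
exists (L1 + M%:R * L2); split.
- by rewrite addr_ge0// mulr_ge0.
- by move=> s p; have [d _] := H s; exact: d.
- by move=> s p p1; apply: le_trans (H1 s p p1) _; rewrite lerDl mulr_ge0.
move=> s p q p1 q1; apply: (@le_trans _ _ (M%:R * L2 * `|p - q|)).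
  apply: lip_of_pderiv p1 q1 => [t z|t z z1]; last exact: (H2 (s, t)).
  by have [_ [_ /(_ t)[d _]]] := H s; exact: d.
by rewrite ler_wpM2r// lerDr.
Qed.

(** Along the path from [Q] to [P] through the axes, each step contributes a product
    of an entry of [P - Q] with a partial derivative of [b], and one of the two
    factors is of order [eta]: the derivative in a top slot, since it vanishes
    at the origin, and by hypothesis the entry of [P - Q] in any other slot. *)
Lemma hol_comp_diff (B : set 'rV[R]_n) (P Q : 'rV[R]_n -> 'rV[R]_M) (top : pred 'I_M) La eta ka b :
  0 <= La -> 0 <= eta <= 1 -> 0 <= ka ->
  (forall s p, derivable b p 'e_s) ->
  (forall s p, cube 1 p -> `|pderiv s b p| <= La) ->
  (forall s p q, cube 1 p -> cube 1 q -> `|pderiv s b p - pderiv s b q| <= La * `|p - q|) ->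
  (forall s, top s -> pderiv s b 0 = 0) ->
  (forall s, hol alpha B eta (fun x => P x 0 s)) ->
  (forall s, hol alpha B eta (fun x => Q x 0 s)) ->
  (forall s, hol alpha B (if top s then ka else eta * ka) (fun x => P x 0 s - Q x 0 s)) ->
  hol alpha B (2 * M%:R * La * eta * ka) (fun x => b (P x) - b (Q x)).
Proof.
move=> La0 /andP[eta0 eta1] ka0 bd bL bLip b0 HP HQ HD.
pose z t x (s : 'I_M) := hyb s (Q x) (P x) + (t * (P x 0 s - Q x 0 s)) *: 'e_s.
have zE t x s j : z t x s 0 j = if j == s then (1 - t) * Q x 0 s + t * P x 0 s else
    if (j < s)%N then P x 0 j else Q x 0 j.
  rewrite /z !mxE eqxx /=; have [->|js] := eqVneq j s.
    by rewrite ltnn mulr1; ring.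
  by rewrite mulr0 addr0.
have zeta t x s : 0 <= t <= 1 -> B x -> `|z t x s| <= eta.
  move=> /andP[t0 t1] Bx; apply: norm_le_coord => // j; rewrite zE.
  have [P1 _] := HP j; have [Q1 _] := HQ j.
  case: eqP => [js|_]; last by case: ifP => _; [exact: P1|exact: Q1].
  rewrite -js; have := P1 x Bx; have := Q1 x Bx; rewrite !ler_norml => /andP[q1 q2] /andP[p1 p2].
  by apply/andP; split; nra.
have zdiff t x y s : 0 <= t <= 1 -> B x -> B y -> `|z t x s - z t y s| <= eta * `|x - y| `^ alpha.
  move=> /andP[t0 t1] Bx By; apply: norm_le_coord => [|j].
    by rewrite mulr_ge0// powR_ge0.
  have subE (p q : 'rV[R]_M) : (p - q) 0 j = p 0 j - q 0 j by rewrite !mxE.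
  rewrite subE !zE; have [_ P2] := HP j; have [_ Q2] := HQ j.
  case: eqP => [js|_]; last by case: ifP => _; [exact: P2|exact: Q2].
  rewrite -js (_ : _ - _ = (1 - t) * (Q x 0 j - Q y 0 j) + t * (P x 0 j - P y 0 j)); last by ring.
  have := P2 x y Bx By; have := Q2 x y Bx By; move: (eta * _) => E.
  rewrite !ler_norml => /andP[q1 q2] /andP[p1 p2].
  by apply/andP; split; nra.
have cz t x s : 0 <= t <= 1 -> B x -> cube 1 (z t x s).
  by move=> t01 Bx; apply: le_trans (zeta _ _ _ t01 Bx) eta1.
pose ks s := if top s then ka else eta * ka.
have ks0 s : 0 <= ks s by rewrite /ks; case: ifP => _ //; rewrite mulr_ge0.
have ksk s : ks s <= ka by rewrite /ks; case: ifP => _ //; rewrite ler_piMl.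
have small t x s : 0 <= t <= 1 -> B x -> ks s * `|pderiv s b (z t x s)| <= La * eta * ka.
  move=> t01 Bx; rewrite /ks; case: ifPn => [ts|_].
    rewrite mulrC ler_wpM2r// -[pderiv _ _ _]subr0 -(b0 s ts).
    have c0 : cube 1 (0 : 'rV[R]_M) by rewrite /cube /= normr0.
    apply: le_trans (bLip s _ 0 (cz _ _ _ t01 Bx) c0) _; rewrite subr0 ler_wpM2l//.
    exact: zeta.
  rewrite mulrC -mulrA ler_wpM2r ?mulr_ge0//; apply: bL; exact: cz.
have dl (x : 'rV[R]_n) (s : 'I_M) (t : R) : is_derive t 1 (fun t : R => b (z t x s))
    ((P x 0 s - Q x 0 s) * pderiv s b (z t x s)).
  exact: is_derive_line.
have tel x : b (P x) - b (Q x) = \sum_s (b (z 1 x s) - b (z 0 x s)).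
  rewrite hyb_telescope; apply: eq_bigr => s _.
  by rewrite /z mul1r mul0r scale0r addr0.
have Bound x : B x -> `|b (P x) - b (Q x)| <= M%:R * (La * eta * ka).
  move=> Bx; rewrite tel; apply: le_trans (ler_norm_sum _ _ _) _.
  apply: le_trans (_ : \sum_(s < M) La * eta * ka <= _); last first.
    by rewrite sumr_const card_ord mulr_natl.
  apply: ler_sum => s _.
  have [t t01 ->] := MVT01 (fun t _ => dl x s t).
  rewrite normrM; apply: le_trans (small t x s t01 Bx); rewrite ler_wpM2r//.
  by have [D1 _] := HD s; exact: D1.
split=> [x Bx|x y Bx By].
  apply: le_trans (Bound x Bx) _; rewrite (_ : 2 * _ * _ * _ * _ = 2 * (M%:R * (La * eta * ka))); last by ring.
  by rewrite ler_peMl ?ler1n// !mulr_ge0.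
rewrite !tel -sumrB; apply: le_trans (ler_norm_sum _ _ _) _.
apply: le_trans (_ : \sum_(s < M) 2 * (La * eta * ka) * `|x - y| `^ alpha <= _); last first.
  by rewrite sumr_const card_ord -[_ *+ M]mulr_natl le_eqVlt; apply/orP; left; apply/eqP; ring.
apply: ler_sum => s _.
have dd (t : R) : is_derive t 1 (fun t : R => b (z t x s) - b (z t y s))
    ((P x 0 s - Q x 0 s) * pderiv s b (z t x s) - (P y 0 s - Q y 0 s) * pderiv s b (z t y s)).
  exact: is_deriveB (dl x s t) (dl y s t).
have [t t01 E] := MVT01 (fun t _ => dd t).
rewrite (_ : _ - _ - _ = b (z 1 x s) - b (z 1 y s) - (b (z 0 x s) - b (z 0 y s))); last by ring.
rewrite E; set Dx := P x 0 s - _; set Dy := P y 0 s - _.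
rewrite (_ : _ - _ = (Dx - Dy) * pderiv s b (z t x s) +
  Dy * (pderiv s b (z t x s) - pderiv s b (z t y s))); last by ring.
have [D1 D2] := HD s.
apply: le_trans (ler_normD _ _) _; rewrite !normrM mulr_natl mulr2n mulrDl; apply: lerD.
  apply: (@le_trans _ _ (ks s * `|x - y| `^ alpha * `|pderiv s b (z t x s)|)).
    by rewrite ler_wpM2r//; exact: D2.
  by rewrite mulrAC ler_wpM2r ?powR_ge0// small.
apply: (@le_trans _ _ (ka * (La * (eta * `|x - y| `^ alpha)))); last first.
  by rewrite le_eqVlt; apply/orP; left; apply/eqP; ring.
apply: ler_pM => //; first by apply: le_trans (D1 y By) (ksk s).
apply: le_trans (bLip s _ _ (cz _ _ _ t01 Bx) (cz _ _ _ t01 By)) _.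
by rewrite ler_wpM2l// zdiff.
Qed.

End Nonlinearity.

(** * Cutoff *)

Section Cutoff.
Context {R : realType} {n : nat} (alpha : R).
Hypothesis alpha01 : 0 < alpha < 1.
Variable L : nat.
Implicit Types (x y : 'rV[R]_n) (C : R) (g : 'rV[R]_n -> R).

Definition chi x : R := Num.max 0 (Num.min 1 (2 - 2 ^+ L.+1 * `|x|)).

Let p0 : 0 < 2 ^+ L.+1 :> R. Proof. by rewrite exprn_gt0. Qed.

Lemma chi_le1 x : 0 <= chi x <= 1.
Proof. by rewrite /chi le_max lexx /= ge_max ler01 ge_min lexx. Qed.

Lemma chi1 x : `|x| <= 2 ^- L.+1 -> chi x = 1.
Proof.
rewrite -[2 ^- _]mulr1 ler_pdivlMl// => H.
by rewrite /chi min_l ?max_r//; lra.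
Qed.

Lemma chi0 x : 2 ^- L <= `|x| -> chi x = 0.
Proof.
rewrite -[2 ^- _]mulr1 ler_pdivrMl ?exprn_gt0// => H.
rewrite /chi max_l// ge_min; apply/orP; right.
by rewrite exprS -mulrA; lra.
Qed.

Lemma chi_lip x y : `|chi x - chi y| <= 2 ^+ L.+1 * `|x - y|.
Proof.
have H : `|2 ^+ L.+1 * `|x| - 2 ^+ L.+1 * `|y| | <= 2 ^+ L.+1 * `|x - y|.
  by rewrite -mulrBr normrM (ger0_norm (ltW p0)) ler_wpM2l ?(ltW p0)// ler_dist_dist.
apply: le_trans _ H; rewrite /chi; move: (2 ^+ L.+1 * `|x|) (2 ^+ L.+1 * `|y|) => u v.
have E (w : R) : Num.max 0 (Num.min 1 w) = if 1 <= w then 1 else if 0 <= w then w else 0.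
  case: (leP 1 w) => w1; first by apply/max_idPr; exact: ler01.
  by case: (leP 0 w).
have := ler_norm (u - v); have := lerNnormlW (lexx `|u - v|); rewrite ler_norml !E.
by case: (leP 1 (2 - u)) => ?; case: (leP 1 (2 - v)) => ?; case: (leP 0 (2 - u)) => ?;
  case: (leP 0 (2 - v)) => ? ? ?; apply/andP; split; lra.
Qed.

Lemma hol_chi C g : 0 <= C -> hol alpha (cube 1) C g ->
  hol alpha setT ((1 + 2 ^+ L.+1) * C) (fun x => chi x * g x).
Proof.
move=> C0 [g1 g2]; set P := 2 ^+ L.+1.
have P0 : 0 <= P by exact: ltW.
have cst0 : 0 <= (1 + P) * C by rewrite mulr_ge0// addr_ge0.
have L1 : 2 ^- L <= 1 :> R by rewrite invf_le1 ?exprn_gt0// exprn_ege1// ler1n.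
have out x : 1 < `|x| -> chi x = 0 by move=> x1; apply: chi0; apply: le_trans L1 (ltW x1).
have chia x y : `|chi x - chi y| <= P * `|x - y| `^ alpha.
  have [d1|d1] := leP `|x - y| 1.
    apply: le_trans (chi_lip x y) _; rewrite ler_wpM2l// powR_ge_id//.
    by rewrite normr_ge0.
  have P1 : 1 <= P by rewrite exprn_ege1// ler1n.
  apply: (@le_trans _ _ 1).
    have := chi_le1 x; have := chi_le1 y; rewrite ler_norml.
    by move=> /andP[? ?] /andP[? ?]; apply/andP; split; lra.
  by rewrite -[leLHS]mulr1; apply: ler_pM => //; rewrite powR_ge1// ltW.
split=> [x _|x y _ _].
  have [x1|x1] := leP `|x| 1; last by rewrite out// mul0r normr0.
  have /andP[c0 c1] := chi_le1 x.
  rewrite normrM (ger0_norm c0); apply: (@le_trans _ _ (1 * C)).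
    by apply: ler_pM => //; exact: g1.
  by rewrite ler_wpM2r// lerDl.
have d0 : 0 <= `|x - y| `^ alpha by exact: powR_ge0.
have half u v : `|v| <= 1 -> 1 < `|u| -> `|chi u * g u - chi v * g v| <= (1 + P) * C * `|u - v| `^ alpha.
  move=> v1 u1; rewrite (out u)// mul0r sub0r normrN normrM.
  have := chia u v; rewrite (out u)// sub0r normrN => cv.
  apply: (@le_trans _ _ (P * `|u - v| `^ alpha * C)).
    by apply: ler_pM => //; exact: g1.
  by rewrite mulrAC ler_wpM2r ?powR_ge0// ler_wpM2r// lerDr.
have [x1|x1] := leP `|x| 1; have [y1|y1] := leP `|y| 1.
- have /andP[c0 c1] := chi_le1 x.
  rewrite (_ : _ - _ = chi x * (g x - g y) + (chi x - chi y) * g y); last by ring.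
  apply: le_trans (ler_normD _ _) _; rewrite !normrM (ger0_norm c0) 2!mulrDl mul1r; apply: lerD.
    by rewrite -[leRHS]mul1r; apply: ler_pM => //; exact: g2.
  by rewrite mulrAC; apply: ler_pM => //; exact: g1.
- by rewrite distrC [`|x - y|]distrC; exact: half.
- exact: half.
- by rewrite !out// !mul0r subrr normr0 mulr_ge0.
Qed.

End Cutoff.

(** * Fixed points in the Hoelder norm *)

Section Contraction.
Context {R : realType} {n : nat} {I : Type} (alpha : R).
Variables (dom : (I -> 'rV[R]_n -> R) -> Prop) (Psi : (I -> 'rV[R]_n -> R) -> I -> 'rV[R]_n -> R).
Variable sig : R.
Implicit Types (f g : I -> 'rV[R]_n -> R) (C : R).

  Local Notation hol := (hol alpha setT).

Lemma hol_lim C (u : nat -> 'rV[R]_n -> R) (F : 'rV[R]_n -> R) k :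
  (forall x, u j x @[j --> \oo] --> F x) -> (forall j, (k <= j)%N -> hol C (u j)) -> hol C F.
Proof.
move=> uF uC.
have H (v : nat -> R) (w A : R) : v j @[j --> \oo] --> w -> (forall j, (k <= j)%N -> `|v j| <= A) -> `|w| <= A.
  move=> vw vA; have nv : `|v j| @[j --> \oo] --> `|w| by exact: cvg_norm.
  rewrite -(cvg_lim _ nv)//; apply: limr_le; first by apply/cvg_ex; exists `|w|.
  by exists k => // j /= kj; exact: vA.
split=> [x _|x y _ _].
  by apply: H (uF x) _ => j kj; case: (uC j kj) => u1 _; exact: u1.
by apply: H (cvgB (uF x) (uF y)) _ => j kj; case: (uC j kj) => _ u2; exact: u2.
Qed.

Hypothesis sig0 : 0 <= sig.
Hypothesis dom_hol : forall f, dom f -> forall l, hol sig (f l).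
Hypothesis dom_lim : forall (u : nat -> I -> 'rV[R]_n -> R) f, (forall j, dom (u j)) ->
  (forall l x, u j l x @[j --> \oo] --> f l x) -> dom f.
Hypothesis dom0 : dom (fun _ _ => 0).
Hypothesis domP : forall f, dom f -> dom (Psi f).
Hypothesis ctr : forall f g C, 0 <= C -> dom f -> dom g ->
  (forall l, hol C (fun x => f l x - g l x)) ->
  forall l, hol (C / 2) (fun x => Psi f l x - Psi g l x).

(** The iterates converge pointwise, and Hoelder bounds pass to pointwise limits,
    so the domain need only be closed under pointwise convergence. *)
Lemma contraction_fixed_point : exists2 f, dom f & forall l x, Psi f l x = f l x.
Proof.
pose u k := iter k Psi (fun _ _ => 0).
have du k : dom (u k) by elim: k => //= k; exact: domP.
pose c k : R := 2 * sig * 2 ^- k.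
have c0 k : 0 <= c k by rewrite !mulr_ge0// invr_ge0 exprn_ge0.
have step k l : hol (c k) (fun x => u k.+1 l x - u k l x).
  elim: k l => [|k ih] l.
    have H0 := dom_hol (du 0%N) l; have H1 := dom_hol (du 1%N) l.
    rewrite /c expr0 invr1 mulr1 mulr_natl mulr2n; apply: hol_add => //.
    by have := hol_scale (-1) H0; rewrite normrN1 mul1r /= mulr0 oppr0.
  rewrite /c exprS invfM [2^-1 * _]mulrC mulrA -/(c k).
  exact: (ctr (c0 k) (du k.+1) (du k)).
have c2 k : c k = c k.+1 + c k.+1.
  by rewrite /c exprS invfM; field; rewrite gt_eqF// exprn_gt0.
have far k j l : hol (2 * c k) (fun x => u (k + j)%N l x - u k l x).
  suff : hol (2 * c k - 2 * c (k + j)%N) (fun x => u (k + j)%N l x - u k l x).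
    by apply: hol_le; rewrite gerBl mulr_ge0.
  elim: j => [|j ih].
    rewrite addn0 subrr; split=> [x _|x y _ _]; by rewrite !subrr ?subr0 ?normr0 ?mul0r.
  have := hol_add ih (step (k + j)%N l); rewrite addnS.
  rewrite (_ : 2 * c k - 2 * c (k + j)%N + c (k + j)%N = 2 * c k - 2 * c (k + j).+1); last first.
    by rewrite (c2 (k + j)%N); ring.
  by congr hol; apply/funext => x; ring.
have cvgu l x : cvgn (fun k => u k l x).
  have -> : (fun k => u k l x) = series (fun k => u k.+1 l x - u k l x).
    by apply/funext => k; rewrite /series /= telescope_sumr// subr0.
  apply: (@ser_cvg _ _ (2 * sig / (1 - 2^-1))) => K.
  apply: (@geom_dom_le R 2^-1 (2 * sig) (fun k => u k.+1 l x - u k l x)) => [||k]; [by lra|by rewrite mulr_ge0|].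
  by have [s1 _] := step k l; rewrite exprVn; exact: s1.
pose f l x := limn (fun k => u k l x).
have uf l x : u k l x @[k --> \oo] --> f l x by exact: cvgu.
have df : dom f by exact: dom_lim du uf.
have near k l : hol (2 * c k) (fun x => f l x - u k l x).
  apply: (@hol_lim _ (fun j x => u j l x - u k l x) _ k) => [x|j kj].
    by apply: cvgB (uf l x) _; exact: cvg_cst.
  by rewrite -(subnKC kj); exact: far.
exists f => // l x; apply/eqP; rewrite -subr_eq0 -normr_le0; apply/ler_addgt0Pl => e e0.
rewrite addr0.
have [||k Hk] := @expr_small R 2^-1 (e / (6 * sig + 1)); first by lra.
  by rewrite divr_gt0// ltr_wpDl// mulr_ge0.
have h1 := ctr (mulr_ge0 (ler0n _ 2) (c0 k)) df (du k) (near k) l.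
have h2 := near k.+1 l.
rewrite (_ : _ - _ = (Psi f l x - Psi (u k) l x) - (f l x - u k.+1 l x)); last first.
  by rewrite /u iterS; ring.
apply: le_trans (ler_normB _ _) _.
have {}h1 := proj1 h1 x Logic.I; have {}h2 := proj1 h2 x Logic.I.
apply: le_trans (lerD h1 h2) _.
rewrite [leLHS](_ : _ = 4 * sig * 2^-1 ^+ k); last first.
  by rewrite /c exprS invfM exprVn; field; rewrite gt_eqF// exprn_gt0.
apply: le_trans (ler_wpM2l (mulr_ge0 (ler0n _ 4) sig0) (Hk k (leqnn k))) _.
have d0 : 0 < 6 * sig + 1 by rewrite ltr_wpDl// mulr_ge0.
rewrite mulrCA ler_piMr ?(ltW e0)// ler_pdivrMr// mul1r.
apply: (@le_trans _ _ (6 * sig)); last by rewrite lerDl.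
by rewrite ler_wpM2r// ler_nat.
Qed.

End Contraction.

(** * The rescaled equation *)

Section ScaledProblem.
Context {R : realType} {n N m : nat} (alpha : R).
Hypothesis alpha01 : 0 < alpha < 1.
Hypothesis n3 : (3 <= n)%N.
Hypothesis m1 : (1 <= m)%N.

  Local Notation hol := (hol alpha).
  Local Notation smooth := (smooth alpha).
  Local Notation cube1 := (@cube R n 1).
  Local Notation slots := #|slot n N (2 * m)|.

Variable a : 'rV[R]_slots -> 'rV[R]_N.
Hypothesis a_C2 : Ck setT 2 a.
Hypothesis a_0 : a 0 = 0.
Hypothesis da_0 : forall (s : slot n N (2 * m)) (l : 'I_N), top_slot s ->
  slot_deriv s (coord_fun a l) 0 = 0.
Variable S : solver n alpha.

Implicit Types (f : 'rV[R]_n -> R) (C c r eta ka eps del : R) (G : 'I_N -> 'rV[R]_n -> R).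

Let i0 : 'I_n := Ordinal (ltnW (ltnW n3)).
Let i1 : 'I_n := Ordinal (ltnW n3).

(** The exponents of [x_0^(2m-1) x_1], a polynomial that [Delta^m] kills and that
    is odd in [x_0], hence not radial. *)
Definition hexp : 'I_n -> nat := fun i =>
  if i == i0 then (2 * m).-1 else if i == i1 then 1%N else 0%N.

Let hexp_i0 : hexp i0 = (2 * m).-1. Proof. by rewrite /hexp eqxx. Qed.
Let hexp_i1 : hexp i1 = 1%N. Proof. by []. Qed.

Definition hpol : 'rV[R]_n -> R := mono hexp.

Lemma prod_hexp (F : 'I_n -> R) : (forall i, i != i0 -> i != i1 -> F i = 1) ->
  \prod_i F i = F i0 * F i1.
Proof.
move=> H; rewrite (bigD1 i0)//= (bigD1 i1)//= big1 ?mulr1// => i /andP[j0 j1].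
exact: H.
Qed.

Lemma hexp_order : mi_order hexp = (2 * m)%N.
Proof.
rewrite /mi_order (bigD1 i0)//= (bigD1 i1)//= big1 => [|i /andP[j0 j1]].
  by rewrite ?hexp_i0 ?hexp_i1 addn0 addn1 prednK// muln_gt0.
by rewrite /hexp (negbTE j0) (negbTE j1).
Qed.

Lemma iter_laplacian_hpol c : iter m laplacian (fun x => c * hpol x) = (fun=> 0).
Proof.
have -> : (fun x => c * hpol x) = psum [:: (c, hexp)].
  by apply/funext => x; rewrite /psum big_seq1.
apply: iter_laplacian_psum; rewrite /light /= andbT; apply/orP; right.
rewrite /wt (bigD1 i0)//= (bigD1 i1)//= big1 => [|i /andP[j0 j1]].
  rewrite ?hexp_i0 ?hexp_i1 !addn0.
  by case: m m1 => // k _; rewrite mul2n doubleS /= uphalf_double.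
by rewrite /hexp (negbTE j0) (negbTE j1).
Qed.

Lemma mderiv_hpol0 ga : mderiv ga hpol 0 = if [forall i, ga i == hexp i] then fact_mi hexp else 0.
Proof.
have -> : hpol = (fun x => 1 * mono hexp x) by apply/funext => x; rewrite mul1r.
rewrite mderivE dword_mono0 mul1r; congr (if _ then _ else _).
by apply: eq_forallb => i; rewrite count_word.
Qed.

Definition xpt (s t : R) : 'rV[R]_n := \row_i (if i == i0 then s else if i == i1 then t else 0).

Lemma hpol_xpt s t : hpol (xpt s t) = s ^+ (2 * m).-1 * t.
Proof.
rewrite /hpol /mono prod_hexp => [|i j0 j1].
  by rewrite ?hexp_i0 ?hexp_i1 !mxE eqxx expr1.
by rewrite /hexp (negbTE j0) (negbTE j1) expr0.
Qed.

Lemma norm_xpt s t c : `|s| <= c -> `|t| <= c -> `|xpt s t| <= c.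
Proof.
move=> sc tc; have c0 : 0 <= c by apply: le_trans sc.
apply: norm_le_coord => // i; rewrite mxE.
by case: ifP => _ //; case: ifP => _ //; rewrite normr0.
Qed.

Lemma enorm_xpt s t : enorm (xpt (- s) t) = enorm (xpt s t).
Proof.
rewrite /enorm; congr Num.sqrt; apply: eq_bigr => i _; rewrite !mxE.
by case: ifP => _; rewrite ?sqrrN.
Qed.

(** The derivatives of order less than [2m] are removed by subtracting a
    polynomial of degree less than [2m], which [Delta^m] does not see. *)
Definition sol f : 'rV[R]_n -> R := cut (2 * m) (iter m (slv S) f).

Let smooth_it C f : hol setT C f -> smooth setT (2 * m) (slvC S ^+ m * C) (iter m (slv S) f).
Proof. by move=> fC; rewrite mul2n; exact: smooth_iter_slv. Qed.

Lemma sol_smooth : exists2 K, 0 <= K & forall C f, hol setT C f -> smooth cube1 (2 * m) (K * C) (sol f).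
Proof.
have [K K0 HK] := @smooth_cut R n alpha alpha01 (2 * m).
exists (K * slvC S ^+ m); first by rewrite mulr_ge0// exprn_ge0// slvC_ge0.
by move=> C f fC; rewrite -mulrA; apply: HK; exact: smooth_it.
Qed.

Lemma sol_lin C C' c f f' : hol setT C f -> hol setT C' f' ->
  sol (fun x => c * f x + f' x) = (fun x => c * sol f x + sol f' x).
Proof.
move=> fC fC'; rewrite /sol -(cut_lin c (smooth_it fC) (smooth_it fC')); congr cut.
elim: m => //= k ->; apply/funext => x; apply: slv_lin.
  exact: hol_bnd (smooth_holE (smooth_iter_slv alpha01 S k fC)).
exact: hol_bnd (smooth_holE (smooth_iter_slv alpha01 S k fC')).
Qed.

Lemma iter_laplacian_sol C f : hol setT C f -> iter m laplacian (sol f) = iter m (rem S) f.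
Proof.
move=> fC; rewrite /sol mul2n (iter_laplacian_cut alpha01 m1 (smooth_iter_slv alpha01 S m fC)).
exact: iter_laplacian_slv fC.
Qed.

(** The argument of [a] in the equation for [v], where [u(x) = r^(2m) v(x/r)]. *)
Definition sjet_slot r G (s : slot n N (2 * m)) (x : 'rV[R]_n) : R :=
  match s with
  | inl i => r * x 0 i
  | inr (be, l) => r ^+ (2 * m - mi_order (mi_fun be)) * mderiv (mi_fun be) (G l) x
  end.

Definition sjet r G (x : 'rV[R]_n) : 'rV[R]_slots := \row_j sjet_slot r G (enum_val j) x.

Let top (j : 'I_slots) : bool := top_slot (enum_val j).

Lemma mindex_order (be : mindex n (2 * m)) : (mi_order (mi_fun be) <= 2 * m)%N.
Proof. exact: (valP be). Qed.

Lemma hol_sjet_deriv r C f (be : mindex n (2 * m)) : 0 <= r <= 1 -> 0 <= C ->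
  smooth cube1 (2 * m) C f ->
  hol cube1 (if mi_order (mi_fun be) == (2 * m)%N then C else r * C)
    (fun x => r ^+ (2 * m - mi_order (mi_fun be)) * mderiv (mi_fun be) f x).
Proof.
move=> /andP[r0 r1] C0 fC; have bm := mindex_order be.
have sb : (size (word (mi_fun be)) <= 2 * m)%N by rewrite size_word.
have := hol_scale (r ^+ (2 * m - mi_order (mi_fun be))) (smooth_holE (smooth_dword fC sb)).
rewrite -mderivE; apply: hol_le.
rewrite ger0_norm ?exprn_ge0//; case: eqP => [->|/eqP ne]; first by rewrite subnn expr0 mul1r.
rewrite ler_wpM2r// -[leRHS]expr1 ler_wiXn2l// subn_gt0.
by rewrite ltn_neqAle ne.
Qed.

Lemma hol_sjet_var r (i : 'I_n) : 0 <= r -> hol cube1 (3 * r) (fun x => r * x 0 i).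
Proof.
move=> r0; rewrite (_ : 3 * r = r + 2 * r); last by ring.
apply: (hol_of_lip alpha01) => // [x x1|x y _ _].
  by rewrite normrM ger0_norm// ler_piMr//; apply: le_trans (coord_le_norm _ _) x1.
rewrite -mulrBr normrM ger0_norm// ler_wpM2l//.
by apply: le_trans (coord_le_norm _ i); rewrite !mxE.
Qed.

Lemma hol_sjet r eta G j : 0 <= r <= 1 -> 0 <= eta -> 3 * r <= eta ->
  (forall l, smooth cube1 (2 * m) eta (G l)) -> hol cube1 eta (fun x => sjet r G x 0 j).
Proof.
move=> r01 eta0 reta HG; have [r0 r1] := andP r01.
rewrite (_ : (fun x => _) = sjet_slot r G (enum_val j)); last by apply/funext => x; rewrite mxE.
case: (enum_val j) => [i|[be l]]; first exact: hol_le reta (hol_sjet_var i r0).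
apply: hol_le (hol_sjet_deriv be r01 eta0 (HG l)).
by case: ifP => _ //; rewrite ler_piMl.
Qed.

Lemma slot_bounds : exists2 La : R, 0 <= La & forall l, [/\
  forall s p, derivable (coord_fun a l) p 'e_s,
  forall s p, cube 1 p -> `|pderiv s (coord_fun a l) p| <= La &
  forall s p q, cube 1 p -> cube 1 q ->
    `|pderiv s (coord_fun a l) p - pderiv s (coord_fun a l) q| <= La * `|p - q|].
Proof.
apply: uniform_cst => [l C C' CC [H1 H2 H3]|l].
  split=> // [s p p1|s p q p1 q1]; first exact: le_trans (H2 s p p1) CC.
  by apply: le_trans (H3 s p q p1 q1) _; rewrite ler_wpM2r.
by have [La [_ H1 H2 H3]] := C2_bounds (a_C2 l); exists La.
Qed.

Let top0 l s : top s -> pderiv s (coord_fun a l) 0 = 0.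
Proof. by move=> ts; have := da_0 l ts; rewrite /slot_deriv enum_valK. Qed.

(** The variable and the slots of order less than [2m] carry a factor [r], and the
    top slots have derivative zero at the origin; hence [a (sjet r G x)] depends
    on [G] with a Lipschitz constant of the order of the size of [G]. *)
Lemma rhs_estimates : exists2 La : R, 0 <= La & forall r eta, 0 <= r <= 1 -> 0 <= eta <= 1 ->
  3 * r <= eta -> r <= eta ->
  (forall ka G G', 0 <= ka -> (forall l, smooth cube1 (2 * m) eta (G l)) ->
    (forall l, smooth cube1 (2 * m) eta (G' l)) ->
    (forall l, smooth cube1 (2 * m) ka (fun x => G l x - G' l x)) ->
    forall l, hol cube1 (La * eta * ka) (fun x => a (sjet r G x) 0 l - a (sjet r G' x) 0 l)) /\
  (forall G, 3 * r <= eta * eta -> (forall l, smooth cube1 (2 * m) eta (G l)) ->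
    forall l, hol cube1 (La * eta * eta) (fun x => a (sjet r G x) 0 l)).
Proof.
have [La La0 HLa] := slot_bounds.
exists (2 * slots%:R * La) => [|r eta r01 eta01 reta reta']; first by rewrite !mulr_ge0.
have [eta0 eta1] := andP eta01; have [r0 r1] := andP r01.
split=> [ka G G' ka0 HG HG' HD l|G reta2 HG l]; have [H1 H2 H3] := HLa l.
  apply: (hol_comp_diff (top := top) La0 eta01 ka0 H1 H2 H3) => [s|s|s|s].
  - exact: top0.
  - exact: hol_sjet.
  - exact: hol_sjet.
  rewrite (_ : (fun x => _) = (fun x => sjet_slot r G (enum_val s) x - sjet_slot r G' (enum_val s) x)); last first.
    by apply/funext => x; rewrite !mxE.
  rewrite /top; case: (enum_val s) => [i|[be k]] /=.
    by split=> [x _|x y _ _]; rewrite !subrr ?subrr normr0 ?mulr_ge0// powR_ge0.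
  have sb : (size (word (mi_fun be)) <= 2 * m)%N by rewrite size_word mindex_order.
  rewrite (_ : (fun x => _) = (fun x => r ^+ (2 * m - mi_order (mi_fun be)) *
      mderiv (mi_fun be) (fun y => G k y - G' k y) x)); last first.
    apply/funext => x; rewrite -mulrBr; congr (_ * _); rewrite !mderivE.
    rewrite (_ : (fun y => G k y - G' k y) = (fun y => -1 * G' k y + G k y)); last first.
      by apply/funext => y; rewrite mulN1r addrC.
    by rewrite (dword_lin (-1) (HG' k) (HG k) sb) mulN1r addrC.
  apply: hol_le (hol_sjet_deriv be r01 ka0 (HD k)).
  by case: ifP => _ //; rewrite ler_wpM2r.
rewrite (_ : (fun x => _) = (fun x => coord_fun a l (sjet r G x) - coord_fun a l ((fun=> 0) x))); last first.
  by apply/funext => x; rewrite /coord_fun a_0 mxE subr0.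
apply: (hol_comp_diff (top := top) La0 eta01 eta0 H1 H2 H3) => [s|s|s|s].
- exact: top0.
- exact: hol_sjet.
- by split=> [x _|x y _ _]; rewrite !mxE ?subrr normr0 ?mulr_ge0// powR_ge0.
rewrite (_ : (fun x => _) = sjet_slot r G (enum_val s)); last by apply/funext => x; rewrite !mxE subr0.
rewrite /top; case: (enum_val s) => [i|[be k]] /=; first exact: hol_le reta2 (hol_sjet_var i r0).
apply: hol_le (hol_sjet_deriv be r01 eta0 (HG k)).
by case: ifP => _ //; rewrite ler_wpM2r.
Qed.

Lemma small_scale (c e : R) : 0 <= c -> 0 < e -> exists2 d, 0 < d <= 1 & c * d < e.
Proof.
move=> c0 e0; exists (Num.min 1 (e / (c + 1))).
  by rewrite lt_min ltr01 divr_gt0 ?ltr_wpDl//= ge_min lexx.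
have cp : 0 < c + 1 by rewrite ltr_wpDl.
apply: (@le_lt_trans _ _ (c * (e / (c + 1)))); first by rewrite ler_wpM2l// ge_min lexx orbT.
by rewrite mulrCA gtr_pMr// ltr_pdivrMr// mul1r ltrDl.
Qed.

Definition ansatz (eps : R) (f : 'I_N -> 'rV[R]_n -> R) (l : 'I_N) (x : 'rV[R]_n) : R :=
  eps * hpol x + sol (f l) x.

(** Where [chi L] is 1, a fixed point [f] satisfies [rem^m f = a (...)], and the left
    side is [Delta^m] of the ansatz. *)
Definition rhs_map (L : nat) (r eps : R) (f : 'I_N -> 'rV[R]_n -> R) (l : 'I_N) (x : 'rV[R]_n) : R :=
  chi L x * (a (sjet r (ansatz eps f) x) 0 l + (f l x - iter m (rem S) (f l) x)).

Lemma ansatz_smooth : exists2 K, 1 <= K &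
  [/\ forall C f, hol setT C f -> smooth cube1 (2 * m) (K * C) (sol f),
   forall eps G C l, 0 <= eps -> hol setT C (G l) ->
     smooth cube1 (2 * m) (K * (eps + C)) (ansatz eps G l) &
   forall eps eps' G G' (B B' C : R) l, hol setT B (G l) -> hol setT B' (G' l) ->
     hol setT C (fun x => G l x - G' l x) ->
     smooth cube1 (2 * m) (K * (`|eps - eps'| + C)) (fun x => ansatz eps G l x - ansatz eps' G' l x)].
Proof.
have [K1 K10 H1] := sol_smooth; have [K2 K20 H2] := smooth_mono alpha01 (2 * m) hexp.
have C0 C (f : 'rV[R]_n -> R) : hol setT C f -> 0 <= C.
  by case=> f1 _; apply: le_trans (f1 0 I).
have hs eps : smooth cube1 (2 * m) (`|eps| * (1 + K1 + K2)) (fun x => eps * hpol x).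
  apply: smooth_le (smooth_scale eps H2); rewrite ler_wpM2l// lerDr.
  by rewrite addr_ge0.
have ss C f : hol setT C f -> smooth cube1 (2 * m) ((1 + K1 + K2) * C) (sol f).
  move=> fC; apply: smooth_le (H1 C f fC); rewrite ler_wpM2r ?(C0 _ _ fC)//.
  by rewrite addrAC lerDr addr_ge0.
exists (1 + K1 + K2); first by rewrite -addrA lerDl addr_ge0.
split=> // [eps f C l eps0 fC|eps eps' f f' B B' C l fB fB' fC].
  rewrite mulrDr [_ * eps]mulrC -{1}(ger0_norm eps0); apply: smooth_add (hs eps) _.
  exact: ss.
rewrite mulrDr [_ * `|_|]mulrC.
rewrite (_ : (fun x => _) = (fun x => (eps - eps') * hpol x + sol (fun y => f l y - f' l y) x)).
  by apply: smooth_add (hs _) _; exact: ss.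
rewrite (_ : (fun y => f l y - f' l y) = (fun y => -1 * f' l y + f l y)); last first.
  by apply/funext => y; rewrite mulN1r addrC.
by rewrite (sol_lin (-1) fB' fB); apply/funext => x; rewrite /ansatz; ring.
Qed.

(** The size of [v] is [del], [r = del^2], and the right-hand side is then
    [O(del^2)].  The map contracts, since [a] has a small Lipschitz constant on
    this scale and [f - rem^m f] is small for [f] supported in a small cube. *)
Lemma fixed_points : exists L (K c0 : R), [/\ 1 <= K, 0 <= c0,
  forall C g, hol setT C g -> smooth cube1 (2 * m) (K * C) (sol g) &
  forall del, 0 < del <= 1 -> c0 * del <= 1 / 4 -> exists f : R -> 'I_N -> 'rV[R]_n -> R, forall eps, 0 <= eps <= del -> [/\
    forall l x, rhs_map L (del ^+ 2) eps (f eps) l x = f eps l x,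
    forall l, hol setT (c0 * del ^+ 2) (f eps l),
    forall l, exists C, smooth cube1 (2 * m) C (ansatz eps (f eps) l) &
    forall eps', 0 <= eps' <= del -> forall l,
      hol setT (c0 * del * `|eps - eps'|) (fun x => f eps l x - f eps' l x)]].
Proof.
have [K K1 [Ks Ka Kd]] := ansatz_smooth.
have K0 : 0 <= K by apply: le_trans K1.
have [La La0 HLa] := rhs_estimates.
have rc0 : 0 <= rem_cst S m by exact: rem_cst_ge0.
(* The volume of the cube, of order 2^(-nL), outweighs the Lipschitz constant 2^(L+1) of the
   cutoff because n >= 2. *)
have [L HL] : exists L, (1 + 2 ^+ L.+1) * (rem_cst S m * (2 ^+ L) ^- n) <= 1 / 4.
  have [||L HL] := @expr_small R 2^-1 (1 / (12 * (rem_cst S m + 1))); first by lra.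
    by rewrite divr_gt0// mulr_gt0// ltr_wpDl.
  exists L; have {HL} := HL L (leqnn L); rewrite exprVn.
  set P := 2 ^+ L => HP.
  have P1 : 1 <= P by rewrite exprn_ege1// ler1n.
  have Pp : 0 < P by apply: lt_le_trans P1.
  have Pn : P ^- n <= P^-1 * P^-1.
    rewrite -invfM -expr2 lef_pV2 ?posrE ?exprn_gt0//.
    by rewrite ler_weXn2l// ltnW.
  have P3 : 1 + 2 ^+ L.+1 <= 3 * P by rewrite exprS -/P; lra.
  apply: (@le_trans _ _ (3 * P * (rem_cst S m * (P^-1 * P^-1)))).
    by apply: ler_pM => //; rewrite ?addr_ge0 ?exprn_ge0 ?mulr_ge0 ?invr_ge0 ?exprn_ge0 ?(ltW Pp)// ler_wpM2l.
  rewrite [leLHS](_ : _ = 3 * rem_cst S m * P^-1); last by field; rewrite gt_eqF.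
  have rp : 0 < rem_cst S m + 1 by rewrite ltr_wpDl.
  apply: le_trans (ler_wpM2l (mulr_ge0 (ler0n _ 3) rc0) HP) _.
  rewrite [leLHS](_ : _ = (rem_cst S m / (rem_cst S m + 1)) * (1 / 4)); last by field; rewrite gt_eqF.
  by rewrite ler_piMl// ler_pdivrMr// mul1r lerDl.
set X := 1 + 2 ^+ L.+1 in HL.
have X0 : 0 <= X by rewrite addr_ge0// exprn_ge0.
pose sg : R := 2 * X * La * (4 * K) ^+ 2.
pose th : R := X * La * (4 * K) * K.
have sg0 : 0 <= sg by rewrite !mulr_ge0// exprn_ge0// mulr_ge0.
have th0 : 0 <= th by rewrite !mulr_ge0.
pose c0 := 4 * K + sg + 4 * th.
exists L, K, c0; split=> //; first by rewrite /c0 !addr_ge0 ?mulr_ge0.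
move=> del /andP[d0 d1] cd.
have cd1 : 4 * K * del <= 1 / 4.
  by apply: le_trans cd; rewrite ler_wpM2r ?(ltW d0)// /c0 -addrA lerDl addr_ge0// mulr_ge0.
have cd2 : sg * del <= 1 / 4.
  apply: le_trans cd; rewrite ler_wpM2r ?(ltW d0)// /c0 addrAC lerDr.
  by rewrite addr_ge0 ?mulr_ge0.
have cd3 : th * del <= 1 / 4.
  apply: le_trans cd; rewrite ler_wpM2r ?(ltW d0)// /c0.
  rewrite -[leLHS]add0r; apply: lerD; first by rewrite addr_ge0 ?mulr_ge0.
  by rewrite ler_peMl// ler1n.
pose sig := sg * del ^+ 2; pose eta := 4 * K * del; pose r := del ^+ 2.
have sig0 : 0 <= sig by rewrite mulr_ge0// sqr_ge0.
have sigd : sig <= del by rewrite /sig expr2 mulrA ler_piMl ?(ltW d0)//; lra.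
have eta01 : 0 <= eta <= 1.
  rewrite /eta !mulr_ge0 ?(ltW d0)//=; lra.
have [eta0 _] := andP eta01.
have PL0 : 0 <= (2 ^+ L) ^- n :> R by rewrite invr_ge0 !exprn_ge0.
have r01 : 0 <= r <= 1 by rewrite /r sqr_ge0 expr2 mulr_ile1 ?(ltW d0).
have rd : r <= del by rewrite /r expr2 ler_piMr ?(ltW d0).
have etad : 4 * del <= eta by rewrite /eta -mulrA ler_wpM2l// ler_peMl ?(ltW d0).
have reta : 3 * r <= eta by lra.
have reta' : r <= eta by lra.
have reta2 : 3 * r <= eta * eta.
  rewrite /eta /r (_ : 4 * K * del * (4 * K * del) = 16 * K ^+ 2 * del ^+ 2); last by ring.
  rewrite ler_wpM2r ?sqr_ge0//.
  have : 1 <= K ^+ 2 by rewrite exprn_ege1.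
  by lra.
have [Ed E0] := HLa r eta r01 eta01 reta reta'.
have anseta eps g l : 0 <= eps <= del -> hol setT sig (g l) -> smooth cube1 (2 * m) eta (ansatz eps g l).
  move=> /andP[e0 e1] gs; apply: smooth_le (Ka eps g sig l e0 gs).
  rewrite /eta (_ : 4 * K * del = K * (4 * del)); last by ring.
  by rewrite ler_wpM2l//; lra.
pose dom (g : 'I_N -> 'rV[R]_n -> R) := (forall l, hol setT sig (g l)) /\
  (forall l y, 2 ^- L < `|y| -> g l y = 0).
have remdiff C (g : 'rV[R]_n -> R) : hol setT C g -> (forall y, 2 ^- L < `|y| -> g y = 0) ->
    hol cube1 (rem_cst S m * ((2 ^+ L) ^- n * C)) (fun x => g x - iter m (rem S) g x).
  by move=> gC g0; apply: (@hol_sub _ _ alpha setT) => //; exact: iter_rem_small.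
have remle C : 0 <= C -> X * (rem_cst S m * ((2 ^+ L) ^- n * C)) <= C / 4.
  move=> C0; rewrite [leLHS](_ : _ = X * (rem_cst S m * (2 ^+ L) ^- n) * C); last by ring.
  by rewrite [C / 4]mulrC ler_wpM2r//; apply: le_trans HL _; lra.
have step eps eps' g g' C : 0 <= eps <= del -> 0 <= eps' <= del -> dom g -> dom g' -> 0 <= C ->
    (forall l, hol setT C (fun x => g l x - g' l x)) -> forall l,
    hol setT (th * del * `|eps - eps'| + C / 2) (fun x => rhs_map L r eps g l x - rhs_map L r eps' g' l x).
  move=> e01 e01' [gs g0] [gs' g0'] C0 gC l.
  have ka0 : 0 <= K * (`|eps - eps'| + C) by rewrite mulr_ge0// addr_ge0.
  have D := Ed _ _ _ ka0 (fun l => anseta eps g l e01 (gs l)) (fun l => anseta eps' g' l e01' (gs' l))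
    (fun l => Kd eps eps' g g' sig sig C l (gs l) (gs' l) (gC l)) l.
  have gz y : 2 ^- L < `|y| -> g l y - g' l y = 0 by move=> yL; rewrite g0// g0'// subrr.
  have := hol_chi alpha01 L _ (hol_add D (remdiff C _ (gC l) gz)).
  have Dn : 0 <= La * eta * (K * (`|eps - eps'| + C)) + rem_cst S m * ((2 ^+ L) ^- n * C).
    apply: addr_ge0; first by apply: mulr_ge0 ka0; exact: mulr_ge0.
    by apply: mulr_ge0 rc0 _; exact: mulr_ge0.
  move=> /(_ Dn) H; move: H; rewrite -/X => H.
  have lin : iter m (rem S) (fun x => g l x - g' l x) = (fun x => iter m (rem S) (g l) x - iter m (rem S) (g' l) x).
    have hb k u B : hol setT B u -> bnd (iter k (rem S) u).
      move=> uB; suff [B' /hol_bnd] : exists B', hol setT B' (iter k (rem S) u) by [].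
      elim: k => [|k [B' HB']]; first by exists B.
      by exists ((slvC S + 1) * B'); exact: hol_rem.
    rewrite (_ : (fun x => g l x - g' l x) = (fun x => -1 * g' l x + g l x)); last first.
      by apply/funext => x; rewrite mulN1r addrC.
    rewrite (_ : (fun x => iter m _ _ x - _) = (fun x => -1 * iter m (rem S) (g' l) x + iter m (rem S) (g l) x)); last first.
      by apply/funext => x; rewrite mulN1r addrC.
    elim: (m) => //= k ->; apply: rem_lin; [exact: hb (gs' l)|exact: hb (gs l)].
  apply: hol_le (_ : X * (La * eta * (K * (`|eps - eps'| + C)) + rem_cst S m * ((2 ^+ L) ^- n * C)) <= _) _.
    rewrite mulrDr (_ : X * (La * eta * _) = th * del * `|eps - eps'| + th * del * C); last first.
      by rewrite /th /eta; ring.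
    rewrite -addrA lerD2l; apply: le_trans (lerD (lexx _) (remle C C0)) _.
    have : th * del * C <= 1 / 4 * C by rewrite ler_wpM2r.
    by lra.
  move: H; congr hol; apply/funext => x; rewrite lin /rhs_map; ring.
have self eps g : 0 <= eps <= del -> dom g -> dom (rhs_map L r eps g).
  move=> e01 [gs g0]; split=> [l|l y yL]; last by rewrite /rhs_map chi0 ?mul0r// ltW.
  have D := E0 _ reta2 (fun l => anseta eps g l e01 (gs l)) l.
  have Dn : 0 <= La * eta * eta + rem_cst S m * ((2 ^+ L) ^- n * sig).
    apply: addr_ge0; first by apply: mulr_ge0 (mulr_ge0 La0 eta0) eta0.
    by apply: mulr_ge0 rc0 _; exact: mulr_ge0.
  have := hol_chi alpha01 L Dn (hol_add D (remdiff sig _ (gs l) (g0 l))).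
  apply: hol_le; rewrite -/X mulrDr; apply: le_trans (lerD (lexx _) (remle sig sig0)) _.
  rewrite (_ : X * (La * eta * eta) = sig / 2); last by rewrite /sig /sg /eta; field.
  by lra.
have dom0 : dom (fun _ _ => 0).
  split=> // l; split=> [x _|x y _ _]; rewrite ?subrr normr0 //.
  by rewrite mulr_ge0// powR_ge0.
have domlim (u : nat -> 'I_N -> 'rV[R]_n -> R) g : (forall j, dom (u j)) ->
    (forall l x, u j l x @[j --> \oo] --> g l x) -> dom g.
  move=> du ug; split=> [l|l y yL].
    by apply: (@hol_lim _ _ _ _ (fun j => u j l) (g l) 0%N) => [x|j _]; [exact: ug|case: (du j)].
  rewrite -(cvg_lim _ (ug l y))// (_ : (fun j => u j l y) = fun=> 0) ?lim_cst//.
  by apply/funext => j; case: (du j) => _; apply.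
have fp eps : exists g, 0 <= eps <= del -> dom g /\ forall l x, rhs_map L r eps g l x = g l x.
  have [e01|ne] := pselect (0 <= eps <= del); last by exists (fun _ _ => 0) => /ne.
  have ds g : dom g -> forall l, hol setT sig (g l) by case.
  have ct g g' C : 0 <= C -> dom g -> dom g' -> (forall l, hol setT C (fun x => g l x - g' l x)) ->
      forall l, hol setT (C / 2) (fun x => rhs_map L r eps g l x - rhs_map L r eps g' l x).
    move=> C0 dg dg' gC l; have := step eps eps g g' C e01 e01 dg dg' C0 gC l.
    by rewrite subrr normr0 mulr0 add0r.
  have [g dg Hg] := contraction_fixed_point sig0 ds domlim dom0 (fun g => self eps g e01) ct.
  by exists g.
have [f Hf] := choice fp.
exists f => eps e01; have [de Fe] := Hf eps e01; split=> //.
- move=> l; apply: hol_le (de.1 l); rewrite /sig ler_wpM2r ?sqr_ge0//.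
  by rewrite /c0 addrAC lerDr addr_ge0 ?mulr_ge0.
- by move=> l; exists eta; exact: anseta (de.1 l).
move=> eps' e01' l; have [de' Fe'] := Hf eps' e01'.
(* Two fixed points differ by at most their distance at the start, halved at each step, plus
   the accumulated effect of changing eps. *)
have it k : forall l, hol setT (2 * (th * del * `|eps - eps'|) + 2 * sig * 2 ^- k)
    (fun x => f eps l x - f eps' l x).
  elim: k => [|k ih] l'.
    rewrite expr0 invr1 mulr1.
    apply: hol_le (_ : sig + `|-1| * sig <= _) _.
      by rewrite normrN1; have : 0 <= th * del * `|eps - eps'|; [rewrite !mulr_ge0 ?(ltW d0)|lra].
    have := hol_add (de.1 l') (hol_scale (-1) (de'.1 l')).
    by congr hol; apply/funext => x; rewrite mulN1r.
  have C0 : 0 <= 2 * (th * del * `|eps - eps'|) + 2 * sig * 2 ^- k.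
    by rewrite addr_ge0 ?mulr_ge0 ?invr_ge0 ?exprn_ge0 ?(ltW d0).
  have := step eps eps' (f eps) (f eps') _ e01 e01' de de' C0 ih l'.
  rewrite (_ : (fun x => rhs_map _ _ _ _ _ x - _) = (fun x => f eps l' x - f eps' l' x)); last first.
    by apply/funext => x; rewrite Fe Fe'.
  apply: hol_le; rewrite exprS invfM; move: (th * del * _) (2 ^- k) => u v.
  by lra.
apply: hol_le (_ : 2 * (th * del * `|eps - eps'|) <= _) _.
  rewrite 2!mulrA -[X in _ <= X]mulrA -[X in X <= _]mulrA ler_wpM2r ?mulr_ge0 ?(ltW d0)//.
  rewrite /c0 -[leLHS]add0r; apply: lerD; first by rewrite addr_ge0 ?mulr_ge0.
  by rewrite ler_wpM2r// ler_nat.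
apply: (@hol_lim _ _ alpha _ (fun _ x => f eps l x - f eps' l x) _ 0%N) => [x|_ _]; first exact: cvg_cst.
have small e : 0 < e -> exists k, 2 * sig * 2 ^- k <= e.
  move=> e0; have [||k Hk] := @expr_small R 2^-1 (e / (2 * sig + 1)); first by lra.
    by rewrite divr_gt0// ltr_wpDl// mulr_ge0.
  exists k; rewrite -exprVn; apply: le_trans (ler_wpM2l _ (Hk k (leqnn k))) _; first by rewrite mulr_ge0.
  have s1 : 0 < 2 * sig + 1 by rewrite ltr_wpDl// mulr_ge0.
  by rewrite mulrCA ler_piMr ?(ltW e0)// ler_pdivrMr// mul1r lerDl.
split=> [x _|x y _ _]; apply/ler_addgt0Pr => e e0.
  have [k Hk] := small e e0; have [h1 _] := it k l.
  by apply: le_trans (h1 x I) _; rewrite lerD2l.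
have p1 : 0 < `|x - y| `^ alpha + 1 by rewrite ltr_wpDl// powR_ge0.
have [|k Hk] := small (e / (`|x - y| `^ alpha + 1)); first by rewrite divr_gt0.
have [_ h2] := it k l; apply: le_trans (h2 x y I I) _.
rewrite mulrDl lerD2l; apply: le_trans (ler_wpM2r (powR_ge0 _ _) Hk) _.
by rewrite mulrAC ler_pdivrMr// ler_wpM2l ?(ltW e0)// lerDl.
Qed.

Lemma hexp_fact_ge1 : 1 <= fact_mi hexp :> R.
Proof.
by rewrite /fact_mi -natr_prod ler1n prodn_gt0// => i; rewrite fact_gt0.
Qed.

(** The correction [sol f] is [O(del^2)] while the coefficient [eps] of the polynomial
    is at least [del / 2]: hence the polynomial decides the derivative of order
    [2m] at the origin and the values at the two points.  Solutions for
    different [eps] differ, as the correction depends on [eps] with the small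
    Lipschitz constant [O(del)]. *)
Lemma scaled_family : exists (r rho t : R) (V : nat -> 'I_N -> 'rV[R]_n -> R),
  [/\ 0 < r, 0 < t < rho & rho <= 1] /\
  [/\ forall k l, exists C, smooth cube1 (2 * m) C (V k l),
    forall k l x, `|x| < rho -> iter m laplacian (V k l) x = a (sjet r (V k) x) 0 l,
    forall k l ga, (mi_order ga < 2 * m)%N -> mderiv ga (V k l) 0 = 0,
    forall k l, mderiv hexp (V k l) 0 <> 0 &
    (forall k l, V k l (xpt (- t) t) <> V k l (xpt t t)) /\
    forall k k' l, k <> k' -> V k l (xpt t t) <> V k' l (xpt t t)].
Proof.
have [L [K [c0 [K1 c00 Ks fix_]]]] := fixed_points.
have K0 : 0 <= K by apply: le_trans K1.
pose t : R := 2 ^- L.+2; pose T := t ^+ (2 * m).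
have t0 : 0 < t by rewrite invr_gt0 exprn_gt0.
have t1 : t <= 1 by rewrite invf_le1 ?exprn_gt0// exprn_ege1// ler1n.
have T0 : 0 < T by rewrite exprn_gt0.
have T1 : T <= 1 by rewrite exprn_ile1// ltW.
have h1 : hpol (xpt t t) = T.
  by rewrite hpol_xpt /T -exprSr prednK// muln_gt0.
have h2 : hpol (xpt (- t) t) = - T.
  have o : odd (2 * m).-1 by case: m m1 => // j _; rewrite mul2n doubleS /= odd_double.
  by rewrite hpol_xpt exprNn -signr_odd o expr1 mulN1r mulNr -hpol_xpt h1.
have nt s : `|s| = t -> `|xpt s t| <= 1.
  by move=> st; apply: norm_xpt; rewrite ?st// ger0_norm// ltW.
have nt1 : `|xpt t t| <= 1 by rewrite nt// ger0_norm// ltW.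
have nt2 : `|xpt (- t) t| <= 1 by rewrite nt// normrN ger0_norm// ltW.
have [||del /andP[d0 d1] dT] := @small_scale (2 * (K * c0)) (T / 2); first by rewrite !mulr_ge0.
  by rewrite divr_gt0.
have Kc : K * c0 * del < T / 4 by lra.
have cd : c0 * del <= 1 / 4.
  apply: (@le_trans _ _ (K * c0 * del)); last by lra.
  by rewrite ler_wpM2r ?(ltW d0)// ler_peMl.
have d01 : 0 < del <= 1 by rewrite d0.
have [f Hf] := fix_ del d01 cd.
pose eps k := del / 2 + del / 2 / k.+1%:R.
have epsge k : del / 2 <= eps k by rewrite lerDl !divr_ge0// ltW.
have e01 k : 0 <= eps k <= del.
  apply/andP; split; first by apply: le_trans (epsge k); rewrite divr_ge0// ltW.
  have : del / 2 / k.+1%:R <= del / 2 by rewrite ler_pdivrMr// ler_peMr ?divr_ge0 ?(ltW d0)// ler1n.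
  by rewrite /eps; move: (_ / k.+1%:R) => z; lra.
have einj k k' : k <> k' -> 0 < `|eps k - eps k'|.
  move=> kk; rewrite normr_gt0 subr_eq0; apply/eqP => /addrI.
  have d2 : del / 2 != 0 by rewrite gt_eqF// divr_gt0.
  by move=> /(mulfI d2) /invr_inj /eqP; rewrite eqr_nat => /eqP [].
have solx C g x : hol setT C g -> `|x| <= 1 -> `|sol g x| <= K * C.
  by move=> gC x1; have [H _] := smooth_holE (Ks C g gC); exact: H.
have del2 : K * (c0 * del ^+ 2) < del * (T / 4).
  by rewrite (_ : K * _ = del * (K * c0 * del)); [rewrite ltr_pM2l|ring].
have [Kh _ Hh] := smooth_mono alpha01 (2 * m) hexp; have wh ga := size_word ga.
exists (del ^+ 2), (2 ^- L.+1), t, (fun k => ansatz (eps k) (f (eps k))).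
have fsol k l := Ks _ _ (let: And4 _ H _ _ := Hf (eps k) (e01 k) in H l).
have der k l ga : (mi_order ga <= 2 * m)%N -> mderiv ga (ansatz (eps k) (f (eps k)) l) 0 =
    eps k * mderiv ga hpol 0 + mderiv ga (sol (f (eps k) l)) 0.
  by move=> ga2; rewrite !mderivE (dword_lin (eps k) Hh (fsol k l)) ?size_word.
split; split.
- by rewrite exprn_gt0.
- rewrite t0 /= /t -!exprVn exprS gtr_pMl ?exprn_gt0 ?invr_gt0//.
  by rewrite invf_lt1 ?ltr1n.
- by rewrite invf_le1 ?exprn_gt0// exprn_ege1// ler1n.
- by move=> k l; have [_ _ H _] := Hf (eps k) (e01 k).
- move=> k l x xr; have [Fe fC _ _] := Hf (eps k) (e01 k).
  have := Fe l x; rewrite /rhs_map chi1 ?(ltW xr)// mul1r.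
  rewrite addrCA -[RHS]addr0 => /addrI /eqP; rewrite subr_eq0 => /eqP ->.
  have Hh' := smooth_scale (eps k) Hh; have Hs := fsol k l.
  rewrite mul2n in Hh' Hs.
  by rewrite (iter_laplacian_add Hh' Hs) iter_laplacian_hpol add0r (iter_laplacian_sol (fC l)).
- move=> k l ga ga2; have [_ fC _ _] := Hf (eps k) (e01 k).
  rewrite der ?(ltnW ga2)// mderiv_hpol0 /sol (mderiv_cut0 alpha01 (smooth_it (fC l)) ga2) addr0.
  case: ifP => [/forallP E|_]; last by rewrite mulr0.
  move: ga2; rewrite -hexp_order /mi_order (eq_bigr hexp) ?ltnn// => i _; exact/eqP.
- move=> k l; have [_ fC _ _] := Hf (eps k) (e01 k).
  rewrite der ?hexp_order// mderiv_hpol0 ifT; last by apply/forallP.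
  have H : `|mderiv hexp (sol (f (eps k) l)) 0| <= K * (c0 * del ^+ 2).
    rewrite mderivE; have sw : (size (word hexp) <= 2 * m)%N by rewrite size_word hexp_order.
    have [H _] := smooth_holE (smooth_dword (fsol k l) sw).
    by apply: H; rewrite /cube /= normr0.
  have : eps k <= eps k * fact_mi hexp.
    by rewrite ler_peMr ?hexp_fact_ge1//; case/andP: (e01 k).
  have := epsge k; move: H; rewrite ler_norml => /andP[H _].
  have dT' : del * (T / 4) < del / 2 by rewrite ltr_pM2l//; lra.
  by lra.
- split=> [k l|k k' l kk]; have [_ fC _ Hd] := Hf (eps k) (e01 k).
    rewrite /ansatz h1 h2.
    have := solx _ _ _ (fC l) nt1; have := solx _ _ _ (fC l) nt2.
    rewrite !ler_norml => /andP[A1 A2] /andP[B1 B2].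
    have : del / 2 * T <= eps k * T by rewrite ler_wpM2r ?(ltW T0).
    have : 0 < del * T by rewrite mulr_gt0.
    by lra.
  have [_ fC' _ _] := Hf (eps k') (e01 k').
  rewrite /ansatz h1.
  have := solx _ _ _ (Hd (eps k') (e01 k') l) nt1.
  rewrite (_ : (fun x => f (eps k) l x - _) = (fun y => -1 * f (eps k') l y + f (eps k) l y)); last first.
    by apply/funext => y; rewrite mulN1r addrC.
  rewrite (sol_lin (-1) (fC' l) (fC l)) => H E.
  have {}H : `|eps k - eps k'| * T <= K * (c0 * del * `|eps k - eps k'|).
    apply: le_trans H; rewrite -[X in _ * X](gtr0_norm T0) -normrM -normrN.
    by rewrite le_eqVlt; apply/orP; left; apply/eqP; congr `|_|; lra.
  have : `|eps k - eps k'| * (K * c0 * del) < `|eps k - eps k'| * T.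
    by rewrite ltr_pM2l ?einj//; lra.
  by lra.
Qed.

End ScaledProblem.

(** * Undoing the rescaling *)

Section Dilation.
Context {R : realType} {n : nat} (alpha : R).
Hypothesis alpha01 : 0 < alpha < 1.
  Local Notation hol := (hol alpha).
  Local Notation smooth := (smooth alpha).
Implicit Types (f : 'rV[R]_n -> R) (b c C : R).

Lemma norm_le_enorm (x : 'rV[R]_n) : `|x| <= enorm x.
Proof.
apply: norm_le_coord => [|i]; first exact: sqrtr_ge0.
rewrite -sqrtr_sqr; apply: ler_wsqrtr; rewrite (bigD1 i)//= lerDl.
by apply: sumr_ge0 => j _; exact: sqr_ge0.
Qed.

Lemma hol_continuous (U : set 'rV[R]_n) C f : open U -> hol U C f ->
  forall x, U x -> {for x, continuous f}.
Proof.
move=> oU [_ fC] x Ux; apply/(@cvgrPdist_le _ _ _ (nbhs x) (nbhs_filter x)) => e e0.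
have [a0 _] := andP alpha01.
have C1 : 0 < `|C| + 1 by rewrite ltr_wpDl.
pose d := (e / (`|C| + 1)) `^ alpha^-1.
have d0 : 0 < d by apply: powR_gt0; rewrite divr_gt0.
have Ed : (`|C| + 1) * d `^ alpha = e.
  by rewrite /d -powRrM mulVf ?gt_eqF// powRr1 ?divr_ge0 ?(ltW e0) ?(ltW C1)// mulrC divfK// gt_eqF.
have /nbhs_normP[r /= r0 rU] : nbhs x U by exact: open_nbhs_nbhs.
change (nbhs x (fun y => `|f x - f y| <= e)); apply/(@nbhs_normP R 'rV[R]_n x).
exists (Num.min r d); first by rewrite /= lt_min r0.
move=> y /=; rewrite lt_min => /andP[/rU Uy /ltW xy].
apply: le_trans (fC x y Ux Uy) _; rewrite -Ed.
apply: le_trans (ler_wpM2r (powR_ge0 _ _) (_ : C <= `|C| + 1)) _.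
  by apply: le_trans (ler_norm C) _; rewrite lerDl.
by rewrite ler_wpM2l ?(ltW C1)// ge0_ler_powR ?nnegrE ?(ltW a0) ?(ltW d0).
Qed.

Lemma is_derive_dil f b c i x : derivable f (b *: x) 'e_i ->
  is_derive x 'e_i (fun y => c * f (b *: y)) (c * b * pderiv i f (b *: x)).
Proof.
move=> df; have df' : derivable f (b *: x + (0 * b) *: 'e_i) 'e_i.
  by rewrite mul0r scale0r addr0.
have H := is_derive_line df'; rewrite mul0r scale0r addr0 in H.
rewrite -mulrA; apply: (@is_deriveZ _ _ _ (fun y => f (b *: y)) c).
have E : (fun h : R => h^-1 *: (((fun s : R => f (b *: x + (s * b) *: 'e_i)) \o shift 0) (h *: 1)
      - f (b *: x + (0 * b) *: 'e_i))) =
    (fun h : R => h^-1 *: (((fun y => f (b *: y)) \o shift x) (h *: 'e_i) - f (b *: x))).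
  apply/funext => h; rewrite /= [h *: 1]mulr1 addr0 mul0r scale0r addr0.
  by rewrite [b *: (_ + x)]scalerDr scalerA [b * h]mulrC [_ + b *: x]addrC.
case: H => H1 H2; apply: DeriveDef; first by rewrite /derivable -E.
by rewrite -H2 /derive E.
Qed.

Lemma pderiv_dil B k C f b c i : smooth B k.+1 C f ->
  (forall x, derivable (fun y => c * f (b *: y)) x 'e_i) /\
  pderiv i (fun y => c * f (b *: y)) = (fun y => c * b * pderiv i f (b *: y)).
Proof.
move=> [_ /(_ i)[df _]]; split=> [x|]; first by case: (is_derive_dil c (df (b *: x))).
by apply/funext => x; case: (is_derive_dil c (df (b *: x))).
Qed.

Lemma dword_dil B k C f b c s : smooth B k C f -> (size s <= k)%N ->
  dword s (fun y => c * f (b *: y)) = (fun y => c * b ^+ size s * dword s f (b *: y)).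
Proof.
elim/last_ind: s k f c => [|s i ih] k f c fk; first by rewrite expr0 mulr1.
rewrite size_rcons !dword_rcons; case: k fk => // k fk sk.
have [_ ->] := pderiv_dil b c i fk; have [_ /(_ i)[_ Hf]] := fk.
by rewrite (ih k _ _ Hf sk) exprS mulrA.
Qed.

Lemma iter_laplacian_dil m B C f b c : smooth B m.*2 C f ->
  iter m laplacian (fun y => c * f (b *: y)) =
  (fun y => c * b ^+ m.*2 * iter m laplacian f (b *: y)).
Proof.
elim: m C f c => [|m ih] C f c fm; first by rewrite expr0 mulr1.
have E : laplacian (fun y => c * f (b *: y)) = (fun y => c * b ^+ 2 * laplacian f (b *: y)).
  apply/funext => x; rewrite /laplacian mulr_sumr; apply: eq_bigr => i _.
  have [_ ->] := pderiv_dil b c i fm; have [_ /(_ i)[_ Hf]] := fm.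
  by have [_ ->] := pderiv_dil b (c * b) i Hf; rewrite expr2 mulrA.
by rewrite !iterSr E (ih _ _ _ (smooth_laplacian fm)) doubleS !exprS !mulrA expr0 mulr1.
Qed.

Lemma hol_dil (B U : set 'rV[R]_n) C f b c : (forall x, U x -> B (b *: x)) -> 0 <= C ->
  hol B C f -> hol U (`|c| * C * (1 + `|b| `^ alpha)) (fun x => c * f (b *: x)).
Proof.
move=> UB C0 [f1 f2]; split=> [x Ux|x y Ux Uy].
  rewrite normrM; apply: le_trans (ler_wpM2l (normr_ge0 c) (f1 _ (UB _ Ux))) _.
  by rewrite ler_peMr ?mulr_ge0// lerDl powR_ge0.
rewrite -mulrBr normrM -!mulrA ler_wpM2l//; apply: le_trans (f2 _ _ (UB _ Ux) (UB _ Uy)) _.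
rewrite ler_wpM2l// -scalerBr normrZ powRM// ler_wpM2r ?powR_ge0//.
by rewrite lerDr.
Qed.

Lemma Ck_dil (B U : set 'rV[R]_n) k C f b c : open U -> (forall x, U x -> B (b *: x)) -> 0 <= C ->
  smooth B k C f -> Ck_scalar U k (fun x => c * f (b *: x)).
Proof.
move=> oU UB C0; elim: k f c => [|k ih] f c fk.
  by split=> //; exact: hol_continuous (hol_dil c UB C0 (smooth_holE fk)).
split; first exact: hol_continuous (hol_dil c UB C0 (smooth_holE fk)).
move=> i; have [df ->] := pderiv_dil b c i fk; split=> [x _ //|].
by case: fk => _ /(_ i)[_ Hf]; exact: ih.
Qed.

Lemma holder_on_hol (U : set 'rV[R]_n) C f : 0 <= C -> hol U C f -> holder_on U alpha f.
Proof.
move=> C0 [_ f2]; exists C => x y Ux Uy; apply: le_trans (f2 x y Ux Uy) _.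
rewrite ler_wpM2l// ge0_ler_powR ?nnegrE ?norm_le_enorm ?sqrtr_ge0//.
by case/andP: alpha01 => /ltW.
Qed.

End Dilation.

Lemma infinite_range_inj (T : Type) (F : nat -> T) : injective F -> infinite_set (range F).
Proof.
move=> Fi; rewrite (eq_finite_set (inj_card_eq (in2W Fi))).
exact: infinite_nat.
Qed.

Theorem theorem1p2 (R : realType) (n N m : nat) (alpha : R)
  (n_ge3 : (3 <= n)%N) (N_ge1 : (1 <= N)%N) (m_ge1 : (1 <= m)%N)
  (alpha_gt0 : 0 < alpha) (alpha_lt1 : alpha < 1)
  (a : 'rV[R]_#|slot n N (2 * m)%N| -> 'rV[R]_N)
  (a_C2 : Ck setT 2 a)
  (a_0 : a 0 = 0)
  (da_0 : forall (s : slot n N (2 * m)%N) (l : 'I_N), top_slot s ->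
     slot_deriv s (coord_fun a l) 0 = 0)
  (d2a_0 : forall (s t : slot n N (2 * m)%N) (l : 'I_N), top_slot s ->
     top_slot t -> slot_deriv s (slot_deriv t (coord_fun a l)) 0 = 0) :
  exists U : set 'rV[R]_n, open_nbhs (0 : 'rV[R]_n) U /\
  exists S : set ('rV[R]_n -> 'rV[R]_N),
    (* infinitely many as functions on U: values off U do not count *)
    infinite_set [set u \_ U | u in S] /\
    forall u, S u ->
      [/\ Ckalpha U (2 * m)%N alpha u,
          forall x, U x -> forall l : 'I_N,
            iter m laplacian (coord_fun u l) x = a (jet (2 * m)%N u x) 0 l,
          vanishing_order_at0 (2 * m)%N u &
          ~ radially_symmetric U u].
Proof.
have alpha01 : 0 < alpha < 1 by rewrite alpha_gt0.
have [S] := exists_solver alpha01 n_ge3.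
have [r [rho [t [V [[r0 /andP[t0 trho] rho1] [Vs Veq Vlow Vtop [Vodd Vdist]]]]]]] :=
  scaled_family alpha01 n_ge3 m_ge1 a_C2 a_0 da_0 S.
have r_neq0 : r != 0 by rewrite gt_eqF.
have l0 : 'I_N := Ordinal N_ge1.
(* The norm of 'rV[R]_n is the maximum norm, so U is a cube. *)
pose U : set 'rV[R]_n := ball 0 (r * rho).
have UE x : U x <-> `|x| < r * rho by rewrite /U -ball_normE /ball_ /= sub0r normrN.
have oU : open U by exact: ball_open.
have U_rho x : U x -> `|r^-1 *: x| < rho.
  by move=> /UE xU; rewrite normrZ gtr0_norm ?invr_gt0// ltr_pdivrMl.
have U_cube x : U x -> cube 1 (r^-1 *: x).
  by move=> /U_rho /ltW H; exact: le_trans H rho1.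
pose u k (x : 'rV[R]_n) : 'rV[R]_N := \row_l (r ^+ (2 * m) * V k l (r^-1 *: x)).
have uE k l : coord_fun (u k) l = (fun x => r ^+ (2 * m) * V k l (r^-1 *: x)).
  by apply/funext => x; rewrite /coord_fun mxE.
have u_mderiv k l be x : (mi_order be <= 2 * m)%N ->
    mderiv be (coord_fun (u k) l) x = r ^+ (2 * m - mi_order be) * mderiv be (V k l) (r^-1 *: x).
  move=> be2; have [C VC] := Vs k l.
  rewrite uE !mderivE (dword_dil _ _ VC) ?size_word//; congr (_ * _).
  by rewrite exprVn expfB_cond// (negbTE r_neq0).
have C_ge0 k l C : smooth alpha (cube 1) (2 * m) C (V k l) -> 0 <= C.
  by move=> /smooth_holE[H _]; apply: le_trans (H 0 _); rewrite /cube /= ?normr0.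
(* The points pt t and pt (- t) are mirror images in the coordinate x_0. *)
pose pt (s : R) : 'rV[R]_n := r *: xpt n_ge3 s t.
have ptE s : pt s = xpt n_ge3 (r * s) (r * t).
  by apply/rowP => i; rewrite !mxE; case: ifP => // _; case: ifP; rewrite ?mulr0.
have ptU s : `|s| = t -> U (pt s).
  move=> st; apply/UE; apply: (@le_lt_trans _ _ (r * t)); last by rewrite ltr_pM2l.
  by rewrite normrZ gtr0_norm// ler_wpM2l ?(ltW r0)// norm_xpt ?st ?gtr0_norm.
have u_pt k l s : u k (pt s) 0 l = r ^+ (2 * m) * V k l (xpt n_ge3 s t).
  by rewrite mxE /pt scalerA mulVf// scale1r.
have pt1 : U (pt t) by apply: ptU; rewrite gtr0_norm.
have pt2 : U (pt (- t)) by apply: ptU; rewrite normrN gtr0_norm.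
have rm : r ^+ (2 * m) != 0 by rewrite expf_neq0.
exists U; split; first by split=> //; apply/UE; rewrite normr0 mulr_gt0// (lt_trans t0).
exists (range u); split.
  (* The values at the point pt t of U separate the solutions. *)
  rewrite (_ : [set _ | _ in _] = range (fun k => u k \_ U)); last by rewrite image_comp.
  apply: infinite_range_inj => k k' E; apply: contrapT => kk.
  have := congr1 (fun g : 'rV[R]_n -> 'rV[R]_N => g (pt t) 0 l0) E.
  rewrite /= !patchE mem_set// !u_pt => /(mulfI rm).
  exact: Vdist.
move=> _ [k _ <-]; split.
- split=> [l|be l be2].
    by have [C VC] := Vs k l; rewrite uE; exact: Ck_dil (C_ge0 _ _ _ VC) VC.
  have [C VC] := Vs k l; have C0 := C_ge0 _ _ _ VC.
  have sw : (size (word be) <= 2 * m)%N by rewrite size_word be2.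
  have H := hol_dil 1 U_cube C0 (smooth_holE (smooth_dword VC sw)).
  apply: holder_on_hol (_ : 0 <= `|1| * C * (1 + `|r^-1| `^ alpha)) _ => //.
    by rewrite !mulr_ge0// addr_ge0// powR_ge0.
  move: H; congr hol; apply/funext => x.
  by rewrite u_mderiv be2// subnn expr0 -mderivE.
- move=> x /U_rho xr l.
  have [C VC2] := Vs k l; have VC : smooth alpha (cube 1) m.*2 C (V k l) by rewrite -mul2n.
  rewrite uE (iter_laplacian_dil _ _ VC) (Veq k l _ xr) -mul2n -exprMn mulfV// expr1n mul1r.
  congr (a _ 0 l); apply/rowP => j; rewrite !mxE.
  case: (enum_val j) => [i|[be l']] /=; first by rewrite mxE mulrA mulfV// mul1r.
  by rewrite u_mderiv//; exact: mindex_order.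
- split=> [be l be2|]; first by rewrite u_mderiv ?(ltnW be2)// scaler0 Vlow// mulr0.
  exists (@hexp n m n_ge3), l0; have ho := hexp_order n_ge3 m_ge1; split=> //.
  by rewrite u_mderiv ?ho// scaler0 subnn expr0 mul1r.
move=> rs; have := rs _ _ pt2 pt1.
rewrite !ptE mulrN enorm_xpt => /(_ erefl); rewrite -mulrN -!ptE.
move=> /(congr1 (fun v : 'rV[R]_N => v 0 l0)); rewrite !u_pt => /(mulfI rm).
exact: Vodd.
Qed.
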